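(* Let $m\ge2$, let $G\le \mathrm{SU}(m-1)$ be compact and connected, let $Z$ be a connected component of $\mu^{-1}(0)\subset\mathbb{C}^{m-1}$ admitting cohomogeneity-one Lagrangian submanifolds, let $z'\in Z\setminus\{0\}$, let $P=\mathbb{C}z'$ be the complex line through $z'$, and let $\Phi:P\to\mathbb{C}$ be the isomorphism specified in the context. Let $I_1,I_2\subset\mathbb{R}$ be open intervals and let $\gamma:I_1\to\mathbb{C}$, $\xi:I_2\to\mathbb{C}$ be smooth curves satisfying $$\vec{\kappa}_{\gamma} - (m-2)\frac{\gamma^{\perp}}{|\gamma|^{2}} = a\gamma^{\perp},\qquad \vec{\kappa}_{\xi} - (m-2)\frac{\xi^{\perp}}{|\xi|^{2}} = b\,\xi^{\perp}$$ for $a,b\in\mathbb{R}$. Let $$\check F:I_1\times I_2\to\mathbb{C}^2,\qquad \check F(x,y)=\Big(\gamma(x)\xi(y),\ \tfrac12(|\xi(y)|^2-|\gamma(x)|^2)+i(\beta_\xi(y)-\beta_\gamma(x))\Big).$$ Then the image $L$ of the map $$F:G\times I_1\times I_2\to\mathbb{C}^{m-1}\times\mathbb{C},\qquad F(g,x,y)=g\cdot(\Phi\oplus\mathrm{Id})^{-1}\circ\check F(x,y)$$ is an exact cohomogeneity-two $G$-invariant Lagrangian submanifold, immersed away from $\{0\}\times\mathbb{C}$. The restriction of the Liouville form $\lambda$ is given by $$F^*\lambda=d\Big(-\tfrac12\big(|\gamma(x)|^2-|\xi(y)|^2\big)\big(\beta_\gamma(x)-\beta_\xi(y)\big)+\widetilde\beta_\gamma(x)+\widetilde\beta_\xi(y)\Big).$$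 Furthermore: - if $a=b=0$, then $L$ is a special Lagrangian, i.e. $\theta(F)=0$; - if $a=-b=1$, then $L$ is a Lagrangian translator, i.e. $\theta(F)=-\langle F,Je_m\rangle$.
   Context: $\mathbb{C}^m=\mathbb{C}^{m-1}\times\mathbb{C}$ carries its standard metric $\langle\cdot,\cdot\rangle$, Kähler form $\omega_0=\sum dx_i\wedge dy_i$, complex structure $J$, holomorphic volume form $\Omega_0=dz_1\wedge\dots\wedge dz_m$ and Liouville form $\lambda=\frac1{2i}\sum_i(\bar z_idz_i-z_id\bar z_i)$; $e_m=(0,\dots,0,1)$. $G$ acts on $\mathbb{C}^{m-1}$ in the standard way and trivially on the last coordinate. $\mu(z)=-\tfrac12\pi_{\mathfrak g}(iz\bar z^T)$ is the standard moment map $\mathbb{C}^{m-1}\to\mathfrak g$, where $\pi_{\mathfrak g}$ is the projection to $\mathfrak g=\mathrm{Lie}(G)$ (with respect to an Ad-invariant inner product). A $G$-invariant $n$-dimensional manifold is cohomogeneity-$k$ if all its points have the same isotropy type $(H)$ (i.e. stabilisers conjugate to $H$) and $\dim(G/H)=n-k$. The isomorphism $\Phi$: it is the complex-linear map $P\to\mathbb{C}$ with $\Phi(V)=1$, where $V\in P$ is chosen so that $\Omega_0(\nu,V,e_m)=\pm1$ for $\nu$ either of the two unit elements of $\Lambda^{m-2}T_V\mathcal O_V$, $\mathcal O_V$ being the ($(m-2)$-dimensional) $G$-orbit of $V$. $\vec\kappa_\gamma$ is the curvature vector of a curve $\gamma$, and $\gamma^\perp$ is the normal component of its position vector. For a curve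 $\gamma$ on an interval with fixed base point $s_0$, $\beta_\gamma(s)=-\int_{s_0}^s\langle\gamma(t),i\gamma'(t)\rangle dt$ and $\widetilde\beta_\gamma(s)=-\int_{s_0}^s|\gamma(t)|^2\langle\gamma(t),i\gamma'(t)\rangle dt$, with $\langle\cdot,\cdot\rangle$ the real inner product on $\mathbb{C}$. The Lagrangian angle $\theta$ is defined by $F^*\Omega_0=e^{i\theta}\mathrm{vol}_L$. A Lagrangian is special Lagrangian if its mean curvature vector $\vec H$ vanishes (equivalently $\theta$ is constant), and is a Lagrangian translator (in the $e_m$ direction) if $\vec H=e_m^\perp$; this integrates to $\theta(F)+\langle F,Je_m\rangle=c$ for a constant $c$, which may be taken to be $0$ after a translation in the $Je_m$-direction. Exact means that the pullback of $\lambda$ is exact.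
   Formalization: The translator sign is corrected: a=-b=1 gives H=-e_m^perp, θ=<F,Je_m>+c, and a=-b=-1 gives H=e_m^perp, θ=-<F,Je_m>+c; the angles (also θ=0 for a=b=0) are stated only up to an additive constant and up to orientation. *)

(* Defs.v *)
From HB Require Import structures.
From mathcomp Require Import all_boot all_order all_algebra.
From mathcomp Require Import complex.
From mathcomp Require Import all_classical all_reals all_analysis.

Set Implicit Arguments.
Unset Strict Implicit.
Unset Printing Implicit Defensive.

Import Order.TTheory GRing.Theory Num.Theory.
Import numFieldNormedType.Exports.

Local Open Scope classical_set_scope.
Local Open Scope ring_scope.
Local Open Scope complex_scope.
Local Notation Re := complex.Re.
Local Notation Im := complex.Im.

(* The topology of R[i] given by the modulus; matrices carry the product
   topology. *)
HB.instance Definition _ (R : realType) := PseudoPointedMetric.copy R[i] R[i]^o.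

(* C^k is the space of columns 'cV[R[i]]_k; C^(d+1) = C^d x C is split with
   col_mx / usubmx / dsubmx. Every notion of dimension, basis and orthogonality
   below is over the real numbers. *)

Section RealLinearAlgebra.
Context {R : realType} {p q : nat}.
Local Notation C := R[i].
Implicit Types (S : set 'M[C]_(p, q)) (s : seq 'M[C]_(p, q)).

(* Re tr (A B^* ): on columns, the standard real inner product of C^k; on u(d),
   an inner product which is Ad-invariant under U(d). *)
Definition dot (A B : 'M[C]_(p, q)) : R :=
  \sum_i \sum_j Re (A i j * (B i j)^*).

Definition real_basis S s : Prop :=
  (forall v, S v <->
     exists a : nat -> R, v = \sum_(i < size s) (a i)%:C *: s`_i) /\
  (forall a : nat -> R, \sum_(i < size s) (a i)%:C *: s`_i = 0 ->
     forall i : nat, (i < size s)%N -> a i = 0).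

Definition real_dim S (k : nat) : Prop :=
  exists2 s, size s = k & real_basis S s.

Definition orthonormal_basis S s : Prop :=
  real_basis S s /\
  forall i j : nat, (i < size s)%N -> (j < size s)%N ->
    dot s`_i s`_j = (i == j)%:R.

(* Meaningful when S is a real subspace: the projection then exists and is
   unique. *)
Definition orthoproj S (v : 'M[C]_(p, q)) : 'M[C]_(p, q) :=
  xget 0 [set w | S w /\ forall u, S u -> dot (v - w) u = 0].

Definition normal_part S (v : 'M[C]_(p, q)) : 'M[C]_(p, q) :=
  v - orthoproj S v.

End RealLinearAlgebra.

Section ComplexSpace.
Context {R : realType} {k : nat}.
Local Notation C := R[i].

Definition cplxJ (v : 'cV[C]_k) : 'cV[C]_k := 'i *: v.

Definition kaehler (u v : 'cV[C]_k) : R :=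
  \sum_i (Re (u i 0) * Im (v i 0) - Im (u i 0) * Re (v i 0)).

Definition liouville (z v : 'cV[C]_k) : C :=
  \sum_i (2 * 'i)^-1 * ((z i 0)^* * v i 0 - z i 0 * (v i 0)^*).

(* dz_1 /\ ... /\ dz_k evaluated on the k vectors listed in s. *)
Definition holvol (s : seq 'cV[C]_k) : C :=
  \det (\matrix_(i < k, j < k) s`_j i 0).

Definition isotropic (S : set 'cV[C]_k) : Prop :=
  forall u v, S u -> S v -> kaehler u v = 0.

End ComplexSpace.

Section Calculus.
Context {R : realType}.
Local Notation C := R[i].

Definition smooth_on (I : set R) (f : R -> R) : Prop :=
  forall (n : nat) (t : R), I t -> derivable (derive1n n f) t 1.

Definition csmooth_on (I : set R) (c : R -> C) : Prop :=
  smooth_on I (fun t => Re (c t)) /\ smooth_on I (fun t => Im (c t)).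

Definition msmooth p q (c : R -> 'M[C]_(p, q)) : Prop :=
  forall i j, csmooth_on setT (fun t => c t i j).

Definition cderiv (c : R -> C) (t : R) : C :=
  derive1 (fun s => Re (c s)) t +i* derive1 (fun s => Im (c s)) t.

Definition mderiv p q (c : R -> 'M[C]_(p, q)) (t : R) : 'M[C]_(p, q) :=
  \matrix_(i, j) cderiv (fun s => c s i j) t.

Fixpoint iter_derive n (f : 'rV[R]_n -> R) (vs : seq 'rV[R]_n) :
    'rV[R]_n -> R :=
  if vs is v :: vs' then (fun u => 'D_v (iter_derive f vs') u) else f.

(* C^oo on an open subset U of R^n *)
Definition rsmooth_on n (U : set 'rV[R]_n) (f : 'rV[R]_n -> R) : Prop :=
  forall vs u, U u -> differentiable (iter_derive f vs) u.

Definition dirderiv n k (f : 'rV[R]_n -> 'cV[C]_k) (v u : 'rV[R]_n) :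
    'cV[C]_k :=
  \col_i ('D_v (fun w => Re (f w i 0)) u +i* 'D_v (fun w => Im (f w i 0)) u).

(* \int_a^b f for a and b in any order *)
Definition oriented_integral (f : R -> R) (a b : R) : R :=
  if a <= b then Rintegral lebesgue_measure `[a, b] f
  else - Rintegral lebesgue_measure `[b, a] f.

End Calculus.

Section Lagrangians.
Context {R : realType} {k : nat}.
Local Notation C := R[i].

(* N is the image of a Lagrangian immersion into C^k of a second countable
   k-manifold: the latter is covered by countably many charts. *)
Definition immersed_lagrangian (N : set 'cV[C]_k) : Prop :=
  exists (U : nat -> set 'rV[R]_k) (f : nat -> 'rV[R]_k -> 'cV[C]_k),
    N = \bigcup_n (f n @` U n) /\
    forall n, open (U n) /\
      (forall i, rsmooth_on (U n) (fun u => Re (f n u i 0)) /\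
                 rsmooth_on (U n) (fun u => Im (f n u i 0))) /\
      forall u, U n u ->
        (forall v, dirderiv (f n) v u = 0 -> v = 0) /\
        forall v w, kaehler (dirderiv (f n) v u) (dirderiv (f n) w u) = 0.

End Lagrangians.

Section Groups.
Context {R : realType} {d : nat}.
Local Notation C := R[i].
Implicit Types G H : set 'M[C]_d.

Definition SU : set 'M[C]_d := [set g | g \is unitarymx /\ \det g = 1].

Definition is_subgroup G : Prop :=
  [/\ G 1%:M, forall g h, G g -> G h -> G (g *m h)
    & forall g, G g -> G (invmx g)].

(* T_1 G. For G closed this is the Lie algebra of G, by the closed subgroup
   theorem. *)
Definition lie G : set 'M[C]_d :=
  [set A | exists c : R -> 'M[C]_d,
     [/\ msmooth c, forall t, G (c t), c 0 = 1%:M & mderiv c 0 = A]].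

Definition moment_map G (z : 'cV[C]_d) : 'M[C]_d :=
  (- 2^-1) *: orthoproj (lie G) ('i *: (z *m (map_mx conjc z)^T)).

Definition zero_level G : set 'cV[C]_d := [set z | moment_map G z = 0].

Definition dim_quotient G H (n : nat) : Prop :=
  exists dG dH, [/\ real_dim (lie G) dG, real_dim (lie H) dH
                  & dG = (dH + n)%N].

Section Action.
Context {X : Type}.
Variable act : 'M[C]_d -> X -> X.

Definition invariant_set G (N : set X) : Prop :=
  forall g q, G g -> N q -> N (act g q).

Definition isotropy G (q : X) : set 'M[C]_d := [set g | G g /\ act g q = q].

(* N, of dimension n, has cohomogeneity k. *)
Definition cohomogeneity G (n k : nat) (N : set X) : Prop :=
  invariant_set G N /\
  exists H,
    [/\ H `<=` G, is_subgroup H,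
        forall q, N q -> exists2 g, G g &
          isotropy G q = [set g *m h *m invmx g | h in H]
      & dim_quotient G H (n - k)].

End Action.

Definition std_act (g : 'M[C]_d) (z : 'cV[C]_d) : 'cV[C]_d := g *m z.

Definition ext_act (g : 'M[C]_d) (q : 'cV[C]_(d + 1)) : 'cV[C]_(d + 1) :=
  col_mx (g *m usubmx q) (dsubmx q).

Definition elast : 'cV[C]_(d + 1) := col_mx 0 1%:M.

Definition orbit_tangent G (V : 'cV[C]_d) : set 'cV[C]_d :=
  [set A *m V | A in lie G].

(* The orbit of V is (d-1)-dimensional and Omega_0(nu, V, e_(d+1)) = +-1 for
   the unit elements nu = s_1 /\ ... /\ s_(d-1) of the top exterior power of
   its tangent space at V. *)
Definition normalized G (V : 'cV[C]_d) : Prop :=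
  real_dim (orbit_tangent G V) d.-1 /\
  forall s, orthonormal_basis (orbit_tangent G V) s ->
    let w := holvol ([seq col_mx v (0 : 'cV[C]_1) | v <- s]
                       ++ [:: col_mx V (0 : 'cV[C]_1); elast]) in
    w = 1 \/ w = -1.

End Groups.

Section PlaneCurves.
Context {R : realType}.
Local Notation C := R[i].
Implicit Types (I : set R) (c : R -> C).

Definition cdot (z w : C) : R := Re (z * w^*).

Definition cnorm (z : C) : R := Num.sqrt (cdot z z).

Definition regular_curve I c : Prop :=
  csmooth_on I c /\ forall t, I t -> cderiv c t != 0.

Definition unit_tangent c (t : R) : C := (cnorm (cderiv c t))^-1%:C * cderiv c t.

(* derivative of the unit tangent with respect to arclength *)
Definition curvature_vector c (t : R) : C :=
  (cnorm (cderiv c t))^-1%:C * cderiv (unit_tangent c) t.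

Definition position_perp c (t : R) : C :=
  c t - (cdot (c t) (unit_tangent c t))%:C * unit_tangent c t.

(* The curve may pass through the origin, where the equation is singular; there
   it is not imposed. *)
Definition soliton_curve (k : nat) (a : R) I c : Prop :=
  forall t, I t -> c t != 0 ->
    curvature_vector c t
      - k%:R * (position_perp c t / (cnorm (c t) ^+ 2)%:C)
    = a%:C * position_perp c t.

Definition beta c (s0 s : R) : R :=
  - oriented_integral (fun t => cdot (c t) ('i * cderiv c t)) s0 s.

Definition beta_tilde c (s0 s : R) : R :=
  - oriented_integral
      (fun t => cnorm (c t) ^+ 2 * cdot (c t) ('i * cderiv c t)) s0 s.

(* check F; s1 and s2 are the base points of beta_gamma and beta_xi *)
Definition Fcheck (gam xi : R -> C) (s1 s2 x y : R) : C * C :=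
  (gam x * xi y,
   2^-1 * (cnorm (xi y) ^+ 2 - cnorm (gam x) ^+ 2)
     +i* (beta xi s2 y - beta gam s1 x)).

End PlaneCurves.

Section Construction.
Context {R : realType} {d : nat}.
Local Notation C := R[i].

(* The inverse of the complex linear Phi : C V -> C with Phi V = 1 is
   w |-> w *: V. *)
Definition PhiId_inv (V : 'cV[C]_d) (w : C * C) : 'cV[C]_(d + 1) :=
  col_mx (w.1 *: V) (w.2%:M).

Definition Fmap (V : 'cV[C]_d) (gam xi : R -> C) (s1 s2 : R)
    (p : 'M[C]_d * R * R) : 'cV[C]_(d + 1) :=
  let: (g, x, y) := p in ext_act g (PhiId_inv V (Fcheck gam xi s1 s2 x y)).

Definition domain (G : set 'M[C]_d) (I1 I2 : set R) : set ('M[C]_d * R * R) :=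
  [set p | [/\ G p.1.1, I1 p.1.2 & I2 p.2]].

Definition off_axis : set 'cV[C]_(d + 1) := [set q | usubmx q != 0].

End Construction.

(* Geometry of a map F from a subset D of 'M_d x R x R to C^k. The differential
   of F is described through its values on velocities of smooth curves in D; F
   need not be injective. *)
Section ParametrizedGeometry.
Context {R : realType} {d k : nat}.
Local Notation C := R[i].
Local Notation point := ('M[C]_d * R * R)%type.
Variables (F : point -> 'cV[C]_k) (D : set point).
Implicit Types (p : point) (c : R -> point).

Definition smooth_path c : Prop :=
  [/\ msmooth (fun t => (c t).1.1), smooth_on setT (fun t => (c t).1.2),
      smooth_on setT (fun t => (c t).2) & forall t, D (c t)].

(* the image of dF at p *)
Definition tangent p : set 'cV[C]_k :=
  [set v | exists c, [/\ smooth_path c, c 0 = p & mderiv (F \o c) 0 = v]].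

(* F^* lambda = df *)
Definition liouville_primitive (f : point -> R) : Prop :=
  forall c t, smooth_path c ->
    derivable (f \o c) t 1 /\
    liouville (F (c t)) (mderiv (F \o c) t) = (derive1 (f \o c) t)%:C.

Definition exact_map : Prop := exists f, liouville_primitive f.

(* F is invariant under right translation of its first argument by H, and at p
   the kernel of dF is tangent to the fibre g H x {x} x {y}: the induced map on
   (G / H) x I1 x I2 is an immersion at p. *)
Definition immersion_mod (H : set 'M[C]_d) p : Prop :=
  (forall h, H h -> F (p.1.1 *m h, p.1.2, p.2) = F p) /\
  forall c, smooth_path c -> c 0 = p -> mderiv (F \o c) 0 = 0 ->
    [/\ lie H (invmx p.1.1 *m mderiv (fun t => (c t).1.1) 0),
        derive1 (fun t => (c t).1.2) 0 = 0 & derive1 (fun t => (c t).2) 0 = 0].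

(* The sum over an orthonormal tangent frame s of II(s_j, s_j), where
   II(v, v) is the normal part of the acceleration of a curve with velocity v. *)
Definition mean_curvature p (h : 'cV[C]_k) : Prop :=
  forall s (c : nat -> R -> point),
    orthonormal_basis (tangent p) s ->
    (forall j, (j < size s)%N ->
       [/\ smooth_path (c j), c j 0 = p & mderiv (F \o c j) 0 = s`_j]) ->
    h = \sum_(j < size s)
          normal_part (tangent p) (mderiv (mderiv (F \o c j)) 0).

(* F^* Omega_0 = e^(i theta) vol for the orientation in which an orthonormal
   tangent frame is positive when Omega_0 equals +e^(i theta) on it. *)
Definition lagrangian_angle (theta : point -> R) : Prop :=
  (forall p s, D p -> orthonormal_basis (tangent p) s ->
     let w := cos (theta p) +i* sin (theta p) in
     holvol s = w \/ holvol s = - w) /\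
  (forall c, smooth_path c -> continuous (theta \o c)).

Definition special_lagrangian : Prop := forall p, D p -> mean_curvature p 0.

(* translator in the direction e *)
Definition lagrangian_translator (e : 'cV[C]_k) : Prop :=
  forall p, D p -> mean_curvature p (normal_part (tangent p) e).

End ParametrizedGeometry.

(* Main.v *)
Require Import Defs.
From HB Require Import structures.
From mathcomp Require Import all_boot all_order all_algebra.
From mathcomp Require Import complex.
From mathcomp Require Import all_classical all_reals all_analysis.
From mathcomp Require Import ring lra.

Import Order.TTheory GRing.Theory Num.Theory.
Import numFieldNormedType.Exports.

Set Implicit Arguments.
Unset Strict Implicit.
Unset Printing Implicit Defensive.

Local Open Scope classical_set_scope.

Local Open Scope complex_scope.
Local Open Scope ring_scope.

Local Notation Re := complex.Re.
Local Notation Im := complex.Im.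

(* At F(g,x,y), with q = gV, w = gamma xi and rho = |gamma|^2 + |xi|^2, the
   tangent space consists of the vectors
     (w A q + (a gamma' xi + b gamma xi') q, b conj(xi) xi' - a conj(gamma) gamma')
   for A in the Lie algebra of G and a, b real. Since mu(V) = 0, the vectors A q
   span an isotropic space Hermitian-orthogonal to q, and the x- and
   y-velocities are Hermitian-orthogonal; so F is Lagrangian. A tangent frame
   has determinant +-w^(m-2) gamma' xi' rho, so the angle is the argument of
   w^(m-2) gamma' xi'. The soliton equations say that
   arg(gamma^(m-2) gamma') + k beta_gamma is constant modulo pi, also across the
   zeros of gamma, where k is the coefficient of gamma^perp; similarly for xi.

   For the mean curvature H, a tangent field v extends along every path as a
   field whose derivative is M u, where u is the velocity of the path and M is a
   complex linear map depending on v only. Differentiating omega(v, u) = 0 and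
   summing over a tangent frame, which is a unitary basis, shows that
   omega(v, H) = Im tr M, and this trace is read off the soliton equations. *)

(** The Lie algebra of G is given only as the set of velocities at 1 of smooth curves in G, and such
    a curve need not be a one-parameter group. Compactness supplies the exponentials. They serve
    twice: det exp(tA) = 1 gives tr A = 0, which removes A from tr M; and exp(tA) fixes V when A V =
    0, which identifies the Lie algebra of the stabiliser of V with the kernel of A -> A V. The
    immersion modulo the stabiliser and the count of dimensions rest on this.

    Branches of the argument are never chosen. The phase z / conj z = e^(2i arg z) replaces arg z;
    it ignores nonzero real factors, so the sign of a frame, the factor rho and the factor s - t of
    gamma(s) near a zero t all disappear. Equalities modulo pi remain, which is what an angle of an
    unoriented frame asks for.

    The map M exists because a real linear map on a Lagrangian subspace extends uniquely to a
    complex linear one. It is written down explicitly, so that second derivatives of curves in G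
    never have to be computed. *)

(** * Complex numbers through real and imaginary parts *)

Section ComplexNumbers.
Context {R : realType}.
Local Notation C := R[i].
Implicit Types (z w : C) (a : R).

Lemma cplx_eq z w : Re z = Re w -> Im z = Im w -> z = w.
Proof. by case: z w => [a b] [c d] /= -> ->. Qed.

Lemma ReD z w : Re (z + w) = Re z + Re w. Proof. exact: raddfD. Qed.
Lemma ImD z w : Im (z + w) = Im z + Im w. Proof. exact: raddfD. Qed.
Lemma ReN z : Re (- z) = - Re z. Proof. exact: raddfN. Qed.
Lemma ImN z : Im (- z) = - Im z. Proof. exact: raddfN. Qed.
Lemma ReM z w : Re (z * w) = Re z * Re w - Im z * Im w.
Proof. by case: z w => [a b] [c d]. Qed.
Lemma ImM z w : Im (z * w) = Re z * Im w + Im z * Re w.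
Proof. by case: z w => [a b] [c d]. Qed.
Lemma ReJ z : Re z^* = Re z. Proof. by case: z. Qed.
Lemma ImJ z : Im z^* = - Im z. Proof. by case: z. Qed.
Lemma Re_real a : Re a%:C = a. Proof. by []. Qed.
Lemma Im_real a : Im a%:C = 0. Proof. by []. Qed.
Lemma Re_i : Re ('i : C) = 0. Proof. by []. Qed.
Lemma Im_i : Im ('i : C) = 1. Proof. by []. Qed.
Lemma Re0 : Re (0 : C) = 0. Proof. by []. Qed.
Lemma Im0 : Im (0 : C) = 0. Proof. by []. Qed.
Lemma Re1 : Re (1 : C) = 1. Proof. by []. Qed.
Lemma Im1 : Im (1 : C) = 0. Proof. by []. Qed.

Definition ReIm := (ReD, ImD, ReN, ImN, ReM, ImM, ReJ, ImJ, Re_real, Im_real,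
  Re_i, Im_i, Re0, Im0, Re1, Im1).

Lemma conjD z w : (z + w)^* = z^* + w^*. Proof. exact: raddfD. Qed.
Lemma conjM z w : (z * w)^* = z^* * w^*. Proof. exact: rmorphM. Qed.
Lemma conjN z : (- z)^* = - z^*. Proof. exact: raddfN. Qed.
Lemma conjcR a : (a%:C)^* = a%:C. Proof. exact: conjc_real. Qed.

Definition sqnorm z : R := Re z ^+ 2 + Im z ^+ 2.

Lemma mulcJ z : z * z^* = (sqnorm z)%:C.
Proof. by apply: cplx_eq; rewrite !ReIm /sqnorm; ring. Qed.

Lemma mulJc z : z^* * z = (sqnorm z)%:C.
Proof. by rewrite mulrC mulcJ. Qed.

Lemma sqnorm_ge0 z : 0 <= sqnorm z.
Proof. by rewrite addr_ge0 ?sqr_ge0. Qed.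

Lemma sqnorm_eq0 z : (sqnorm z == 0) = (z == 0).
Proof.
rewrite /sqnorm paddr_eq0 ?sqr_ge0 // !sqrf_eq0.
by case: z => a b; rewrite eq_complex.
Qed.

Lemma sqnorm_gt0 z : (0 < sqnorm z) = (z != 0).
Proof. by rewrite lt_def sqnorm_ge0 andbT sqnorm_eq0. Qed.

Lemma sqnormM z w : sqnorm (z * w) = sqnorm z * sqnorm w.
Proof. by rewrite /sqnorm !ReIm; ring. Qed.

Lemma Re_sum I (r : seq I) P (F : I -> C) :
  Re (\sum_(i <- r | P i) F i) = \sum_(i <- r | P i) Re (F i).
Proof. exact: raddf_sum. Qed.

Lemma Im_sum I (r : seq I) P (F : I -> C) :
  Im (\sum_(i <- r | P i) F i) = \sum_(i <- r | P i) Im (F i).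
Proof. exact: raddf_sum. Qed.

End ComplexNumbers.

(** * The Hermitian product on columns *)

Section HermitianMatrices.
Context {R : realType}.
Local Notation C := R[i].

Definition hadj p q (A : 'M[C]_(p, q)) : 'M[C]_(q, p) := (map_mx Num.conj A)^T.

Lemma hadjM p q r (A : 'M[C]_(p, q)) (B : 'M[C]_(q, r)) :
  hadj (A *m B) = hadj B *m hadj A.
Proof. by rewrite /hadj map_mxM trmx_mul. Qed.

Lemma hadjD p q (A B : 'M[C]_(p, q)) : hadj (A + B) = hadj A + hadj B.
Proof. by apply/matrixP => i j; rewrite !mxE conjD. Qed.

Lemma hadjN p q (A : 'M[C]_(p, q)) : hadj (- A) = - hadj A.
Proof. by apply/matrixP => i j; rewrite !mxE conjN. Qed.

Lemma hadjZ p q a (A : 'M[C]_(p, q)) : hadj (a *: A) = a^* *: hadj A.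
Proof. by apply/matrixP => i j; rewrite !mxE conjM. Qed.

Lemma hadjK p q (A : 'M[C]_(p, q)) : hadj (hadj A) = A.
Proof. by apply/matrixP => i j; rewrite !mxE conjCK. Qed.

Lemma hadj1 p : hadj 1%:M = 1%:M :> 'M[C]_p.
Proof. by apply/matrixP => i j; rewrite !mxE eq_sym rmorph_nat. Qed.

Lemma hadj0 p q : hadj 0 = 0 :> 'M[C]_(q, p).
Proof. by apply/matrixP => i j; rewrite !mxE conjC0. Qed.

(** Conjugate-linear in the first argument, so that the real part is [dot] and the imaginary part is
    [kaehler]: one product carries both. *)
Definition hip p (u v : 'cV[C]_p) : C := (hadj u *m v) 0 0.

Lemma hipE p (u v : 'cV[C]_p) : hip u v = \sum_i (u i 0)^* * v i 0.
Proof. by rewrite /hip mxE; apply: eq_bigr => i _; rewrite !mxE. Qed.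

Lemma hipDl p (u v w : 'cV[C]_p) : hip (u + v) w = hip u w + hip v w.
Proof. by rewrite /hip hadjD mulmxDl mxE. Qed.

Lemma hipDr p (u v w : 'cV[C]_p) : hip w (u + v) = hip w u + hip w v.
Proof. by rewrite /hip mulmxDr mxE. Qed.

Lemma hipZl p a (u v : 'cV[C]_p) : hip (a *: u) v = a^* * hip u v.
Proof. by rewrite /hip hadjZ -scalemxAl mxE. Qed.

Lemma hipZr p a (u v : 'cV[C]_p) : hip u (a *: v) = a * hip u v.
Proof. by rewrite /hip -scalemxAr mxE. Qed.

Lemma hipNr p (u v : 'cV[C]_p) : hip u (- v) = - hip u v.
Proof. by rewrite -scaleN1r hipZr mulN1r. Qed.

Lemma hipBr p (u v w : 'cV[C]_p) : hip w (u - v) = hip w u - hip w v.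
Proof. by rewrite hipDr hipNr. Qed.

Lemma hipNl p (u v : 'cV[C]_p) : hip (- u) v = - hip u v.
Proof. by rewrite /hip hadjN mulNmx mxE. Qed.

Lemma hip0l p (u : 'cV[C]_p) : hip 0 u = 0.
Proof. by rewrite /hip hadj0 mul0mx mxE. Qed.

Lemma hip0r p (u : 'cV[C]_p) : hip u 0 = 0.
Proof. by rewrite /hip mulmx0 mxE. Qed.

Lemma hipJ p (u v : 'cV[C]_p) : (hip u v)^* = hip v u.
Proof.
rewrite !hipE rmorph_sum; apply: eq_bigr => i _.
by rewrite rmorphM /= conjCK mulrC.
Qed.

Lemma hip_mull p (A : 'M[C]_p) (u v : 'cV[C]_p) :
  hip (A *m u) v = hip u (hadj A *m v).
Proof. by rewrite /hip hadjM mulmxA. Qed.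

Lemma hip_mulr p (A : 'M[C]_p) (u v : 'cV[C]_p) :
  hip u (A *m v) = hip (hadj A *m u) v.
Proof. by rewrite hip_mull hadjK. Qed.

Lemma hip_sumr p I (r : seq I) P (F : I -> 'cV[C]_p) u :
  hip u (\sum_(i <- r | P i) F i) = \sum_(i <- r | P i) hip u (F i).
Proof. by rewrite /hip mulmx_sumr summxE. Qed.

Lemma hip_unitary p (g : 'M[C]_p) (u v : 'cV[C]_p) :
  hadj g *m g = 1%:M -> hip (g *m u) (g *m v) = hip u v.
Proof. by move=> gg; rewrite hip_mull mulmxA gg mul1mx. Qed.

Lemma hip_ge0 p (u : 'cV[C]_p) : hip u u = (\sum_i sqnorm (u i 0))%:C.
Proof.
by rewrite hipE rmorph_sum; apply: eq_bigr => i _; rewrite mulJc.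
Qed.

Lemma hip_eq0 p (u : 'cV[C]_p) : hip u u = 0 -> u = 0.
Proof.
rewrite hip_ge0 => /complexI /eqP.
rewrite psumr_eq0 => [/allP h|i _]; last exact: sqnorm_ge0.
apply/colP => i; rewrite mxE; apply/eqP; rewrite -sqnorm_eq0.
by have := h i; rewrite mem_index_enum /=; exact.
Qed.

Lemma hip_col p q (a c : 'cV[C]_p) (b d : 'cV[C]_q) :
  hip (col_mx a b) (col_mx c d) = hip a c + hip b d.
Proof.
rewrite !hipE big_split_ord; congr (_ + _); apply: eq_bigr => i _;
  by rewrite ?col_mxEu ?col_mxEd.
Qed.

Lemma hip_scalar (a b : C) : hip (a%:M : 'cV_1) b%:M = a^* * b.
Proof. by rewrite hipE big_ord1 !mxE !mulr1n. Qed.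

Lemma dotE p (u v : 'cV[C]_p) : dot u v = Re (hip u v).
Proof.
rewrite /dot hipE Re_sum; apply: eq_bigr => i _.
by rewrite big_ord1 !ReIm; ring.
Qed.

Lemma kaehlerE p (u v : 'cV[C]_p) : kaehler u v = Im (hip u v).
Proof.
rewrite /kaehler hipE Im_sum; apply: eq_bigr => i _.
by rewrite !ReIm; ring.
Qed.

Lemma dot_trace p q (A B : 'M[C]_(p, q)) : dot A B = Re (\tr (hadj B *m A)).
Proof.
rewrite /dot exchange_big /= /mxtrace Re_sum; apply: eq_bigr => j _.
rewrite mxE Re_sum; apply: eq_bigr => i _.
by rewrite !mxE mulrC.
Qed.

End HermitianMatrices.

(** * Real subspaces, orthonormal bases and orthogonal projection *)

Section RealSubspaces.
Context {R : realType} {p q : nat}.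
Local Notation C := R[i].
Local Notation M := 'M[C]_(p, q).
Implicit Types (S : set M) (s : seq M) (u v w : M) (a : R).

Lemma dotDl u v w : dot (u + v) w = dot u w + dot v w.
Proof.
rewrite /dot -big_split; apply: eq_bigr => i _.
rewrite -big_split; apply: eq_bigr => j _.
by rewrite mxE mulrDl ReD.
Qed.

Lemma dotZl a u w : dot (a%:C *: u) w = a * dot u w.
Proof.
rewrite /dot mulr_sumr; apply: eq_bigr => i _.
rewrite mulr_sumr; apply: eq_bigr => j _.
by rewrite mxE -mulrA [LHS]ReM Re_real Im_real mul0r subr0.
Qed.

Lemma dotC u v : dot u v = dot v u.
Proof.
rewrite /dot; apply: eq_bigr => i _; apply: eq_bigr => j _.
by rewrite !ReIm; ring.
Qed.

Lemma dotNl u w : dot (- u) w = - dot u w.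
Proof.
by rewrite -scaleN1r -[-1](rmorphN1 (real_complex R)) dotZl mulN1r.
Qed.

Lemma dotBl u v w : dot (u - v) w = dot u w - dot v w.
Proof. by rewrite dotDl dotNl. Qed.

Lemma dot0l w : dot 0 w = 0.
Proof. by rewrite -(subrr w) dotBl subrr. Qed.

Lemma dot_suml I (r : seq I) P (F : I -> M) w :
  dot (\sum_(i <- r | P i) F i) w = \sum_(i <- r | P i) dot (F i) w.
Proof.
apply: (big_morph (fun u => dot u w)); last exact: dot0l.
by move=> x y; rewrite dotDl.
Qed.

Lemma dot_sqnorm u : dot u u = \sum_i \sum_j sqnorm (u i j).
Proof.
rewrite /dot; apply: eq_bigr => i _; apply: eq_bigr => j _.
by rewrite mulcJ.
Qed.

Lemma dot_ge0 u : 0 <= dot u u.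
Proof.
rewrite dot_sqnorm; apply: sumr_ge0 => i _; apply: sumr_ge0 => j _.
exact: sqnorm_ge0.
Qed.

Lemma dot_eq0 u : dot u u = 0 -> u = 0.
Proof.
rewrite dot_sqnorm => /eqP.
rewrite psumr_eq0 => [/allP h|i _]; last first.
  by apply: sumr_ge0 => j _; exact: sqnorm_ge0.
apply/matrixP => i j; rewrite mxE; apply/eqP; rewrite -sqnorm_eq0.
have := h i; rewrite mem_index_enum /= => /(_ isT).
rewrite psumr_eq0 => [/allP h'|k _]; last exact: sqnorm_ge0.
by have := h' j; rewrite mem_index_enum /=; exact.
Qed.

Definition real_subspace S :=
  S 0 /\ forall a u v, S u -> S v -> S (a%:C *: u + v).

Lemma subspaceD S u v : real_subspace S -> S u -> S v -> S (u + v).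
Proof. by case=> _ h Su Sv; rewrite -[u]scale1r; exact: (h 1). Qed.

Lemma subspaceZ S a u : real_subspace S -> S u -> S (a%:C *: u).
Proof. by case=> S0 h Su; rewrite -[_ *: _]addr0; exact: h. Qed.

Lemma subspaceB S u v : real_subspace S -> S u -> S v -> S (u - v).
Proof.
move=> SS Su Sv; apply: subspaceD => //.
by rewrite -scaleN1r -[-1](rmorphN1 (real_complex R)); apply: subspaceZ.
Qed.

Lemma subspace_sum S I (r : seq I) (P : pred I) (F : I -> M) : real_subspace S ->
  (forall i, P i -> S (F i)) -> S (\sum_(i <- r | P i) F i).
Proof.
move=> SS h; apply: big_ind => //; first by case: SS.
by move=> x y Sx Sy; exact: subspaceD.
Qed.

Definition orthonormal s := forall i j : nat,
  (i < size s)%N -> (j < size s)%N -> dot s`_i s`_j = (i == j)%:R.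

(** Real coordinates in which [dot] is the Euclidean product; rank bounds for real matrices become
    available. *)
Definition realrow u : 'rV[R]_(p * q + p * q) :=
  row_mx (mxvec (\matrix_(i, j) Re (u i j))) (mxvec (\matrix_(i, j) Im (u i j))).

Lemma mxvec_dot (A B : 'M[R]_(p, q)) :
  (mxvec A *m (mxvec B)^T) 0 0 = \sum_i \sum_j A i j * B i j.
Proof.
rewrite mxE pair_bigA /=.
rewrite (reindex _ (curry_mxvec_bij _ _)) /=.
by apply: eq_bigr => -[i j] _ /=; rewrite mxE !mxvecE.
Qed.

Lemma realrow_dot u v : (realrow u *m (realrow v)^T) 0 0 = dot u v.
Proof.
rewrite /realrow tr_row_mx mul_row_col [LHS]mxE !mxvec_dot -big_split /=.
apply: eq_bigr => i _; rewrite -big_split /=; apply: eq_bigr => j _.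
by rewrite !mxE !ReIm; ring.
Qed.

(** The Gram matrix is the identity, and its rank is at most the length of the real rows. *)
Lemma orthonormal_size s : orthonormal s -> (size s <= p * q + p * q)%N.
Proof.
move=> hs; pose A := \matrix_(i < size s) realrow s`_i.
have AA : A *m A^T = 1%:M.
  apply/matrixP => i j.
  have := hs _ _ (ltn_ord i) (ltn_ord j); rewrite -realrow_dot => hij.
  rewrite [RHS]mxE [RHS](esym hij) !mxE.
  by apply: eq_bigr => k _; rewrite !mxE.
have := mulmx_max_rank A A^T.
by rewrite AA mxrank1.
Qed.

Lemma orthonormal_free s (a : nat -> R) i : orthonormal s -> (i < size s)%N ->
  dot (\sum_(j < size s) (a j)%:C *: s`_j) s`_i = a i.
Proof.
move=> hs li; rewrite dot_suml (bigD1 (Ordinal li)) //= dotZl hs // eqxx mulr1.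
rewrite big1 ?addr0 // => j ji; rewrite dotZl hs //.
by rewrite (negbTE (ji : nat_of_ord j != i)) mulr0.
Qed.

(* Orthonormal families have bounded length, and one of maximal length spans. *)
Lemma ex_orthonormal_basis S : real_subspace S ->
  exists s, orthonormal_basis S s.
Proof.
move=> SS.
pose P n := `[< exists2 s, size s = n & (forall i, (i < n)%N -> S s`_i) /\ orthonormal s >].
have P0 : exists n, P n.
  by exists 0%N; apply/asboolP; exists [::].
have Pb n : P n -> (n <= p * q + p * q)%N.
  by move/asboolP => [s <- [_ /orthonormal_size]].
have [n /asboolP[s sn [sS so]] nmax] := ex_maxnP P0 Pb.
exists s; split=> //; split=> [v|a a0 i li]; last first.
  by rewrite -(orthonormal_free a so li) a0 dot0l.
split=> [Sv|[a ->]]; last first.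
  apply: subspace_sum => // i _; apply: subspaceZ => //.
  by apply: sS; rewrite -sn.
pose a i := dot v s`_i.
exists a; apply/eqP; rewrite -subr_eq0; apply/eqP.
set r := v - _.
have Sr : S r.
  apply: subspaceB => //; apply: subspace_sum => // i _; apply: subspaceZ => //.
  by apply: sS; rewrite -sn.
have rs i : (i < size s)%N -> dot r s`_i = 0.
  by move=> li; rewrite /r dotBl orthonormal_free // subrr.
have [//|r0] := pselect (r = 0).
have rr : 0 < dot r r.
  rewrite lt_def dot_ge0 andbT; apply/eqP => /dot_eq0; exact: r0.
pose e := (Num.sqrt (dot r r))^-1%:C *: r.
have Se : S e by apply: subspaceZ.
have es i : (i < size s)%N -> dot e s`_i = 0.
  by move=> li; rewrite dotZl rs // mulr0.
have ee : dot e e = 1.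
  rewrite dotZl dotC dotZl mulrA -expr2 exprVn sqr_sqrtr ?ltW //.
  by rewrite mulVf // gt_eqF.
have : P n.+1.
  apply/asboolP; exists (rcons s e); rewrite ?size_rcons ?sn //.
  split=> [i|i j].
    rewrite nth_rcons sn ltnS leq_eqVlt => /orP[/eqP->|li].
      by rewrite ltnn eqxx.
    by rewrite li; apply: sS.
  rewrite size_rcons !ltnS !nth_rcons => li lj.
  case: ltngtP li => // li _; case: ltngtP lj => // lj _.
  - exact: so.
  - by rewrite dotC es // lj (ltn_eqF li).
  - by rewrite es // li (gtn_eqF lj).
  - by rewrite ee li lj eqxx.
by move/nmax; rewrite ltnn.
Qed.

Lemma basis_mem S s i : real_basis S s -> (i < size s)%N -> S s`_i.
Proof.
move=> [h _] li; apply/h; exists (fun j => (j == i)%:R).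
rewrite (bigD1 (Ordinal li)) //= eqxx scale1r big1 ?addr0 // => j ji.
by rewrite (negbTE (ji : nat_of_ord j != i)) scale0r.
Qed.

(** The expansion in an orthonormal basis is a projection, so the default value of [xget] is never
    returned. *)
Lemma orthoprojP S v : real_subspace S ->
  S (orthoproj S v) /\ forall u, S u -> dot (v - orthoproj S v) u = 0.
Proof.
move=> SS; have [s [hb so]] := ex_orthonormal_basis SS.
apply: (@xgetPex _ 0 [set w | S w /\ forall u, S u -> dot (v - w) u = 0]).
exists (\sum_(i < size s) (dot v s`_i)%:C *: s`_i); split.
  by apply/hb.1; exists (fun i => dot v s`_i).
move=> u /hb.1[a ->]; rewrite dotC dot_suml big1 // => i _.
rewrite dotZl dotC dotBl (orthonormal_free (fun i => dot v s`_i)) //.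
by rewrite subrr mulr0.
Qed.

End RealSubspaces.

(** * Frames of isotropic spaces *)

Section UnitaryFrames.
Context {R : realType} {k : nat}.
Local Notation C := R[i].
Local Notation cV := 'cV[C]_k.
Implicit Types (T : set cV) (s : seq cV).

(** The number n of columns is kept apart from [size s]: the frame can be square before the length
    of s is known, and [\det (frame s k)] is then [holvol s] by definition. *)
Definition frame s n : 'M[C]_(k, n) := \matrix_(i, j) s`_j i 0.

Lemma frame_hip s n (A : 'M[C]_k) i j :
  (hadj (frame s n) *m A *m frame s n) i j = hip s`_i (A *m s`_j).
Proof.
rewrite -mulmxA mxE hipE; apply: eq_bigr => l _.
by rewrite !mxE; congr (_ * _); apply: eq_bigr => l' _; rewrite !mxE.
Qed.

(** On an isotropic space the Hermitian product takes real values, so real orthonormality is already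
    Hermitian orthonormality. *)
Lemma isotropic_orthonormal T s : isotropic T -> orthonormal_basis T s ->
  hadj (frame s (size s)) *m frame s (size s) = 1%:M.
Proof.
move=> iT [bT oT]; apply/matrixP => i j.
rewrite -[hadj _]mulmx1 frame_hip mul1mx [RHS]mxE.
have := oT _ _ (ltn_ord i) (ltn_ord j).
have := iT _ _ (basis_mem bT (ltn_ord i)) (basis_mem bT (ltn_ord j)).
rewrite dotE kaehlerE => h1 h2; apply: cplx_eq; rewrite ?h1 ?h2.
  by rewrite -(rmorph_nat (real_complex R)).
by rewrite -(rmorph_nat (real_complex R)).
Qed.

Lemma frame_span T s n (v : 'I_n -> cV) : real_basis T s ->
  (forall j, T (v j)) -> exists B : 'M[R]_(size s, n),
    \matrix_(i, j) v j i 0 = frame s (size s) *m map_mx (real_complex R) B.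
Proof.
move=> [bT _] vT.
have /choice[a ha] j : exists a : nat -> R, v j = \sum_(i < size s) (a i)%:C *: s`_i.
  by apply/bT.
exists (\matrix_(i, j) a j i); apply/matrixP => i j.
rewrite !mxE ha summxE; apply: eq_bigr => l _.
by rewrite !mxE mulrC.
Qed.

(** Unitarity bounds the length of s above by k; the invertible matrix [W], which factors through s,
    bounds it below. The factor between them is a real matrix, so the determinants differ by a real
    number and the angle modulo pi can be read off any tangent frame. *)
Lemma lagrangian_frame T s (v : 'I_k -> cV) :
    isotropic T -> orthonormal_basis T s -> (forall j, T (v j)) ->
    \det (\matrix_(i, j) v j i 0) != 0 ->
  [/\ size s = k,
      hadj (frame s k) *m frame s k = 1%:M
    & exists r : R, \det (\matrix_(i, j) v j i 0) = r%:C * \det (frame s k)].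
Proof.
move=> iT bT vT; set W := (\matrix_(i, j) v j i 0) => W0.
have u := isotropic_orthonormal iT bT.
have [B] := frame_span bT.1 vT; rewrite -/W => hB.
have sk : size s = k.
  apply/anti_leq/andP; split.
    have : (\rank (hadj (frame s (size s)) *m frame s (size s)) <= k)%N.
      exact: leq_trans (mxrankM_maxl _ _) (rank_leq_col _).
    by rewrite u mxrank1.
  have : (\rank W <= size s)%N.
    rewrite hB; exact: leq_trans (mxrankM_maxl _ _) (rank_leq_col _).
  by rewrite mxrank_unit // unitmxE unitfE.
move: B u hB; rewrite sk => B u hB; split=> //.
by exists (\det B); rewrite hB det_mulmx det_map_mx mulrC.
Qed.

Lemma trace_frame s (A : 'M[C]_k) : hadj (frame s k) *m frame s k = 1%:M ->
  \sum_(j < k) hip s`_j (A *m s`_j) = \tr A.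
Proof.
move=> u; have u' := mulmx1C u.
rewrite -[in RHS](mulmx1 A) -u' mulmxA mxtrace_mulC mulmxA /mxtrace.
by apply: eq_bigr => j _; rewrite frame_hip.
Qed.

Lemma frame_expand s (v : cV) : hadj (frame s k) *m frame s k = 1%:M ->
  v = \sum_(j < k) hip s`_j v *: s`_j.
Proof.
move=> /mulmx1C u; rewrite -[LHS]mul1mx -u -mulmxA.
apply/colP => i; rewrite mxE summxE; apply: eq_bigr => j _.
rewrite !mxE mulrC hipE; congr (_ * _).
by apply: eq_bigr => l _; rewrite !mxE.
Qed.

End UnitaryFrames.

(** * Derivatives and smoothness of real functions *)

Section RealDerivatives.
Context {R : realType}.
Implicit Types (f g : R -> R) (t a b : R).

Lemma derivD f g t a b : is_derive t 1 f a -> is_derive t 1 g b ->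
  is_derive t 1 (fun s => f s + g s) (a + b).
Proof. by move=> hf hg; exact: is_deriveD. Qed.

Lemma derivN f t a : is_derive t 1 f a -> is_derive t 1 (fun s => - f s) (- a).
Proof. by move=> hf; exact: is_deriveN. Qed.

Lemma derivB f g t a b : is_derive t 1 f a -> is_derive t 1 g b ->
  is_derive t 1 (fun s => f s - g s) (a - b).
Proof. by move=> hf hg; apply: derivD => //; exact: derivN. Qed.

Lemma derivM f g t a b : is_derive t 1 f a -> is_derive t 1 g b ->
  is_derive t 1 (fun s => f s * g s) (a * g t + f t * b).
Proof.
move=> hf hg; apply: is_derive_eq (is_deriveM hf hg) _.
by rewrite addrC /GRing.scale /= [g t * a]mulrC.
Qed.

Lemma deriv_cst t a : is_derive t 1 (fun=> a : R) 0.
Proof. exact: is_derive_cst. Qed.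

Lemma deriv_uniq f t a b : is_derive t 1 f a -> is_derive t 1 f b -> a = b.
Proof. by move=> [_ <-] [_ <-]. Qed.

Lemma deriv_derive1 f t a : is_derive t 1 f a -> derive1 f t = a.
Proof. by move=> [_ h]; rewrite derive1E. Qed.

Lemma derivableE f t : derivable f t 1 -> is_derive t 1 f (derive1 f t).
Proof. by move=> h; split => //; rewrite derive1E. Qed.

Lemma deriv_eq f t a b : is_derive t 1 f a -> a = b -> is_derive t 1 f b.
Proof. by move=> h <-. Qed.

Lemma deriv_continuous f t a : is_derive t 1 f a -> {for t, continuous f}.
Proof.
by move=> [h _]; apply/differentiable_continuous; rewrite -derivable1_diffP.
Qed.

Lemma deriv_comp f g t a b : is_derive (g t) 1 f a -> is_derive t 1 g b ->
  is_derive t 1 (fun s => f (g s)) (a * b).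
Proof. by move=> hf hg; exact: is_derive1_comp. Qed.

Lemma deriv_aff t a b : is_derive t 1 (fun s => a + b * s) b.
Proof.
have h : is_derive t 1 (fun s : R => s) 1 := is_derive_id _ _.
apply: deriv_eq (derivD (deriv_cst t a) (derivM (deriv_cst t b) h)) _.
by rewrite /= mul0r !add0r mulr1.
Qed.

(* [smooth_on setT], made opaque to unification. *)
Variant smooth (f : R -> R) : Prop := Smooth of smooth_on setT f.

Lemma smoothP f : smooth f <-> smooth_on setT f.
Proof. by split=> [[]|/Smooth]. Qed.

Lemma derive1nSn f n : derive1n n.+1 f = derive1n n (derive1 f).
Proof. by rewrite /derive1n -iterSr. Qed.

Lemma smoothW f t : smooth f -> is_derive t 1 f (derive1 f t).
Proof. by case=> h; apply: derivableE; exact: (h 0%N t). Qed.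

Lemma smooth_derive1 f : smooth f -> smooth (derive1 f).
Proof. by case=> h; split=> n t _; rewrite -derive1nSn; exact: h. Qed.

(** Induction on the order of the derivative, for all members of the class at once. Smoothness is
    thereby reduced to exhibiting a class stable under derivation. *)
Lemma smooth_class (K : (R -> R) -> Prop) :
  (forall f, K f -> exists2 g, K g & forall t, is_derive t 1 f (g t)) ->
  forall f, K f -> smooth f.
Proof.
move=> h f Kf; split=> n; elim: n f Kf => [|n IH] f Kf t _.
  by have [g _ /(_ t)[]] := h f Kf.
have [g Kg fg] := h f Kf.
have -> : derive1n n.+1 f = derive1n n g.
  by rewrite derive1nSn; congr derive1n; apply/funext => s; exact: deriv_derive1.
exact: IH.
Qed.

(** Products alone are not stable under derivation, since the product rule yields sums of products;
    the class generated by both operations is. *)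
Inductive smooth_alg : (R -> R) -> Prop :=
| smooth_alg_base f : smooth f -> smooth_alg f
| smooth_algD f g : smooth_alg f -> smooth_alg g ->
    smooth_alg (fun t => f t + g t)
| smooth_algM f g : smooth_alg f -> smooth_alg g ->
    smooth_alg (fun t => f t * g t).

Lemma smooth_alg_smooth f : smooth_alg f -> smooth f.
Proof.
apply: smooth_class => {}f; elim=> {f} [f sf|f g _ [f' Kf ff] _ [g' Kg gg]|f g hf [f' Kf ff] hg [g' Kg gg]].
- exists (derive1 f); last by move=> t; exact: smoothW.
  exact/smooth_alg_base/smooth_derive1.
- by exists (fun t => f' t + g' t); [exact: smooth_algD|move=> t; exact: derivD].
- exists (fun t => f' t * g t + f t * g' t); last by move=> t; exact: derivM.
  by apply: smooth_algD; exact: smooth_algM.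
Qed.

Lemma smoothD f g : smooth f -> smooth g -> smooth (fun t => f t + g t).
Proof. by move=> hf hg; apply/smooth_alg_smooth/smooth_algD; exact: smooth_alg_base. Qed.

Lemma smoothM f g : smooth f -> smooth g -> smooth (fun t => f t * g t).
Proof. by move=> hf hg; apply/smooth_alg_smooth/smooth_algM; exact: smooth_alg_base. Qed.

Lemma smooth_cst a : smooth (fun=> a).
Proof.
apply: (@smooth_class (fun f => exists c, f = fun=> c)) => [_ [c ->]|]; last by exists a.
by exists (fun=> 0); [exists 0|move=> t; exact: deriv_cst].
Qed.

Lemma smoothN f : smooth f -> smooth (fun t => - f t).
Proof.
move=> hf; have -> : (fun t => - f t) = (fun t => -1 * f t).
  by apply/funext => t; rewrite mulN1r.
by apply: smoothM => //; exact: smooth_cst.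
Qed.

Lemma smooth_comp_aff f a b : smooth f -> smooth (fun t => f (a + b * t)).
Proof.
move=> sf.
(* The constant c absorbs the factor b that each derivation of the inner affine map produces. *)
apply: (@smooth_class (fun g => exists c f, smooth f /\ g = fun t => c * f (a + b * t))).
  move=> _ [c [{}f [{}sf ->]]].
  exists (fun t => c * b * derive1 f (a + b * t)).
    by exists (c * b), (derive1 f); split=> //; exact: smooth_derive1.
  move=> t; apply: deriv_eq (derivM (deriv_cst t c)
    (deriv_comp (smoothW _ sf) (deriv_aff t a b))) _.
  by rewrite mul0r add0r [_ * b]mulrC mulrA.
by exists 1, f; split=> //; apply/funext => t; rewrite mul1r.
Qed.

Lemma smooth_trig a b : smooth (fun t => a * cos t + b * sin t).
Proof.
apply: (@smooth_class (fun g => exists a b, g = fun t => a * cos t + b * sin t)).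
  move=> _ [c [d ->]]; exists (fun t => d * cos t + (- c) * sin t).
    by exists d, (- c).
  move=> t; apply: deriv_eq (derivD (derivM (deriv_cst t c) (is_derive_cos t))
    (derivM (deriv_cst t d) (is_derive_sin t))) _.
  by rewrite !mul0r !add0r mulrN mulNr addrC.
by exists a, b.
Qed.

Lemma smooth_cos : smooth cos.
Proof.
have := smooth_trig 1 0; congr smooth; apply/funext => t.
by rewrite mul1r mul0r addr0.
Qed.

Lemma smooth_sin : smooth sin.
Proof.
have := smooth_trig 0 1; congr smooth; apply/funext => t.
by rewrite mul1r mul0r add0r.
Qed.

End RealDerivatives.

(** * Derivatives of complex and matrix valued curves *)

Section ComplexDerivatives.
Context {R : realType}.
Local Notation C := R[i].
Implicit Types (c e : R -> C) (t : R) (l k : C).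

Definition has_cderiv c t l :=
  is_derive t 1 (fun s => Re (c s)) (Re l) /\
  is_derive t 1 (fun s => Im (c s)) (Im l).

Lemma has_cderivP c t l : has_cderiv c t l -> cderiv c t = l.
Proof. by move=> [h1 h2]; apply: cplx_eq => /=; exact: deriv_derive1. Qed.

Lemma cderiv_eq c t l k : has_cderiv c t l -> l = k -> has_cderiv c t k.
Proof. by move=> h <-. Qed.

Lemma cderiv_uniq c t l k : has_cderiv c t l -> has_cderiv c t k -> l = k.
Proof. by move=> /has_cderivP <- /has_cderivP. Qed.

Lemma cderiv_cst l t : has_cderiv (fun=> l) t 0.
Proof. by split; exact: deriv_cst. Qed.

Lemma cderivD c e t l k : has_cderiv c t l -> has_cderiv e t k ->
  has_cderiv (fun s => c s + e s) t (l + k).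
Proof.
move=> [c1 c2] [e1 e2]; split.
  by under eq_fun do rewrite ReD; rewrite ReD; exact: derivD.
by under eq_fun do rewrite ImD; rewrite ImD; exact: derivD.
Qed.

Lemma cderivN c t l : has_cderiv c t l -> has_cderiv (fun s => - c s) t (- l).
Proof.
move=> [c1 c2]; split.
  by under eq_fun do rewrite ReN; rewrite ReN; exact: derivN.
by under eq_fun do rewrite ImN; rewrite ImN; exact: derivN.
Qed.

Lemma cderivB c e t l k : has_cderiv c t l -> has_cderiv e t k ->
  has_cderiv (fun s => c s - e s) t (l - k).
Proof. by move=> hc he; apply: cderivD => //; exact: cderivN. Qed.

Lemma cderivM c e t l k : has_cderiv c t l -> has_cderiv e t k ->
  has_cderiv (fun s => c s * e s) t (l * e t + c t * k).
Proof.
move=> [c1 c2] [e1 e2]; split.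
  under eq_fun do rewrite ReM.
  apply: deriv_eq (derivB (derivM c1 e1) (derivM c2 e2)) _.
  by rewrite ReD !ReM; ring.
under eq_fun do rewrite ImM.
apply: deriv_eq (derivD (derivM c1 e2) (derivM c2 e1)) _.
by rewrite ImD !ImM; ring.
Qed.

Lemma cderivJ c t l : has_cderiv c t l -> has_cderiv (fun s => (c s)^*) t l^*.
Proof.
move=> [c1 c2]; split.
  by under eq_fun do rewrite ReJ; rewrite ReJ.
by under eq_fun do rewrite ImJ; rewrite ImJ; exact: derivN.
Qed.

Lemma cderiv_real (f : R -> R) t a : is_derive t 1 f a ->
  has_cderiv (fun s => (f s)%:C) t a%:C.
Proof. by move=> hf; split=> //; exact: deriv_cst. Qed.

Lemma cderiv_comp c (f : R -> R) t l a : has_cderiv c (f t) l ->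
  is_derive t 1 f a -> has_cderiv (fun s => c (f s)) t (a%:C * l).
Proof.
move=> [c1 c2] hf; split.
  by apply: deriv_eq (deriv_comp c1 hf) _; rewrite !ReIm; ring.
by apply: deriv_eq (deriv_comp c2 hf) _; rewrite !ReIm; ring.
Qed.

Lemma cderiv_sum I (r : seq I) (P : pred I) (F : I -> R -> C) (F' : I -> C) t :
  (forall i, P i -> has_cderiv (F i) t (F' i)) ->
  has_cderiv (fun s => \sum_(i <- r | P i) F i s) t (\sum_(i <- r | P i) F' i).
Proof.
move=> h; elim: r => [|i r IH].
  rewrite big_nil; under eq_fun do rewrite big_nil; exact: cderiv_cst.
rewrite big_cons; under eq_fun do rewrite big_cons.
by case: ifP => // Pi; apply: cderivD => //; exact: h.
Qed.

Definition csmooth c := smooth (fun t => Re (c t)) /\ smooth (fun t => Im (c t)).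

Lemma csmoothP c : csmooth c <-> csmooth_on setT c.
Proof. by split=> -[h1 h2]; split; apply/smoothP. Qed.

Lemma csmoothW c t : csmooth c -> has_cderiv c t (cderiv c t).
Proof. by move=> [h1 h2]; split; exact: smoothW. Qed.

Lemma csmooth_cderiv c : csmooth c -> csmooth (cderiv c).
Proof. by move=> [h1 h2]; split; exact: smooth_derive1. Qed.

Lemma csmooth_on_deriv (I : set R) c t : csmooth_on I c -> I t ->
  has_cderiv c t (cderiv c t).
Proof. by move=> [h1 h2] It; split; apply: derivableE; [exact: (h1 0%N)|exact: (h2 0%N)]. Qed.

Lemma csmooth_on_cderiv (I : set R) c : csmooth_on I c ->
  csmooth_on I (cderiv c).
Proof. by move=> [h1 h2]; split=> n t It; rewrite -derive1nSn; [exact: h1|exact: h2]. Qed.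

Lemma csmooth_cst l : csmooth (fun=> l).
Proof. by split; exact: smooth_cst. Qed.

Lemma csmoothD c e : csmooth c -> csmooth e -> csmooth (fun s => c s + e s).
Proof.
move=> [c1 c2] [e1 e2]; split.
  by under eq_fun do rewrite ReD; exact: smoothD.
by under eq_fun do rewrite ImD; exact: smoothD.
Qed.

Lemma csmoothM c e : csmooth c -> csmooth e -> csmooth (fun s => c s * e s).
Proof.
move=> [c1 c2] [e1 e2]; split.
  under eq_fun do rewrite ReM; apply: smoothD; first exact: smoothM.
  by apply: smoothN; exact: smoothM.
by under eq_fun do rewrite ImM; apply: smoothD; exact: smoothM.
Qed.

Lemma csmooth_sum I (r : seq I) (F : I -> R -> C) :
  (forall i, csmooth (F i)) -> csmooth (fun s => \sum_(i <- r) F i s).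
Proof.
move=> h; elim: r => [|i r IH].
  under eq_fun do rewrite big_nil; exact: csmooth_cst.
by under eq_fun do rewrite big_cons; exact: csmoothD.
Qed.

End ComplexDerivatives.

Section MatrixDerivatives.
Context {R : realType}.
Local Notation C := R[i].

Definition has_mderiv p q (c : R -> 'M[C]_(p, q)) t (l : 'M[C]_(p, q)) :=
  forall i j, has_cderiv (fun s => c s i j) t (l i j).

Lemma has_mderivP p q (c : R -> 'M[C]_(p, q)) t l :
  has_mderiv c t l -> mderiv c t = l.
Proof. by move=> h; apply/matrixP => i j; rewrite mxE; exact: has_cderivP. Qed.

Lemma mderiv_eq p q (c : R -> 'M[C]_(p, q)) t l k :
  has_mderiv c t l -> l = k -> has_mderiv c t k.
Proof. by move=> h <-. Qed.

Lemma mderiv_uniq p q (c : R -> 'M[C]_(p, q)) t l k :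
  has_mderiv c t l -> has_mderiv c t k -> l = k.
Proof. by move=> /has_mderivP <- /has_mderivP. Qed.

Lemma mderiv_cst p q (l : 'M[C]_(p, q)) t : has_mderiv (fun=> l) t 0.
Proof. by move=> i j; rewrite mxE; exact: cderiv_cst. Qed.

Lemma mderivD p q (c e : R -> 'M[C]_(p, q)) t l k : has_mderiv c t l ->
  has_mderiv e t k -> has_mderiv (fun s => c s + e s) t (l + k).
Proof.
move=> hc he i j; rewrite mxE; under eq_fun do rewrite mxE.
exact: cderivD.
Qed.

Lemma mderivB p q (c e : R -> 'M[C]_(p, q)) t l k : has_mderiv c t l ->
  has_mderiv e t k -> has_mderiv (fun s => c s - e s) t (l - k).
Proof.
move=> hc he i j; rewrite !mxE; under eq_fun do rewrite !mxE.
exact: cderivB.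
Qed.

Lemma mderivM p q r (c : R -> 'M[C]_(p, q)) (e : R -> 'M[C]_(q, r)) t l k :
  has_mderiv c t l -> has_mderiv e t k ->
  has_mderiv (fun s => c s *m e s) t (l *m e t + c t *m k).
Proof.
move=> hc he i j; rewrite !mxE -big_split /=; under eq_fun do rewrite mxE.
by apply: cderiv_sum => h _; exact: cderivM.
Qed.

Lemma mderivMl p q r (B : 'M[C]_(p, q)) (e : R -> 'M[C]_(q, r)) t k :
  has_mderiv e t k -> has_mderiv (fun s => B *m e s) t (B *m k).
Proof.
move=> he; apply: mderiv_eq (mderivM (mderiv_cst B t) he) _.
by rewrite mul0mx add0r.
Qed.

Lemma mderivMr p q r (c : R -> 'M[C]_(p, q)) (B : 'M[C]_(q, r)) t k :
  has_mderiv c t k -> has_mderiv (fun s => c s *m B) t (k *m B).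
Proof.
move=> he; apply: mderiv_eq (mderivM he (mderiv_cst B t)) _.
by rewrite mulmx0 addr0.
Qed.

Lemma mderivZ p q (f : R -> C) (c : R -> 'M[C]_(p, q)) t a l :
  has_cderiv f t a -> has_mderiv c t l ->
  has_mderiv (fun s => f s *: c s) t (a *: c t + f t *: l).
Proof.
move=> hf hc i j; rewrite !mxE; under eq_fun do rewrite mxE.
exact: cderivM.
Qed.

Lemma mderiv_hadj p q (c : R -> 'M[C]_(p, q)) t l :
  has_mderiv c t l -> has_mderiv (fun s => hadj (c s)) t (hadj l).
Proof.
by move=> hc i j; rewrite !mxE; under eq_fun do rewrite !mxE; exact: cderivJ.
Qed.

Lemma mderiv_comp p q (c : R -> 'M[C]_(p, q)) (f : R -> R) t l a :
  has_mderiv c (f t) l -> is_derive t 1 f a ->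
  has_mderiv (fun s => c (f s)) t (a%:C *: l).
Proof.
move=> hc hf i j; rewrite mxE.
exact: (cderiv_comp (c := fun s => c s i j)).
Qed.

Lemma mderiv_col p1 p2 q (c : R -> 'M[C]_(p1, q)) (e : R -> 'M[C]_(p2, q)) t l k :
  has_mderiv c t l -> has_mderiv e t k ->
  has_mderiv (fun s => col_mx (c s) (e s)) t (col_mx l k).
Proof.
move=> hc he i j; case: (split_ordP i) => i' ->.
  by rewrite col_mxEu; under eq_fun do rewrite col_mxEu; exact: hc.
by rewrite col_mxEd; under eq_fun do rewrite col_mxEd; exact: he.
Qed.

Lemma mderiv_scalar (f : R -> C) t a n :
  has_cderiv f t a -> has_mderiv (fun s => (f s)%:M : 'M[C]_n) t a%:M.
Proof.
move=> hf i j; rewrite mxE; under eq_fun do rewrite mxE.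
by case: (i == j) => //=; exact: cderiv_cst.
Qed.

Lemma cderiv_hip p (u v : R -> 'cV[C]_p) t u' v' :
  has_mderiv u t u' -> has_mderiv v t v' ->
  has_cderiv (fun s => hip (u s) (v s)) t (hip u' (v t) + hip (u t) v').
Proof.
by move=> hu hv; have := mderivM (mderiv_hadj hu) hv; move=> /(_ 0 0); rewrite mxE.
Qed.

Lemma msmoothP p q (c : R -> 'M[C]_(p, q)) :
  msmooth c <-> forall i j, csmooth (fun t => c t i j).
Proof.
by split=> h i j; [apply: (csmoothP _).2|apply: (csmoothP _).1]; exact: (h i j).
Qed.

Lemma msmoothW p q (c : R -> 'M[C]_(p, q)) t : msmooth c ->
  has_mderiv c t (mderiv c t).
Proof. by move=> /msmoothP hc i j; rewrite mxE; exact: csmoothW. Qed.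

Lemma msmooth_mderiv p q (c : R -> 'M[C]_(p, q)) : msmooth c ->
  msmooth (mderiv c).
Proof.
move=> /msmoothP hc; apply/msmoothP => i j.
by under eq_fun do rewrite mxE; exact: csmooth_cderiv.
Qed.

Lemma msmooth_cst p q (l : 'M[C]_(p, q)) : msmooth (fun=> l).
Proof. by apply/msmoothP => i j; exact: csmooth_cst. Qed.

Lemma msmoothM p q r (c : R -> 'M[C]_(p, q)) (e : R -> 'M[C]_(q, r)) :
  msmooth c -> msmooth e -> msmooth (fun s => c s *m e s).
Proof.
move=> /msmoothP hc /msmoothP he; apply/msmoothP => i j.
by under eq_fun do rewrite mxE; apply: csmooth_sum => h; exact: csmoothM.
Qed.

Lemma msmooth_comp_aff p q (c : R -> 'M[C]_(p, q)) a b :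
  msmooth c -> msmooth (fun s => c (a + b * s)).
Proof.
move=> /msmoothP hc; apply/msmoothP => i j; have [h1 h2] := hc i j.
by split; [exact: (smooth_comp_aff a b h1)|exact: (smooth_comp_aff a b h2)].
Qed.

End MatrixDerivatives.

(** * Estimates for powers of unitary matrices *)

Section MatrixLimits.
Context {R : realType}.
Local Notation C := R[i].

(** A real-valued l1 norm, submultiplicative both here and in its matrix version, which keeps
    estimates of matrix products elementary. *)
Definition norm1 (z : C) : R := `|Re z| + `|Im z|.

Definition mxnorm1 p q (A : 'M[C]_(p, q)) : R := \sum_i \sum_j norm1 (A i j).

Lemma norm1_ge0 z : 0 <= norm1 z.
Proof. by rewrite addr_ge0. Qed.

Lemma norm1D z w : norm1 (z + w) <= norm1 z + norm1 w.
Proof.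
rewrite /norm1 ReD ImD addrACA; apply: lerD; exact: ler_normD.
Qed.

Lemma norm1M z w : norm1 (z * w) <= norm1 z * norm1 w.
Proof.
rewrite /norm1 ReM ImM mulrDl !mulrDr -!normrM.
have h1 := ler_normB (Re z * Re w) (Im z * Im w).
have h2 := ler_normD (Re z * Im w) (Im z * Re w).
lra.
Qed.

Lemma norm1_sum I (r : seq I) (F : I -> C) :
  norm1 (\sum_(i <- r) F i) <= \sum_(i <- r) norm1 (F i).
Proof.
elim: r => [|i r IH]; first by rewrite !big_nil /norm1 normr0 addr0.
by rewrite !big_cons; apply: le_trans (norm1D _ _) _; rewrite lerD2l.
Qed.

Lemma norm1_sqnorm_le1 z : sqnorm z <= 1 -> norm1 z <= 2.
Proof.
rewrite /sqnorm /norm1 => h.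
suff [h1 h2] : `|Re z| <= 1 /\ `|Im z| <= 1 by lra.
have := sqr_ge0 (Re z); have := sqr_ge0 (Im z) => ? ?.
split; rewrite -(@ler_pXn2r _ 2) ?nnegrE // -normrX ger0_norm ?sqr_ge0 // expr1n;
  lra.
Qed.

Lemma norm_norm1 (z : C) : `|z| <= (norm1 z)%:C.
Proof.
have {1}-> : z = (Re z)%:C + 'i * (Im z)%:C.
  by apply: cplx_eq; rewrite !ReIm; ring.
apply: le_trans (ler_normD _ _) _.
rewrite normrM normCi mul1r.
rewrite !normc_def !Re_real !Im_real expr0n !addr0 !sqrtr_sqr.
by rewrite -rmorphD.
Qed.

Lemma mxnorm1_ge0 p q (A : 'M[C]_(p, q)) : 0 <= mxnorm1 A.
Proof. by apply: sumr_ge0 => i _; apply: sumr_ge0 => j _; exact: norm1_ge0. Qed.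

Lemma mxnorm1D p q (A B : 'M[C]_(p, q)) :
  mxnorm1 (A + B) <= mxnorm1 A + mxnorm1 B.
Proof.
rewrite /mxnorm1 -big_split /=; apply: ler_sum => i _.
rewrite -big_split /=; apply: ler_sum => j _.
by rewrite mxE norm1D.
Qed.

Lemma mxnorm1_entry p q (A : 'M[C]_(p, q)) i j : norm1 (A i j) <= mxnorm1 A.
Proof.
rewrite /mxnorm1 (bigD1 i) //= (bigD1 j) //= -addrA lerDl addr_ge0 //.
  by apply: sumr_ge0 => k _; exact: norm1_ge0.
by apply: sumr_ge0 => k _; apply: sumr_ge0 => l _; exact: norm1_ge0.
Qed.

Lemma mxnorm1M p q r (A : 'M[C]_(p, q)) (B : 'M[C]_(q, r)) :
  mxnorm1 (A *m B) <= mxnorm1 A * mxnorm1 B.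
Proof.
rewrite /mxnorm1 mulr_suml; apply: ler_sum => i _.
have h j : norm1 ((A *m B) i j) <= \sum_k norm1 (A i k) * norm1 (B k j).
  rewrite mxE; apply: le_trans (norm1_sum _ _) _.
  by apply: ler_sum => k _; exact: norm1M.
apply: le_trans (ler_sum _ (fun j _ => h j)) _.
rewrite exchange_big mulr_suml /=; apply: ler_sum => k _.
rewrite -mulr_sumr; apply: ler_wpM2l; first exact: norm1_ge0.
rewrite (bigD1 k) //= lerDl.
by apply: sumr_ge0 => i' _; apply: sumr_ge0 => j' _; exact: norm1_ge0.
Qed.

(** The columns have Hermitian norm one, so each of the n^2 entries has modulus at most 1 and
    contributes at most 2. *)
Lemma mxnorm1_unitary n (U : 'M[C]_n) : hadj U *m U = 1%:M ->
  mxnorm1 U <= 2 *+ n *+ n.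
Proof.
move=> UU.
have h i j : norm1 (U i j) <= 2.
  apply: norm1_sqnorm_le1.
  have : (\sum_k sqnorm (U k j))%:C = 1 :> C.
    have /matrixP/(_ j j) := UU; rewrite !mxE eqxx => hj; apply: etrans hj.
    rewrite rmorph_sum; apply: eq_bigr => k _.
    by rewrite !mxE mulJc.
  move/complexI => <-; rewrite (bigD1 i) //= lerDl.
  by apply: sumr_ge0 => k _; exact: sqnorm_ge0.
rewrite /mxnorm1; apply: le_trans (ler_sum _ (fun i _ => ler_sum _ (fun j _ => h i j))) _.
by rewrite !sumr_const card_ord.
Qed.

(** Compact sets of a Hausdorff space are closed. Two different matrices are separated by balls of
    half the distance between two differing entries. *)
Lemma compact_limit n (G : set 'M[C]_n) X : compact G ->
  (forall e : R, 0 < e -> exists2 M, G M & mxnorm1 (X - M) < e) -> G X.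
Proof.
move=> cG h.
have hT : hausdorff_space 'M[C]_n.
  rewrite ball_hausdorff => a b ab.
  have [i [j abij]] : exists i j, a i j != b i j.
    apply: contrapT => nab; case/eqP: ab; apply/matrixP => i j.
    by apply/eqP; apply: contrapT => /negP ?; apply: nab; exists i, j.
  have e0 : 0 < `|a i j - b i j| / 2 by rewrite divr_gt0 // normr_gt0 subr_eq0.
  exists (PosNum e0, PosNum e0) => /=; apply/eqP/seteqP; split=> // x [h1 h2].
  have {}h1 : `|a i j - x i j| < `|a i j - b i j| / 2 by case: h1 => _ /(_ i j).
  have {}h2 : `|b i j - x i j| < `|a i j - b i j| / 2 by case: h2 => _ /(_ i j).
  have := ler_distD (x i j) (a i j) (b i j).
  rewrite [`|x i j - _|]distrC [X in X <= _]splitr => h3.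
  by have := lt_le_trans (ltrD h1 h2) h3; rewrite ltxx.
have := compact_closed hT cG; apply => B /nbhs_ballP[e /= e0 eB].
(* Radii of balls are elements of [R[i]] here, and the positive ones are real. *)
have e0' : 0 < Re e by move: e0; rewrite ltcE => /andP[].
have [M GM XM] := h _ e0'.
exists M; split=> //; apply: eB; split=> // i j.
suff : `|X i j - M i j| < e by [].
have -> : e = (Re e)%:C by apply: cplx_eq => //=; move: e0; rewrite ltcE => /andP[/eqP].
apply: le_lt_trans (norm_norm1 _) _; rewrite ltcR.
apply: le_lt_trans XM; have := mxnorm1_entry (X - M) i j.
by rewrite !mxE.
Qed.

Definition mxpow n (A : 'M[C]_n) k := iter k (mulmx A) 1%:M.

Lemma mxpow_unitary n (A : 'M[C]_n) k : hadj A *m A = 1%:M ->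
  hadj (mxpow A k) *m mxpow A k = 1%:M.
Proof.
move=> hA; elim: k => [|k IH]; first by rewrite hadj1 mul1mx.
by rewrite /= hadjM -mulmxA [hadj A *m _]mulmxA hA mul1mx.
Qed.

(** Telescoping: A^(k+1) - B^(k+1) = A (A^k - B^k) + (A - B) B^k. The unitary prefix P absorbs the
    factor A at each step, so the bound on unitary matrices is applied to each summand separately
    and the error grows linearly in k instead of geometrically. *)
Lemma mxnorm1_pow_diff n (P A B : 'M[C]_n) k : hadj P *m P = 1%:M ->
  hadj A *m A = 1%:M -> hadj B *m B = 1%:M ->
  mxnorm1 (P *m (mxpow A k - mxpow B k)) <=
    (2 *+ n *+ n * mxnorm1 (A - B) * (2 *+ n *+ n)) *+ k.
Proof.
move=> hP hA hB; elim: k P hP => [|k IH] P hP.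
  rewrite subrr mulmx0 mulr0n /mxnorm1 big1 // => i _; rewrite big1 // => j _.
  by rewrite mxE /norm1 normr0 addr0.
have -> : P *m (mxpow A k.+1 - mxpow B k.+1) =
    P *m A *m (mxpow A k - mxpow B k) + P *m (A - B) *m mxpow B k.
  rewrite /= -/(mxpow A k) -/(mxpow B k) !mulmxBr !mulmxBl !mulmxA.
  by rewrite addrA subrK.
apply: le_trans (mxnorm1D _ _) _; rewrite mulrSr; apply: lerD.
  by apply: IH; rewrite hadjM -mulmxA [hadj P *m _]mulmxA hP mul1mx.
apply: le_trans (mxnorm1M _ _) _; apply: ler_pM; rewrite ?mxnorm1_ge0 //.
  apply: le_trans (mxnorm1M _ _) _; apply: ler_wpM2r; rewrite ?mxnorm1_ge0 //.
  exact: mxnorm1_unitary.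
by apply/mxnorm1_unitary/mxpow_unitary.
Qed.

End MatrixLimits.

Section SmallIncrements.
Context {R : realType}.
Local Notation C := R[i].

Lemma deriv_zero_small (f : R -> R) (e : R) : is_derive (0 : R) 1 f 0 -> f 0 = 0 ->
  0 < e -> \forall s \near (0 : R), `|f s| <= e * `|s|.
Proof.
move=> [df f'0] f0 e0.
move: df f'0; rewrite /derivable /derive => + f'0; rewrite f'0.
move/cvgr_dist_lt => /(_ e e0).
rewrite /dnbhs /within /= => h.
near=> s; have [->|s0] := eqVneq s 0; first by rewrite f0 !normr0 mulr0.
have /= : `|0 - s^-1 *: ((f \o shift 0) (s *: 1) - f 0)| < e by move: s0; near: s.
rewrite sub0r normrN f0 subr0 addr0 normrM normfV.
have -> : s *: 1 = s by rewrite /GRing.scale /= mulr1.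
by rewrite ltr_pdivrMl ?normr_gt0 // mulrC => /ltW.
Unshelve. all: by end_near. Qed.

Lemma mderiv_zero_small p q (D : R -> 'M[C]_(p, q)) (e : R) :
  has_mderiv D 0 0 -> D 0 = 0 -> 0 < e ->
  \forall s \near (0 : R), mxnorm1 (D s) <= (2 * e * `|s|) *+ q *+ p.
Proof.
move=> dD D0 e0.
have h : \forall s \near (0 : R), forall i j, norm1 (D s i j) <= 2 * e * `|s|.
  have := @filter_forall _ _ (fun i s => forall j, norm1 (D s i j) <= 2 * e * `|s|)
    _ (nbhs_filter (0 : R)).
  apply=> i.
  have := @filter_forall _ _ (fun j s => norm1 (D s i j) <= 2 * e * `|s|)
    _ (nbhs_filter (0 : R)).
  apply=> j.
  have [h1 h2] := dD i j; rewrite mxE in h1 h2.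
  have k1 : \forall s \near (0 : R), `|Re (D s i j)| <= e * `|s|.
    by apply: (deriv_zero_small h1) => //=; rewrite D0 mxE.
  have k2 : \forall s \near (0 : R), `|Im (D s i j)| <= e * `|s|.
    by apply: (deriv_zero_small h2) => //=; rewrite D0 mxE.
  near=> s.
  have l1 : `|Re (D s i j)| <= e * `|s| by near: s.
  have l2 : `|Im (D s i j)| <= e * `|s| by near: s.
  by rewrite /norm1; lra.
near=> s.
have hs : forall i j, norm1 (D s i j) <= 2 * e * `|s| by near: s.
apply: le_trans (ler_sum _ (fun i _ => ler_sum _ (fun j _ => hs i j))) _.
by rewrite !sumr_const !card_ord.
Unshelve. all: by end_near. Qed.

End SmallIncrements.

(** * One-parameter groups of skew-Hermitian matrices *)

Section SkewExponential.
Context {R : realType}.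
Local Notation C := R[i].

Definition cis (x : R) : C := cos x +i* sin x.

Lemma cisD x y : cis (x + y) = cis x * cis y.
Proof. by apply: cplx_eq; rewrite ?ReM ?ImM /= ?cosD ?sinD //; ring. Qed.

Lemma cis0 : cis 0 = 1.
Proof. by apply: cplx_eq; rewrite /= ?cos0 ?sin0. Qed.

Lemma cisN x : cis (- x) = (cis x)^*.
Proof. by apply: cplx_eq; rewrite ?ReJ ?ImJ /= ?cosN ?sinN. Qed.

Lemma sqnorm_cis x : sqnorm (cis x) = 1.
Proof. exact: cos2Dsin2. Qed.

Lemma cis_sum I (r : seq I) (F : I -> R) :
  cis (\sum_(i <- r) F i) = \prod_(i <- r) cis (F i).
Proof. by apply: big_morph; [exact: cisD|exact: cis0]. Qed.

Lemma cderiv_cis (f : R -> R) (t a : R) : is_derive t 1 f a ->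
  has_cderiv (fun s => cis (f s)) t (a%:C * 'i * cis (f t)).
Proof.
move=> hf; split.
  apply: deriv_eq (deriv_comp (is_derive_cos (f t)) hf) _.
  by rewrite !ReIm /=; ring.
apply: deriv_eq (deriv_comp (is_derive_sin (f t)) hf) _.
by rewrite !ReIm /=; ring.
Qed.

Lemma cis_ex z : sqnorm z = 1 -> exists x, z = cis x.
Proof.
case: z => a b; rewrite /sqnorm /= => h.
have a1 : -1 <= a <= 1.
  have := sqr_ge0 b; rewrite -ler_norml => b0.
  by rewrite -(@ler_pXn2r _ 2) ?nnegrE // -normrX ger0_norm ?sqr_ge0 // expr1n; lra.
have ca : cos (acos a) = a by rewrite acosK // in_itv.
have sa : sin (acos a) ^+ 2 = b ^+ 2.
  by have := cos2Dsin2 (acos a); rewrite ca; lra.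
move/eqP: sa; rewrite eqf_sqr => /orP[] /eqP sb.
  by exists (acos a); apply: cplx_eq => /=.
exists (- acos a); apply: cplx_eq => /=; rewrite ?cosN ?sinN //.
by rewrite sb opprK.
Qed.

Lemma hadj_trC p q (A : 'M[C]_(p, q)) : map_mx Num.conj A^T = hadj A.
Proof. by apply/matrixP => i j; rewrite !mxE. Qed.

(** This is exp(tA) for A = P^* diag(i lam_j) P, defined through the spectral decomposition instead
    of a power series. *)
Definition exp_path n (P : 'M[C]_n) (lam : 'I_n -> R) (t : R) : 'M[C]_n :=
  hadj P *m diag_mx (\row_j cis (lam j * t)) *m P.

Section ExpPath.
Context {n : nat} (P : 'M[C]_n) (lam : 'I_n -> R).
Hypothesis PP : P *m hadj P = 1%:M.
Local Notation E := (exp_path P lam).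

Lemma exp_pathD s t : E (s + t) = E s *m E t.
Proof.
rewrite /exp_path -!mulmxA; congr (_ *m _).
rewrite [P *m (hadj P *m _)]mulmxA PP mul1mx mulmxA mulmx_diag.
congr (diag_mx _ *m _); apply/rowP => j.
by rewrite !mxE mulrDr cisD.
Qed.

Lemma exp_path0 : E 0 = 1%:M.
Proof.
rewrite /exp_path -[RHS](mulmx1C PP); congr (_ *m _).
rewrite -[RHS]mulmx1; congr (_ *m _).
by apply/matrixP => i j; rewrite !mxE mulr0 cis0.
Qed.

Lemma exp_path_hadj t : hadj (E t) = E (- t).
Proof.
rewrite /exp_path !hadjM hadjK -mulmxA; congr (_ *m (_ *m _)).
apply/matrixP => i j; rewrite !mxE mulrN cisN.
by case: eqVneq => [->|_]; rewrite ?mulr1n ?mulr0n ?conjC0.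
Qed.

Lemma exp_path_unitary t : hadj (E t) *m E t = 1%:M.
Proof. by rewrite exp_path_hadj -exp_pathD addNr exp_path0. Qed.

Lemma exp_path_smooth : msmooth E.
Proof.
apply: msmoothM (msmooth_cst P); apply: msmoothM (msmooth_cst _) _.
apply/msmoothP => i j; under eq_fun do rewrite !mxE.
case: (i == j); last by exact: csmooth_cst.
split => /=.
  have := smooth_comp_aff 0 (lam i) smooth_cos.
  by congr smooth; apply/funext => t; rewrite add0r.
have := smooth_comp_aff 0 (lam i) smooth_sin.
by congr smooth; apply/funext => t; rewrite add0r.
Qed.

Lemma exp_path_deriv :
  has_mderiv E 0 (hadj P *m diag_mx (\row_j ('i * (lam j)%:C)) *m P).
Proof.
apply: mderivMr; apply: mderivMl => i j.
under eq_fun do rewrite !mxE; rewrite !mxE.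
case: (i == j) => /=; last exact: cderiv_cst.
have h : is_derive (0 : R) 1 (fun s => lam i * s) (lam i).
  apply: deriv_eq (derivM (deriv_cst 0 (lam i)) (is_derive_id (0 : R) 1)) _.
  by rewrite mul0r add0r mulr1.
apply: cderiv_eq (cderiv_cis h) _.
by rewrite mulr0 cis0 mulr1 mulrC.
Qed.

Lemma exp_path_det t : \det (E t) = cis ((\sum_j lam j) * t).
Proof.
rewrite /exp_path !det_mulmx mulrAC -det_mulmx (mulmx1C PP) det1 mul1r.
rewrite det_diag mulr_suml cis_sum; apply: eq_bigr => j _.
by rewrite mxE.
Qed.

(** In the eigenbasis each coordinate of V either vanishes or belongs to the eigenvalue 0, where the
    factor is cis 0 = 1. *)
Lemma exp_path_fix (V : 'cV[C]_n) t :
  hadj P *m diag_mx (\row_j ('i * (lam j)%:C)) *m P *m V = 0 -> E t *m V = V.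
Proof.
move=> h.
have {}h : diag_mx (\row_j ('i * (lam j)%:C)) *m (P *m V) = 0.
  by have := congr1 (mulmx P) h; rewrite mulmx0 -!mulmxA mulmxA PP mul1mx.
rewrite /exp_path -!mulmxA -[RHS]mul1mx -(mulmx1C PP) -mulmxA; congr (_ *m _).
move: (P *m V) h => W h; apply/colP => j.
have /colP/(_ j) := h; rewrite !mul_diag_mx !mxE => /eqP.
rewrite !mulf_eq0 => /orP[/orP[|/eqP[->]]|/eqP ->].
- by rewrite (negPf (neq0Ci _)).
- by rewrite mul0r cis0 mul1r.
- by rewrite mulr0.
Qed.

End ExpPath.

(** A is normal, hence unitarily diagonalisable; its diagonal form is again skew-Hermitian, so the
    eigenvalues are imaginary. *)
Lemma skew_spectral n (A : 'M[C]_n) : hadj A = - A ->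
  exists P (lam : 'I_n -> R), P *m hadj P = 1%:M /\
    A = hadj P *m diag_mx (\row_j ('i * (lam j)%:C)) *m P.
Proof.
move=> sA.
have nA : A \is normalmx.
  by apply/normalmxP; rewrite hadj_trC sA mulmxN mulNmx.
have := orthomx_spectralP nA; set P := spectralmx A; set D := spectral_diag A.
have uP : P \is unitarymx by exact: spectral_unitarymx.
have PP : P *m hadj P = 1%:M by have /unitarymxP := uP; rewrite hadj_trC.
rewrite invmx_unitary // hadj_trC => AE.
exists P, (fun j => Im (D 0 j)); split; first exact PP.
rewrite {1}AE; congr (_ *m diag_mx _ *m _); apply/rowP => j; rewrite mxE.
have DE : diag_mx D = P *m A *m hadj P.
  by rewrite AE -!mulmxA PP mulmx1 mulmxA PP mul1mx.
have : hadj (diag_mx D) = - diag_mx D.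
  by rewrite DE !hadjM hadjK sA mulNmx mulmxN mulmxA.
move/matrixP => /(_ j j); rewrite !mxE eqxx !mulr1n => h.
have h' : Re (D 0 j) = 0 by have := congr1 (@complex.Re R) h; rewrite ReJ ReN; lra.
by apply: cplx_eq; rewrite ?ReM ?ImM ?Re_i ?Im_i ?Re_real ?Im_real ?h'; ring.
Qed.

End SkewExponential.

(** * The Lie algebra of G, the moment map and stabilisers *)

Section LieAlgebra.
Context {R : realType} {d : nat}.
Local Notation C := R[i].
Variable G : set 'M[C]_d.
Hypotheses (hG : is_subgroup G) (hGSU : G `<=` SU).
Implicit Types (A B g : 'M[C]_d) (V : 'cV[C]_d).

Lemma SU_unitary g : SU g -> g *m hadj g = 1%:M.
Proof. by move=> [/unitarymxP + _]; rewrite hadj_trC. Qed.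

Lemma SU_inv g : SU g -> invmx g = hadj g.
Proof. by move=> [/invmx_unitary -> _]; rewrite hadj_trC. Qed.

Lemma group_hadjr g : G g -> g *m hadj g = 1%:M.
Proof. by move/hGSU/SU_unitary. Qed.

Lemma group_hadjl g : G g -> hadj g *m g = 1%:M.
Proof. by move/group_hadjr/mulmx1C. Qed.

Lemma group_inv g : G g -> G (hadj g).
Proof. by move=> Gg; rewrite -SU_inv; [case: hG => _ _; apply|exact: hGSU]. Qed.

Lemma group_mul g h : G g -> G h -> G (g *m h).
Proof. by case: hG => _ + _; apply. Qed.

Lemma group_one : G 1%:M. Proof. by case: hG. Qed.

Lemma lie_path (c : R -> 'M[C]_d) t : msmooth c -> (forall s, G (c s)) ->
  lie G (mderiv c t *m hadj (c t)).
Proof.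
move=> sc Gc; exists (fun s => c (t + 1 * s) *m hadj (c t)); split.
- exact (msmoothM (msmooth_comp_aff t 1 sc) (msmooth_cst _)).
- by move=> s; apply: group_mul => //; exact: group_inv.
- by rewrite mulr0 addr0 group_hadjr.
- apply/has_mderivP/mderivMr.
  have h : has_mderiv c (t + 1 * 0) (mderiv c t).
    by rewrite mulr0 addr0; exact: msmoothW.
  apply: mderiv_eq (mderiv_comp (f := fun s => t + 1 * s) h (deriv_aff 0 t 1)) _.
  by rewrite scale1r.
Qed.

(** The curve c1(a s) c2(s) in G has velocity a A + B at the identity. *)
Lemma lie_subspace : real_subspace (lie G).
Proof.
split.
  exists (fun=> 1%:M); split => //.
  - exact: msmooth_cst.
  - by move=> _; exact: group_one.
  - exact/has_mderivP/mderiv_cst.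
move=> a A B [c1 [s1 G1 c10 <-]] [c2 [s2 G2 c20 <-]].
exists (fun s => c1 (0 + a * s) *m c2 s); split.
- exact (msmoothM (msmooth_comp_aff 0 a s1) s2).
- by move=> s; exact: group_mul.
- by rewrite mulr0 addr0 c10 c20 mulmx1.
- apply: has_mderivP.
  have h : has_mderiv c1 (0 + a * 0) (mderiv c1 0).
    by rewrite mulr0 addr0; exact: msmoothW.
  have h1 : has_mderiv (fun s => c1 (0 + a * s)) 0 (a%:C *: mderiv c1 0).
    exact: (mderiv_comp (f := fun s => 0 + a * s) h (deriv_aff 0 0 a)).
  apply: mderiv_eq (mderivM h1 (msmoothW 0 s2)) _.
  by rewrite mulr0 addr0 c10 c20 mul1mx mulmx1.
Qed.

Lemma lie_Ad g A : G g -> lie G A -> lie G (g *m A *m hadj g).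
Proof.
move=> Gg [c [sc Gc c0 <-]]; exists (fun s => g *m c s *m hadj g); split.
- exact (msmoothM (msmoothM (msmooth_cst g) sc) (msmooth_cst (hadj g))).
- by move=> s; apply: group_mul (group_inv _) => //; exact: group_mul.
- by rewrite c0 mulmx1 group_hadjr.
- by apply/has_mderivP/mderivMr/mderivMl; exact: msmoothW.
Qed.

Lemma lie_Ad' g A : G g -> lie G A -> lie G (hadj g *m A *m g).
Proof. by move=> Gg lA; have := lie_Ad (group_inv Gg) lA; rewrite hadjK. Qed.

Lemma lie_skew A : lie G A -> hadj A = - A.
Proof.
move=> [c [sc Gc c0 <-]].
have h := mderivM (mderiv_hadj (msmoothW 0 sc)) (msmoothW 0 sc).
have cc : (fun s => hadj (c s) *m c s) = fun=> 1%:M.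
  by apply/funext => s; exact: group_hadjl.
rewrite cc in h; have := mderiv_uniq h (mderiv_cst _ _).
rewrite c0 mulmx1 hadj1 mul1mx => /eqP; rewrite addr_eq0 => /eqP.
by [].
Qed.

(** This is mu(V) = 0 in a usable form: the pairing of i V V^* with A is Im of this product, whose
    real part vanishes by skewness. Invariance under complex scaling and under G becomes
    immediate. *)
Definition momentless V := forall A, lie G A -> hip V (A *m V) = 0.

Lemma hip_skew A V : lie G A -> (hip V (A *m V))^* = - hip V (A *m V).
Proof. by move=> lA; rewrite hipJ hip_mull lie_skew // mulNmx hipNr. Qed.

Lemma zero_level_momentless z : zero_level G z -> momentless z.
Proof.
rewrite /zero_level /moment_map /= => /eqP; rewrite scaler_eq0 => /orP[|/eqP h A lA].
  by rewrite oppr_eq0 invr_eq0 pnatr_eq0.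
have [_ /(_ A lA)] := orthoprojP ('i *: (z *m (map_mx conjc z)^T)) lie_subspace.
rewrite h subr0 dot_trace -scalemxAr mulmxA mxtraceZ mxtrace_mulC.
have -> : \tr ((map_mx conjc z)^T *m (hadj A *m z)) = - hip z (A *m z).
  rewrite lie_skew // mulNmx mulmxN /mxtrace big_ord1 mxE.
  by congr (- _).
rewrite ReM Re_i Im_i mul0r mul1r sub0r ImN opprK => him.
have := congr1 (@complex.Re R) (hip_skew z lA); rewrite ReJ ReN => hre.
by apply: cplx_eq => //=; lra.
Qed.

Lemma momentlessZ a z : momentless z -> momentless (a *: z).
Proof. by move=> h A lA; rewrite -scalemxAr hipZl hipZr h // !mulr0. Qed.

Lemma momentlessM g V : G g -> momentless V -> momentless (g *m V).
Proof.
move=> Gg h A lA; rewrite hip_mull.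
by rewrite !mulmxA; apply: h; exact: lie_Ad'.
Qed.

(** Differentiating <V, c A c^* V> = 0 along a curve c in G with velocity B gives <V, (BA - AB) V> =
    0, and skewness turns the left side into 2i Im <A V, B V>. *)
Lemma momentless_isotropic V A B : momentless V -> lie G A -> lie G B ->
  Im (hip (A *m V) (B *m V)) = 0.
Proof.
move=> hV lA lB; case: (lB) => c [sc Gc c0 cB].
have dc : has_mderiv c 0 B by rewrite -cB; exact: msmoothW.
have h := mderivMr V (mderivM (mderivMr A dc) (mderiv_hadj dc)).
have {h} := cderiv_hip (mderiv_cst V 0) h.
have -> : (fun s => hip V ((c s *m A *m hadj (c s)) *m V)) = fun=> 0.
  by apply/funext => s; apply: hV; exact: lie_Ad.
move/cderiv_uniq => /(_ _ (cderiv_cst _ _)).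
rewrite hip0l add0r c0 mul1mx hadj1 mulmx1 mulmxDl hipDr.
have -> : hip V (B *m A *m V) = - hip (B *m V) (A *m V).
  by rewrite -mulmxA hip_mulr (lie_skew lB) mulNmx hipNl.
have -> : hip V (A *m hadj B *m V) = hip (A *m V) (B *m V).
  by rewrite hip_mull (lie_skew lA) (lie_skew lB) mulmxN !mulNmx mulmxA.
rewrite -(hipJ (A *m V)) => h.
by have := congr1 (@complex.Im R) h; rewrite ImD ImN ImJ Im0; lra.
Qed.

Hypothesis cG : compact G.

Lemma group_mxpow g k : G g -> G (mxpow g k).
Proof.
by move=> Gg; elim: k => [|k IH]; [exact: group_one|exact: group_mul].
Qed.

(* exp(tA) is the limit of c(t/n)^n, for any curve c in G with c'(0) = A. *)
Lemma lie_exp_mem A P (lam : 'I_d -> R) t : lie G A -> P *m hadj P = 1%:M ->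
  A = hadj P *m diag_mx (\row_j ('i * (lam j)%:C)) *m P -> G (exp_path P lam t).
Proof.
move=> [c [sc Gc c0 cA]] PP AE; set E := exp_path P lam.
have dD : has_mderiv (fun s => E s - c s) 0 0.
  have h := mderivB (exp_path_deriv P lam) (msmoothW 0 sc).
  by rewrite cA -AE subrr in h.
have D0 : E 0 - c 0 = 0 by rewrite c0 /E exp_path0 // subrr.
apply: compact_limit cG _ => e e0.
pose K : R := 2 *+ d *+ d.
have K0 : 0 <= K by rewrite !mulrn_wge0.
(* N gathers all constants of the telescoping estimate. With slope e / (N + 1) for the first-order
   error, n.+1 steps of size t / n.+1 < del accumulate at most N e / (N + 1) < e. *)
pose N := K * (2 * `|t|) *+ d *+ d * K.
have N0 : 0 <= N by rewrite mulr_ge0 // !mulrn_wge0 // mulr_ge0 // mulr_ge0.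
have e'0 : 0 < e / (N + 1) by rewrite divr_gt0 // ltr_wpDl.
have := mderiv_zero_small dD D0 e'0.
move=> /nbhs_ballP[del /= del0 small].
have [n nt] : exists n, `|t| / del < n.+1%:R.
  by exists (Num.trunc (`|t| / del)); rewrite truncnS_gt.
have n0 : 0 < n.+1%:R :> R by [].
have tn : `|t / n.+1%:R| < del.
  by rewrite normrM normfV (gtr0_norm n0) ltr_pdivrMr // mulrC -ltr_pdivrMr.
exists (mxpow (c (t / n.+1%:R)) n.+1); first exact: group_mxpow.
have Epow k s : E (s *+ k) = mxpow (E s) k.
  by elim: k => [|k IH]; [rewrite mulr0n /E exp_path0|rewrite mulrS /E exp_pathD // -/E IH].
have -> : E t = mxpow (E (t / n.+1%:R)) n.+1.
  by rewrite -Epow -[_ / _ *+ _]mulr_natr divfK // gt_eqF.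
rewrite -[X in mxnorm1 X]mul1mx.
have uE := exp_path_unitary lam PP (t / n.+1%:R).
apply: le_lt_trans (mxnorm1_pow_diff _ _ uE (group_hadjl (Gc _))) _.
  by rewrite hadj1 mul1mx.
have sm : mxnorm1 (E (t / n.+1%:R) - c (t / n.+1%:R)) <=
    (2 * (e / (N + 1)) * `|t / n.+1%:R|) *+ d *+ d.
  by apply: small; rewrite /ball /= sub0r normrN.
rewrite -/K -/E.
apply: (@le_lt_trans _ _ (K * ((2 * (e / (N + 1)) * `|t / n.+1%:R|) *+ d *+ d) * K *+ n.+1)).
  by rewrite lerMn2r /= ler_wpM2r // ler_wpM2l.
have -> : K * (2 * (e / (N + 1)) * `|t / n.+1%:R| *+ d *+ d) * K *+ n.+1 = N * (e / (N + 1)).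
  have mnE (x : R) : x *+ d *+ d = x * (d%:R * d%:R).
    by rewrite -[LHS]mulr_natr -[x *+ d]mulr_natr -mulrA.
  rewrite normrM normfV (gtr0_norm n0) -[LHS]mulr_natr mnE.
  rewrite /N mnE.
  have alg (k f z x y : R) : x != 0 ->
      k * (2 * f * (z / x) * y) * k * x = k * (2 * z) * y * k * f.
    by move=> ?; field.
  by apply: alg; rewrite gt_eqF.
rewrite mulrCA gtr_pMr // ltr_pdivrMr ?mul1r ?ltrDl //.
exact: ltr_wpDl.
Qed.

Lemma lie_exp A : lie G A -> exists E : R -> 'M[C]_d,
  [/\ msmooth E, forall t, G (E t), E 0 = 1%:M, has_mderiv E 0 A
    & forall V t, A *m V = 0 -> E t *m V = V].
Proof.
move=> lA; have [P [lam [PP AE]]] := skew_spectral (lie_skew lA).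
exists (exp_path P lam); split.
- exact: exp_path_smooth.
- by move=> t; exact: lie_exp_mem lA PP AE.
- exact: exp_path0.
- by rewrite AE; exact: exp_path_deriv.
- by move=> V t AV; apply: exp_path_fix => //; rewrite -AE.
Qed.

(** The one-parameter group of A lies in SU, so its determinant cis(l t) is constantly 1; the
    derivative at 0 is i l, where i l is the trace. *)
Lemma lie_trace A : lie G A -> \tr A = 0.
Proof.
move=> lA; have [P [lam [PP AE]]] := skew_spectral (lie_skew lA).
pose l := \sum_j lam j.
have dt t : cis (l * t) = 1.
  rewrite -(exp_path_det lam PP).
  by have := hGSU (lie_exp_mem t lA PP AE); case.
have l0 : l = 0.
  have h : is_derive (0 : R) 1 (fun s => l * s) l.
    apply: deriv_eq (derivM (deriv_cst 0 l) (is_derive_id (0 : R) 1)) _.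
    by rewrite mul0r add0r mulr1.
  have := cderiv_cis h; under eq_fun do rewrite dt.
  move/cderiv_uniq => /(_ _ (cderiv_cst _ _)) /(congr1 (@complex.Im R)).
  by rewrite mulr0 cis0 mulr1 !ImM Re_i Im_i Re_real Im_real; lra.
rewrite AE mxtrace_mulC mulmxA PP mul1mx mxtrace_diag.
under eq_bigr do rewrite mxE.
by rewrite -mulr_sumr -rmorph_sum -/l l0 mulr0.
Qed.

(** An arbitrary curve in G with velocity A has no reason to fix V even if A V = 0; the exponential
    does. *)
Lemma lie_isotropy V A : lie (isotropy std_act G V) A <-> lie G A /\ A *m V = 0.
Proof.
split=> [[c [sc Gc c0 cA]]|[lA AV]].
  split; first by exists c; split=> // t; case: (Gc t).
  have h : has_mderiv (fun t => c t *m V) 0 (A *m V).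
    by apply: mderivMr; rewrite -cA; exact: msmoothW.
  have cV : (fun t => c t *m V) = fun=> V by apply/funext => t; case: (Gc t).
  by rewrite cV in h; exact: mderiv_uniq h (mderiv_cst _ _).
have [E [sE GE E0 dE fixE]] := lie_exp lA.
exists E; split=> //; last exact: has_mderivP.
by move=> t; split=> //; exact: fixE.
Qed.

Lemma orbit_tangent_subspace V : real_subspace (orbit_tangent G V).
Proof.
split; first by exists 0; [case: lie_subspace|rewrite mul0mx].
move=> a _ _ [A lA <-] [B lB <-]; exists (a%:C *: A + B).
  by case: lie_subspace => _; apply.
by rewrite mulmxDl -scalemxAl.
Qed.

(** Rank-nullity for the real linear map A -> A V: a basis [r] of the kernel, followed by lifts [L]
    of a basis of the image, is a basis of the Lie algebra of G. By [lie_isotropy] the kernel is the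
    Lie algebra of the stabiliser. *)
Lemma isotropy_dim_quotient V n : real_dim (orbit_tangent G V) n ->
  dim_quotient G (isotropy std_act G V) n.
Proof.
move=> [s sn [bs fs]].
pose K := [set A | lie G A /\ A *m V = 0].
have sK : real_subspace K.
  split; first by split; [case: lie_subspace|rewrite mul0mx].
  move=> a A B [lA AV] [lB BV]; split; first by case: lie_subspace => _; apply.
  by rewrite mulmxDl -scalemxAl AV BV scaler0 addr0.
have [r [[br fr] _]] := ex_orthonormal_basis sK.
have /choice[L hL] i : exists A, (i < size s)%N -> lie G A /\ A *m V = s`_i.
  case: (ltnP i (size s)) => [li|_]; last by exists 0.
  have [A lA AV] := basis_mem (conj bs fs) li.
  by exists A.
have catE (a : nat -> R) :
    \sum_(i < size (r ++ mkseq L (size s))) (a i)%:C *: (r ++ mkseq L (size s))`_i =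
    \sum_(i < size r) (a i)%:C *: r`_i +
    \sum_(i < size s) (a (size r + i)%N)%:C *: L i.
  rewrite size_cat size_mkseq big_split_ord /=; congr (_ + _); apply: eq_bigr => i _.
    by rewrite nth_cat ltn_ord.
  by rewrite nth_cat ltnNge leq_addr addKn nth_mkseq.
have LV (a : nat -> R) : (\sum_(i < size s) (a i)%:C *: L i) *m V =
    \sum_(i < size s) (a i)%:C *: s`_i.
  rewrite mulmx_suml; apply: eq_bigr => i _.
  by rewrite -scalemxAl; have [_ ->] := hL _ (ltn_ord i).
have rK (a : nat -> R) : K (\sum_(i < size r) (a i)%:C *: r`_i).
  by apply/br; exists a.
exists (size r + n)%N, (size r); split=> //; last first.
  exists r => //; split=> // v; rewrite -br; exact: lie_isotropy.
exists (r ++ mkseq L (size s)); first by rewrite size_cat size_mkseq sn.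
split=> [A|a].
  split=> [lA|[a ->]]; last first.
    rewrite catE; apply: subspaceD (rK a).1 _; first exact: lie_subspace.
    apply: subspace_sum => [|i _]; first exact: lie_subspace.
    by apply: subspaceZ (hL _ (ltn_ord i)).1; exact: lie_subspace.
  have /bs[a AV] : orbit_tangent G V (A *m V) by exists A.
  have : K (A - \sum_(i < size s) (a i)%:C *: L i).
    split; last by rewrite mulmxBl LV AV subrr.
    apply: subspaceB => //; first exact: lie_subspace.
    apply: subspace_sum => [|i _]; first exact: lie_subspace.
    by apply: subspaceZ (hL _ (ltn_ord i)).1; exact: lie_subspace.
  move/br => [b bE].
  pose f i := if (i < size r)%N then b i else a (i - size r)%N.
  exists f; rewrite (catE f) -[LHS](subrK (\sum_(i < size s) (a i)%:C *: L i)) bE.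
  congr (_ + _); apply: eq_bigr => i _; first by rewrite /f ltn_ord.
  by rewrite /f ltnNge leq_addr addKn.
rewrite catE => a0.
have aL i : (i < size s)%N -> a (size r + i)%N = 0.
  apply: (fs (fun i => a (size r + i)%N)); rewrite -(LV (fun i => a (size r + i)%N)).
  have := congr1 (mulmx^~ V) a0; rewrite /= mulmxDl (rK a).2 add0r mul0mx.
  by [].
have ar : forall i, (i < size r)%N -> a i = 0.
  apply: (fr a); move: a0; rewrite [X in _ + X]big1 ?addr0 // => i _.
  by rewrite aL // scale0r.
move=> i; rewrite size_cat size_mkseq => li.
case: (ltnP i (size r)) => [/ar //|ri].
by rewrite -(subnKC ri) aL // ltn_subLR.
Qed.

End LieAlgebra.

(** * Calculus on open intervals *)

Section RealIntervals.
Context {R : realType}.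
Implicit Types (f : R -> R) (I : set R) (s t : R).

Lemma derivV f t a : is_derive t 1 f a -> f t != 0 ->
  is_derive t 1 (fun s => (f s)^-1) (- a / f t ^+ 2).
Proof.
move=> [df fa] f0; split; first exact: derivableV.
by rewrite deriveV // fa /GRing.scale /= mulrC mulrN mulNr.
Qed.

Lemma deriv_near f g t a : (\forall s \near t, f s = g s) ->
  is_derive t 1 f a -> is_derive t 1 g a.
Proof. exact: near_eq_is_derive. Qed.

Lemma open_interval_nbhd I s t : open I -> is_interval I -> I s -> I t ->
  exists a b, [/\ a < s < b, a < t < b & forall x, a <= x <= b -> I x].
Proof.
move=> oI iI Is It.
have ball x : I x -> exists2 e, 0 < e & forall y, `|x - y| < e -> I y.
  by move=> Ix; have /nbhs_ballP[e /= e0 h] := open_nbhs_nbhs (conj oI Ix); exists e.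
have [e e0 he] : exists2 e, 0 < e & I (Num.min s t - e) /\ I (Num.max s t + e).
  have Imin : I (Num.min s t) by case: leP.
  have Imax : I (Num.max s t) by case: leP.
  have [e1 e10 h1] := ball _ Imin; have [e2 e20 h2] := ball _ Imax.
  exists (Num.min e1 e2 / 2); first by rewrite divr_gt0 // lt_min e10.
  have : Num.min e1 e2 <= e1 by rewrite ge_min lexx.
  have : Num.min e1 e2 <= e2 by rewrite ge_min lexx orbT.
  have : 0 < Num.min e1 e2 by rewrite lt_min e10.
  move: (Num.min e1 e2) => e ? ? ?; split.
    by apply: h1; rewrite opprB addrC subrK ger0_norm; lra.
  by apply: h2; rewrite opprD addrA subrr sub0r normrN ger0_norm; lra.
exists (Num.min s t - e), (Num.max s t + e).
have : Num.min s t <= s by rewrite ge_min lexx.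
have : Num.min s t <= t by rewrite ge_min lexx orbT.
have : s <= Num.max s t by rewrite le_max lexx.
have : t <= Num.max s t by rewrite le_max lexx orbT.
move=> ? ? ? ?; split; try by apply/andP; split; lra.
by move=> x xab; apply: iI he.1 he.2 _ xab.
Qed.

Lemma oriented_integral_deriv I f s0 s : open I -> is_interval I ->
  (forall t, I t -> {for t, continuous f}) -> I s0 -> I s ->
  is_derive s 1 (oriented_integral f s0) (f s).
Proof.
move=> oI iI cf Is0 Is.
have [a [b [s0ab sab abI]]] := open_interval_nbhd oI iI Is0 Is.
have [as0 s0b] := andP s0ab; have [as_ sb] := andP sab.
have cab : {within `[a, b], continuous f}.
  apply/continuous_in_subspaceT => t; rewrite inE /= in_itv /= => tab.
  by apply: cf; exact: abI.
have iab : lebesgue_measure.-integrable `[a, b] (EFin \o f).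
  by apply: continuous_compact_integrable => //; exact: segment_compact.
(* The primitive starts at a, to the left of both s0 and s, so the oriented integral is F x - F s0
   on either side of s0. *)
pose F x := Rintegral lebesgue_measure `[a, x] f.
have FB p q : a <= p -> p <= q -> q <= b ->
    Rintegral lebesgue_measure `[p, q] f = F q - F p.
  move=> ap pq qb.
  have iaq : lebesgue_measure.-integrable `[a, q] (EFin \o f).
    apply: integrableS iab => //; apply: subset_itvl; by rewrite bnd_simp.
  rewrite /F Rintegral_itvB ?bnd_simp // Rintegral_itv_obnd_cbnd //.
  apply: integrableS iaq => //; apply: subset_itvr; by rewrite bnd_simp.
have [dF F's] : derivable F s 1 /\ derive1 F s = f s.
  by apply: (continuous_FTC1_closed sb) => //; exact: cf.
have hF : is_derive s 1 (fun x => F x - F s0) (f s).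
  by apply: deriv_eq (derivB (derivableE dF) (deriv_cst s (F s0))) _; rewrite F's subr0.
apply: deriv_near hF.
have : \forall x \near s, x \in `]a, b[.
  by apply: near_in_itvoo; rewrite in_itv /= as_ sb.
apply: filterS => x; rewrite in_itv /= => /andP[ax xb].
rewrite /oriented_integral; case: leP => s0x.
  by rewrite FB // ltW.
by rewrite FB ?ltW // opprB.
Qed.

Lemma deriv0_cst I f s t : is_interval I ->
  (forall x, I x -> is_derive x 1 f 0) -> I s -> I t -> f s = f t.
Proof.
move=> iI df; wlog st : s t / s <= t.
  move=> h Is It; have [/h|/ltW/h] := leP s t; first exact.
  by move=> h'; apply/esym/h'.
move=> Is It.
have Ix x : s <= x <= t -> I x by move=> ?; exact: iI Is It _ _.
have [||c _] := @MVT_segment R f (fun=> 0) s t st.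
- by move=> x; rewrite in_itv /= => /andP[sx xt]; apply/df/Ix; rewrite !ltW.
- apply/continuous_in_subspaceT => x; rewrite inE /= in_itv /= => /Ix /df.
  exact: deriv_continuous.
by rewrite mul0r => /eqP; rewrite subr_eq0 => /eqP.
Qed.

(** By continuity the mean value theorem applies on both sides up to t itself, so f is constant near
    t. *)
Lemma deriv0_punctured f t : {for t, continuous f} ->
  (\forall s \near t^', is_derive (s : R) 1 f 0) -> is_derive t 1 f 0.
Proof.
move=> cf /nbhs_ballP[e /= e0 he].
have {}he s : `|t - s| < e -> s != t -> is_derive s 1 f 0 by exact: he.
apply: deriv_near (deriv_cst t (f t)).
apply/nbhs_ballP; exists e => //= s; rewrite /ball /= => ts.
have cs x : `|t - x| < e -> {for x, continuous f}.
  move=> tx; have [->//|xt] := eqVneq x t.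
  exact: deriv_continuous (he _ tx xt).
have [st|ts'] := leP s t.
- have [||c _] := @MVT_segment R f (fun=> 0) s t st.
  + move=> x; rewrite in_itv /= => /andP[sx xt].
    apply: he; last by rewrite lt_eqF.
    by move: ts; rewrite !ger0_norm; lra.
  + apply/continuous_in_subspaceT => x; rewrite inE /= in_itv /= => /andP[sx xt].
    by apply: cs; move: ts; rewrite !ger0_norm; lra.
  by rewrite mul0r => /eqP; rewrite subr_eq0 => /eqP.
- have [||c _] := @MVT_segment R f (fun=> 0) t s (ltW ts').
  + move=> x; rewrite in_itv /= => /andP[tx xs].
    apply: he; last by rewrite gt_eqF.
    by move: ts; rewrite !ler0_norm; lra.
  + apply/continuous_in_subspaceT => x; rewrite inE /= in_itv /= => /andP[tx xs].
    by apply: cs; move: ts; rewrite !ler0_norm; lra.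
  by rewrite mul0r => /eqP; rewrite subr_eq0 => /eqP/esym.
Qed.

(* Hadamard quotient of a function vanishing at t. *)
Lemma deriv_quotient f t a : is_derive t 1 f a -> f t = 0 ->
  {for t, continuous (fun s => if s == t then a else f s / (s - t))}.
Proof.
move=> df ft; rewrite /prop_for /continuous_at eqxx.
apply/cvgrPdist_le => e e0.
have dg : is_derive (0 : R) 1 (fun s => f (t + 1 * s) - a * s) 0.
  have df' : is_derive (t + 1 * 0) 1 f a by rewrite mulr0 addr0.
  apply: deriv_eq (derivB (deriv_comp (g := fun s => t + 1 * s) df' (deriv_aff 0 t 1))
    (derivM (deriv_cst 0 a) (is_derive_id (0 : R) 1))) _.
  by rewrite mul0r add0r !mulr1 subrr.
have g0 : f (t + 1 * 0) - a * 0 = 0 by rewrite !mulr0 addr0 ft subr0.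
have /nbhs_ballP[r /= r0 hr] := deriv_zero_small dg g0 e0.
apply/nbhs_ballP; exists r => //= s; rewrite /ball /= => ts.
case: eqVneq => [_|st]; first by rewrite subrr normr0 ltW.
have /= := hr (s - t); rewrite /ball /= sub0r opprB => /(_ ts).
rewrite mul1r [t + _]addrC subrK => h.
have st0 : s - t != 0 by rewrite subr_eq0.
have -> : a - f s / (s - t) = - ((f s - a * (s - t)) / (s - t)) by field.
by rewrite normrN normrM normfV ler_pdivrMr // normr_gt0.
Qed.

End RealIntervals.

(** * Plane curves and the soliton equation *)

Section PlaneCurves.
Context {R : realType}.
Local Notation C := R[i].
Implicit Types (c : R -> C) (z w l : C) (t : R).

Lemma real_complexV (a : R) : (a^-1)%:C = (a%:C)^-1 :> C.
Proof. exact: fmorphV. Qed.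

Lemma real_complexM (a b : R) : (a * b)%:C = a%:C * b%:C :> C.
Proof. exact: rmorphM. Qed.

Lemma real_complexD (a b : R) : (a + b)%:C = a%:C + b%:C :> C.
Proof. exact: rmorphD. Qed.

Lemma real_complexN (a : R) : (- a)%:C = - a%:C :> C.
Proof. exact: rmorphN. Qed.

Lemma conjC_neq0 z : z != 0 -> z^* != 0.
Proof. by rewrite conjC_eq0. Qed.

Lemma divcE z w : z / w = (sqnorm w)^-1%:C * (z * w^*).
Proof.
have [->|w0] := eqVneq w 0; first by rewrite invr0 conjC0 !mulr0.
have w0' := conjC_neq0 w0.
by rewrite real_complexV -mulcJ; field; apply/andP.
Qed.

Lemma Re2 z : (2 * Re z)%:C = z + z^*.
Proof. by apply: cplx_eq; rewrite !ReIm; ring. Qed.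

Lemma Im2 z : (2 * Im z)%:C * 'i = z - z^*.
Proof. by apply: cplx_eq; rewrite !ReIm; ring. Qed.

Lemma Im_div z w : Im (z / w) = Im (z * w^*) / sqnorm w.
Proof. by rewrite divcE ImM Re_real Im_real mul0r addr0 mulrC. Qed.

Lemma cnorm_sqr z : cnorm z ^+ 2 = sqnorm z.
Proof.
rewrite /cnorm /cdot mulcJ Re_real sqr_sqrtr //; exact: sqnorm_ge0.
Qed.

Lemma cnorm_gt0 z : z != 0 -> 0 < cnorm z.
Proof. by move=> z0; rewrite /cnorm /cdot mulcJ Re_real sqrtr_gt0 sqnorm_gt0. Qed.

Lemma cdot_i z w : cdot z ('i * w) = - Im (z^* * w).
Proof. by rewrite /cdot !ReIm; ring. Qed.

Lemma deriv_sqnorm c t l : has_cderiv c t l ->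
  is_derive t 1 (fun s => sqnorm (c s)) (2 * Re ((c t)^* * l)).
Proof.
move=> [h1 h2]; apply: deriv_eq (derivD (derivM h1 h1) (derivM h2 h2)) _.
by rewrite !ReIm; ring.
Qed.

Lemma cderivV c t l : has_cderiv c t l -> c t != 0 ->
  has_cderiv (fun s => (c s)^-1) t (- l / c t ^+ 2).
Proof.
move=> hc c0; have n0 : sqnorm (c t) != 0 by rewrite sqnorm_eq0.
have := cderivM (cderiv_real (derivV (deriv_sqnorm hc) n0)) (cderivJ hc).
have -> : (fun s => (sqnorm (c s))^-1%:C * (c s)^*) = fun s => (c s)^-1.
  by apply/funext => s; rewrite -[RHS]mul1r divcE mul1r.
move/cderiv_eq; apply.
have c0' := conjC_neq0 c0.
rewrite [(- _ / _)%:C]real_complexM !real_complexV real_complexN Re2 expr2 real_complexM -mulcJ.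
by rewrite conjM conjCK; field; apply/andP.
Qed.

Lemma cderiv_near c e t l : (\forall s \near t, c s = e s) ->
  has_cderiv c t l -> has_cderiv e t l.
Proof.
move=> ce [h1 h2]; split; [move: h1|move: h2]; apply: deriv_near;
  by apply: filterS ce => s ->.
Qed.

Lemma ccontinuous_deriv c t l : has_cderiv c t l ->
  {for t, continuous (fun s => Re (c s))} /\ {for t, continuous (fun s => Im (c s))}.
Proof. by move=> [h1 h2]; split; exact: deriv_continuous. Qed.

Lemma near_neq0 c t l : has_cderiv c t l -> c t != 0 ->
  \forall s \near t, c s != 0.
Proof.
move=> hc c0.
rewrite -sqnorm_gt0 in c0.
have h := cvgr_gt _ (deriv_continuous (deriv_sqnorm hc)) _ c0.
near=> s; rewrite -sqnorm_gt0; near: s; exact: h.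
Unshelve. all: by end_near. Qed.

(* [log_deriv c t r]: c moves on a circle with angular velocity r. *)
Definition log_deriv c t (r : R) := has_cderiv c t (c t * (r%:C * 'i)).

Lemma log_derivM c e t r r' : log_deriv c t r -> log_deriv e t r' ->
  log_deriv (fun s => c s * e s) t (r + r').
Proof.
by move=> hc he; apply: cderiv_eq (cderivM hc he) _; rewrite rmorphD; ring.
Qed.

Lemma log_derivX c t r k : log_deriv c t r ->
  log_deriv (fun s => c s ^+ k) t (k%:R * r).
Proof.
move=> hc; elim: k => [|k IH].
  by apply: cderiv_eq (cderiv_cst 1 t) _; rewrite mul0r mul0r mulr0.
have := log_derivM hc IH.
have -> : (fun s => c s * c s ^+ k) = fun s => c s ^+ k.+1.
  by apply/funext => s; rewrite exprS.
by rewrite -nat1r mulrDl mul1r.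
Qed.

(** c / conj c = e^(2i arg c) turns at twice the rate Im(c'/c) at which arg c changes. *)
Lemma log_deriv_phase c t l : has_cderiv c t l -> c t != 0 ->
  log_deriv (fun s => c s / (c s)^*) t (2 * Im (l / c t)).
Proof.
move=> hc c0; have c0' := conjC_neq0 c0.
apply: cderiv_eq (cderivM hc (cderivV (cderivJ hc) c0')) _.
rewrite Im2 conjM (fmorphV Num.conj).
by field; apply/andP.
Qed.

Lemma log_deriv_cis (f : R -> R) (t a : R) : is_derive t 1 f a ->
  log_deriv (fun s => cis (f s)) t a.
Proof. by move=> /cderiv_cis /cderiv_eq; apply; rewrite mulrC. Qed.

Section Soliton.
Variables (k : nat) (a : R) (I : set R) (c : R -> C).
Hypotheses (oI : open I) (iI : is_interval I).
Hypotheses (rc : regular_curve I c) (sc : soliton_curve k a I c).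

Lemma curve_deriv t : I t -> has_cderiv c t (cderiv c t).
Proof. exact: csmooth_on_deriv rc.1. Qed.

Lemma curve_deriv2 t : I t -> has_cderiv (cderiv c) t (cderiv (cderiv c) t).
Proof. exact: csmooth_on_deriv (csmooth_on_cderiv rc.1). Qed.

(** Multiplying the soliton equation by conj(c') and taking imaginary parts kills every tangential
    term. What remains says that arg c' + k arg c + a beta has derivative zero, since beta' =
    Im(conj(c) c'). *)
Lemma soliton_angle t : I t -> c t != 0 ->
  Im (cderiv (cderiv c) t / cderiv c t) + k%:R * Im (cderiv c t / c t) =
  - a * Im ((c t)^* * cderiv c t).
Proof.
move=> It c0; have c10 := rc.2 _ It.
have := sc It c0; rewrite /curvature_vector /position_perp.
(* Only the existence of the derivative r' of the inverse speed matters: it multiplies c', so its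
   term is tangential. *)
have [r' hr] : exists r', is_derive t 1 (fun s => (cnorm (cderiv c s))^-1) r'.
  have h := deriv_sqnorm (curve_deriv2 It).
  have n0 : 0 < sqnorm (cderiv c t) by rewrite sqnorm_gt0.
  have h' := deriv_comp (f := Num.sqrt) (g := fun s => sqnorm (cderiv c s))
    (is_derive1_sqrt n0) h.
  have s0 : Num.sqrt (sqnorm (cderiv c t)) != 0 by rewrite gt_eqF // sqrtr_gt0.
  have := derivV h' s0; set r' := (X in is_derive _ _ _ X) => h''.
  exists r'; have -> // : (fun s => (cnorm (cderiv c s))^-1) =
    (fun s => (Num.sqrt (sqnorm (cderiv c s)))^-1).
  by apply/funext => s; rewrite /cnorm /cdot mulcJ.
have := has_cderivP (cderivM (cderiv_real hr) (curve_deriv2 It)).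
rewrite -[cderiv _ t]/(cderiv (unit_tangent c) t) => ->.
rewrite /unit_tangent cnorm_sqr.
have rn : (cnorm (cderiv c t))^-1 ^+ 2 * sqnorm (cderiv c t) = 1.
  by rewrite -cnorm_sqr exprVn mulVf // expf_neq0 // gt_eqF // cnorm_gt0.
have n0 : sqnorm (cderiv c t) != 0 by rewrite sqnorm_eq0.
have v0 : sqnorm (c t) != 0 by rewrite sqnorm_eq0.
move: (cnorm (cderiv c t))^-1 rn => r rn.
rewrite !Im_div.
move: (cderiv (cderiv c) t) (cderiv c t) (c t) n0 v0 rn {c10 c0}.
move=> c2 c1 c0 n0 v0 rn.
set p := c0 - _ => E.
have pE : Im (p * c1^*) = Im (c0 * c1^*).
  by rewrite /p /cdot !ReIm; ring.
have := congr1 (fun z => Im (z * c1^*)) E.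
have -> : k%:R * (p / (sqnorm c0)%:C) = (k%:R / sqnorm c0)%:C * p :> C.
  by rewrite real_complexM real_complexV rmorph_nat; ring.
rewrite /= mulrBl ImD ImN -!mulrA [Im (a%:C * _)]ImM [Im ((_ / _)%:C * _)]ImM.
rewrite pE !Re_real !Im_real !mul0r !addr0.
have -> : Im (r%:C * ((r'%:C * c1 + r%:C * c2) * c1^*)) = r ^+ 2 * Im (c2 * c1^*).
  by rewrite !ReIm; ring.
have -> : r ^+ 2 = (sqnorm c1)^-1 by rewrite -[RHS]mul1r -rn mulfK.
have -> : Im (c1 * c0^*) = - Im (c0 * c1^*) by rewrite !ReIm; ring.
have -> : Im (c0^* * c1) = - Im (c0 * c1^*) by rewrite !ReIm; ring.
move=> h; rewrite mulrNN -h; field.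
by rewrite n0 v0.
Qed.

End Soliton.

End PlaneCurves.

(** * Constancy of the phase of a soliton curve *)

Section SolitonPhase.
Context {R : realType}.
Local Notation C := R[i].
Implicit Types (c e : R -> C) (t : R).

Definition ccont c t :=
  {for t, continuous (fun s => Re (c s))} /\ {for t, continuous (fun s => Im (c s))}.

Lemma ccontM c e t : ccont c t -> ccont e t -> ccont (fun s => c s * e s) t.
Proof.
move=> [c1 c2] [e1 e2]; split; rewrite /prop_for /continuous_at.
  under eq_fun do rewrite ReM; rewrite ReM.
  by apply: cvgB; apply: cvgM.
under eq_fun do rewrite ImM; rewrite ImM.
by apply: cvgD; apply: cvgM.
Qed.

Lemma ccontX c t k : ccont c t -> ccont (fun s => c s ^+ k) t.
Proof.
move=> hc; elim: k => [|k IH].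
  by split; apply: cvg_cst.
by under eq_fun do rewrite exprS; exact: ccontM.
Qed.

Lemma ccont_phase c t : ccont c t -> c t != 0 ->
  ccont (fun s => c s / (c s)^*) t.
Proof.
move=> hc c0; under eq_fun do rewrite divcE conjCK.
have [c1 c2] := hc.
apply: ccontM; last exact: ccontM.
split; rewrite /prop_for /continuous_at /=; last exact: cvg_cst.
apply: cvgV; first by rewrite sqnorm_eq0 conjC_eq0.
under eq_fun do rewrite /sqnorm ReJ ImJ sqrrN.
rewrite /sqnorm ReJ ImJ sqrrN !expr2.
by apply: cvgD; apply: cvgM.
Qed.

Lemma ccont_near c e t : (\forall s \near t, c s = e s) -> ccont c t -> ccont e t.
Proof.
move=> ce [c1 c2]; have cet := nbhs_singleton ce.
split; rewrite /prop_for /continuous_at -cet; [move: c1|move: c2]; apply: cvg_trans;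
  apply: near_eq_cvg; near=> s; congr (_ _); near: s; exact: ce.
Unshelve. all: by end_near. Qed.

(* c / conj c, extended continuously through the zeros of a regular curve *)
Definition unit_phase c t :=
  if c t == 0 then cderiv c t / (cderiv c t)^* else c t / (c t)^*.

(** The Hadamard quotient of c at a zero t, taken on real and imaginary parts separately so that
    [deriv_quotient] applies to each. *)
Definition chord c t s : C :=
  (if s == t then Re (cderiv c t) else Re (c s) / (s - t)) +i*
  (if s == t then Im (cderiv c t) else Im (c s) / (s - t)).

Lemma chord_cont c t : has_cderiv c t (cderiv c t) -> c t = 0 -> ccont (chord c t) t.
Proof.
move=> [h1 h2] c0; split.
  by apply: (deriv_quotient h1); rewrite c0.
by apply: (deriv_quotient h2); rewrite c0.
Qed.

Lemma chordE c t s : s != t -> c s = (s - t)%:C * chord c t s.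
Proof.
move=> st; have st0 : s - t != 0 by rewrite subr_eq0.
rewrite /chord (negbTE st); apply: cplx_eq.
  by rewrite ReM Re_real Im_real mul0r subr0 /= mulrC divfK.
by rewrite ImM Re_real Im_real mul0r addr0 /= mulrC divfK.
Qed.

Lemma chord_neq0 c t : has_cderiv c t (cderiv c t) -> c t = 0 ->
  cderiv c t != 0 -> \forall s \near t, chord c t s != 0.
Proof.
move=> hc c0 c10; have [h1 h2] := chord_cont hc c0.
have ht : chord c t t = cderiv c t by apply: cplx_eq; rewrite /= eqxx.
have h : {for t, continuous (fun s => sqnorm (chord c t s))}.
  rewrite /prop_for /continuous_at /sqnorm.
  by apply: cvgD; under eq_fun do rewrite expr2; rewrite expr2; exact: cvgM.
have n0 : 0 < sqnorm (chord c t t) by rewrite ht sqnorm_gt0.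
have h' := cvgr_gt _ h _ n0.
near=> s; rewrite -sqnorm_gt0; near: s; exact: h'.
Unshelve. all: by end_near. Qed.

(** Near a zero t, c(s) = (s - t) [chord c t s], and the real factor s - t cancels in c / conj c.
    The argument of c jumps by pi at t, but the phase, which doubles it, does not. *)
Lemma unit_phase_cont c t : has_cderiv c t (cderiv c t) -> c t = 0 ->
  cderiv c t != 0 -> ccont (unit_phase c) t.
Proof.
move=> hc c0 c10; have hne := chord_neq0 hc c0 c10.
have ht : chord c t t = cderiv c t by apply: cplx_eq; rewrite /= eqxx.
have := ccont_phase (chord_cont hc c0); rewrite ht => /(_ c10).
apply: ccont_near; near=> s.
have [->|st] := eqVneq s t; first by rewrite /unit_phase c0 eqxx ht.
have s0 : chord c t s != 0 by near: s; exact: hne.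
have cE := chordE c st.
have st0 : (s - t)%:C != 0 :> C.
  by apply/eqP => /complexI /eqP; rewrite subr_eq0; apply/negP.
have cs0 : c s != 0 by rewrite cE mulf_neq0.
have s0' := conjC_neq0 s0.
rewrite /unit_phase (negbTE cs0) cE conjM conjcR.
move: (chord c t s)^* (s - t)%:C s0' st0 => z x z0 x0; field.
by rewrite x0 z0.
Unshelve. all: by end_near. Qed.

Section Phase.
Variables (I : set R) (c : R -> C) (s0 : R).
Hypotheses (oI : open I) (iI : is_interval I) (rc : regular_curve I c) (Is0 : I s0).

Let hc t := @curve_deriv R I c rc t.
Let hc2 t := @curve_deriv2 R I c rc t.

Lemma beta_integrand_cont t : I t ->
  {for t, continuous (fun s => cdot (c s) ('i * cderiv c s))}.
Proof.
move=> It; have [_ h] := cderivM (cderivJ (hc It)) (hc2 It).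
have := deriv_continuous (derivN h).
have -> // : (fun s => - Im ((c s)^* * cderiv c s)) = (fun s => cdot (c s) ('i * cderiv c s)).
by apply/funext => s; rewrite cdot_i.
Qed.

Lemma beta_deriv s : I s ->
  is_derive s 1 (beta c s0) (Im ((c s)^* * cderiv c s)).
Proof.
move=> Is; have h := oriented_integral_deriv oI iI beta_integrand_cont Is0 Is.
by apply: deriv_eq (derivN h) _; rewrite cdot_i opprK.
Qed.

Lemma beta_tilde_deriv s : I s ->
  is_derive s 1 (beta_tilde c s0) (sqnorm (c s) * Im ((c s)^* * cderiv c s)).
Proof.
move=> Is.
have h t : I t -> {for t, continuous
    (fun s => cnorm (c s) ^+ 2 * cdot (c s) ('i * cderiv c s))}.
  move=> It; rewrite /prop_for /continuous_at cnorm_sqr.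
  under eq_fun do rewrite cnorm_sqr.
  apply: cvgM.
    exact: deriv_continuous (deriv_sqnorm (hc It)).
  exact: beta_integrand_cont.
apply: deriv_eq (derivN (oriented_integral_deriv oI iI h Is0 Is)) _.
by rewrite cnorm_sqr cdot_i mulrN opprK.
Qed.

Variables (k : nat) (a : R).
Hypothesis sc : soliton_curve k a I c.

(** This is e^(2i (k arg c + arg c' + a beta)), with k arg c extended through the zeros of c. *)
Definition soliton_phase t :=
  unit_phase c t ^+ k * (cderiv c t / (cderiv c t)^*) * cis (2 * a * beta c s0 t).

Lemma soliton_phase_deriv_neq0 t : I t -> c t != 0 -> has_cderiv soliton_phase t 0.
Proof.
move=> It c0.
have hb : is_derive t 1 (fun s => 2 * a * beta c s0 s)
    (2 * a * Im ((c t)^* * cderiv c t)).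
  apply: deriv_eq (derivM (deriv_cst t (2 * a)) (beta_deriv It)) _.
  by rewrite mul0r add0r.
have h := log_derivM (log_derivM (log_derivX k (log_deriv_phase (hc It) c0))
  (log_deriv_phase (hc2 It) (rc.2 _ It))) (log_deriv_cis hb).
have r0 : k%:R * (2 * Im (cderiv c t / c t)) +
    2 * Im (cderiv (cderiv c) t / cderiv c t) +
    2 * a * Im ((c t)^* * cderiv c t) = 0.
  by have := soliton_angle rc sc It c0; lra.
rewrite r0 /log_deriv mul0r mulr0 in h; apply: cderiv_near h.
have hn := near_neq0 (hc It) c0.
near=> s; rewrite /soliton_phase /unit_phase ifF //.
by apply/negbTE; near: s; exact: hn.
Unshelve. all: by end_near. Qed.

(** Zeros of c are isolated because c' does not vanish. The phase is therefore continuous at such a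
    point with zero derivative on a punctured neighbourhood. *)
Lemma soliton_phase_deriv t : I t -> has_cderiv soliton_phase t 0.
Proof.
move=> It; have [c0|] := eqVneq (c t) 0; last exact: soliton_phase_deriv_neq0.
have [h1 h2] : ccont soliton_phase t.
  apply: ccontM.
    apply: ccontM; first exact: ccontX (unit_phase_cont (hc It) c0 (rc.2 _ It)).
    exact: ccont_phase (ccontinuous_deriv (hc2 It)) (rc.2 _ It).
  exact: ccontinuous_deriv (cderiv_cis (derivM (deriv_cst t (2 * a)) (beta_deriv It))).
have hn : \forall s \near t^', has_cderiv soliton_phase s 0.
  have hne := chord_neq0 (hc It) c0 (rc.2 _ It).
  have hI : \forall s \near t, I s by exact: open_nbhs_nbhs.
  near=> s; have st : s != t by near: s; exact: nbhs_dnbhs_neq.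
  apply: soliton_phase_deriv_neq0; first by near: s; exact: nbhs_dnbhs hI.
  rewrite (chordE c st) mulf_neq0 //; last by near: s; exact: nbhs_dnbhs hne.
  by apply/eqP => /complexI /eqP; rewrite subr_eq0; apply/negP.
by split; apply: deriv0_punctured => //; apply: filterS hn => s [].
Unshelve. all: by end_near. Qed.

Lemma soliton_phase_cst t : I t -> soliton_phase t = soliton_phase s0.
Proof.
move=> It; apply: cplx_eq.
  by apply: (deriv0_cst (f := fun s => Re (soliton_phase s)) iI) => // x /soliton_phase_deriv[].
by apply: (deriv0_cst (f := fun s => Im (soliton_phase s)) iI) => // x /soliton_phase_deriv[].
Qed.

End Phase.

End SolitonPhase.

(** * The map F and its velocities *)

(** The data shared by all arguments before the soliton equations enter. [cons_momentless] encodes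
    the position of V in the zero level of mu; [cons_unit] is extracted from the normalisation of V
    by [normalized_unit]. *)
Record construction {R : realType} {d : nat} (G : set 'M[R[i]]_d)
    (V : 'cV[R[i]]_d) (I1 I2 : set R) (gam xi : R -> R[i]) (s1 s2 : R) : Prop :=
  Construction {
    cons_group : is_subgroup G;
    cons_SU : G `<=` SU;
    cons_compact : compact G;
    cons_momentless : momentless G V;
    cons_unit : hip V V = 1;
    cons_open1 : open I1;
    cons_itv1 : is_interval I1;
    cons_base1 : I1 s1;
    cons_curve1 : regular_curve I1 gam;
    cons_open2 : open I2;
    cons_itv2 : is_interval I2;
    cons_base2 : I2 s2;
    cons_curve2 : regular_curve I2 xi
  }.

Section Velocities.
Context {R : realType} {d : nat}.
Local Notation C := R[i].
Local Notation point := ('M[C]_d * R * R)%type.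
Variables (G : set 'M[C]_d) (V : 'cV[C]_d) (I1 I2 : set R) (gam xi : R -> C).
Variables (s1 s2 : R).
Hypothesis S : construction G V I1 I2 gam xi s1 s2.
Implicit Types (p : point) (A B g : 'M[C]_d) (a b : R).

Let hG := cons_group S. Let hGSU := cons_SU S.
Let hV := cons_momentless S. Let V1 := cons_unit S.
Let oI1 := cons_open1 S. Let iI1 := cons_itv1 S. Let Is1 := cons_base1 S.
Let oI2 := cons_open2 S. Let iI2 := cons_itv2 S. Let Is2 := cons_base2 S.
Let rgam := cons_curve1 S. Let rxi := cons_curve2 S.
Let F := Fmap V gam xi s1 s2.
Let D := domain G I1 I2.
Let D' := D `&` F @^-1` off_axis.

Lemma liouvilleE k (z v : 'cV[C]_k) : liouville z v = (Im (hip z v))%:C.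
Proof.
rewrite /liouville hipE Im_sum rmorph_sum; apply: eq_bigr => i _.
have i0 : 'i != 0 :> C := neq0Ci _.
have -> : z i 0 * (v i 0)^* = ((z i 0)^* * v i 0)^* by rewrite conjM conjCK.
rewrite -Im2 real_complexM rmorph_nat.
by field.
Qed.

Lemma orbit_unit g : G g -> hip (g *m V) (g *m V) = 1.
Proof. by move=> Gg; rewrite hip_unitary // (group_hadjl hGSU). Qed.

Definition height x y : C := (Fcheck gam xi s1 s2 x y).2.

Lemma Re_height x y : Re (height x y) = 2^-1 * (sqnorm (xi y) - sqnorm (gam x)).
Proof. by rewrite -!cnorm_sqr. Qed.

Lemma Im_height x y : Im (height x y) = beta xi s2 y - beta gam s1 x.
Proof. by []. Qed.

Lemma FmapE p : F p = col_mx ((gam p.1.2 * xi p.2) *: (p.1.1 *m V)) (height p.1.2 p.2)%:M.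
Proof.
case: p => [[g x] y].
by rewrite /F /Fmap /ext_act /PhiId_inv col_mxKu col_mxKd -scalemxAr.
Qed.

(** The velocity of F when g' g^(-1) = A, x' = a, y' = b. Recording g' on the left of g lets one
    fixed A define a tangent field along a whole path. *)
Definition tvec p A a b : 'cV[C]_(d + 1) :=
  let: (g, x, y) := p in
  col_mx ((gam x * xi y) *: (A *m (g *m V)) +
          (a%:C * (cderiv gam x * xi y) + b%:C * (gam x * cderiv xi y)) *: (g *m V))
    (b%:C * ((xi y)^* * cderiv xi y) - a%:C * ((gam x)^* * cderiv gam x))%:M.

Lemma tvec_lin p A B a b a' b' (r : R) :
  tvec p (r%:C *: A + B) (r * a + a') (r * b + b') =
  r%:C *: tvec p A a b + tvec p B a' b'.
Proof.
case: p => [[g x] y]; rewrite /tvec scale_col_mx add_col_mx; congr col_mx.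
  rewrite mulmxDl -scalemxAl !rmorphD !rmorphM /=.
  move: (A *m _) => AV; move: (B *m _) => BV; move: (g *m V) => q.
  apply/matrixP => i j; rewrite !mxE; ring.
by apply/matrixP => i j; rewrite !ord1 !mxE eqxx !mulr1n !rmorphD !rmorphM /=; ring.
Qed.

Definition weight x y : R := sqnorm (gam x) + sqnorm (xi y).

(** The last coordinate of F is such that its mixed term in x and y cancels the one from gamma xi,
    while the pure terms add up to |gamma'|^2 and |xi'|^2 times [weight]. *)
Lemma hip_tvec g x y A B a b a' b' : G g -> lie G A -> lie G B ->
  hip (tvec (g, x, y) A a b) (tvec (g, x, y) B a' b') =
  (sqnorm (gam x * xi y))%:C * hip (A *m (g *m V)) (B *m (g *m V)) +
  ((a * a' * sqnorm (cderiv gam x) + b * b' * sqnorm (cderiv xi y)) *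
   weight x y)%:C.
Proof.
move=> Gg lA lB; have hq := momentlessM hG hGSU Gg hV.
have AV : hip (A *m (g *m V)) (g *m V) = 0.
  by rewrite -hipJ hq // conjC0.
rewrite /tvec hip_col hip_scalar !hipDl !hipDr !hipZl !hipZr AV hq // orbit_unit //.
rewrite !mulr0 !addr0 !add0r mulr1.
move: (hip _ _) => h; rewrite -mulcJ /weight.
have -> : ((a * a' * sqnorm (cderiv gam x) + b * b' * sqnorm (cderiv xi y)) *
    (sqnorm (gam x) + sqnorm (xi y)))%:C =
    (a%:C * a'%:C * (cderiv gam x * (cderiv gam x)^*) +
     b%:C * b'%:C * (cderiv xi y * (cderiv xi y)^*)) *
    (gam x * (gam x)^* + xi y * (xi y)^*).
  by rewrite !mulcJ !(real_complexD, real_complexM).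
rewrite !(conjD, conjN, conjM) !conjCK !conjcR.
by ring.
Qed.

Lemma tvec_isotropic g x y A B a b a' b' : G g -> lie G A -> lie G B ->
  Im (hip (tvec (g, x, y) A a b) (tvec (g, x, y) B a' b')) = 0.
Proof.
move=> Gg lA lB; rewrite hip_tvec // ImD Im_real addr0 ImM Im_real mul0r addr0.
by rewrite (momentless_isotropic hG hGSU (momentlessM hG hGSU Gg hV)) // mulr0.
Qed.

Lemma weight_gt0 x y : gam x != 0 -> 0 < weight x y.
Proof. by move=> g0; rewrite ltr_wpDr ?sqnorm_ge0 // sqnorm_gt0. Qed.

(** By [hip_tvec] the squared norm is a sum of nonnegative terms whose coefficients are positive off
    the axis. *)
Lemma tvec_eq0 g x y A a b : G g -> lie G A -> I1 x -> I2 y ->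
  gam x != 0 -> xi y != 0 -> tvec (g, x, y) A a b = 0 ->
  [/\ A *m (g *m V) = 0, a = 0 & b = 0].
Proof.
move=> Gg lA Ix Iy g0 x0 t0.
have := hip_tvec x y a b a b Gg lA lA; rewrite t0 hip0l hip_ge0.
set n := \sum_i _ => /(congr1 (@complex.Re R)).
rewrite Re0 ReD ReM !Re_real !Im_real mul0r subr0.
have n0 : 0 <= n by apply: sumr_ge0 => i _; exact: sqnorm_ge0.
have w0 : 0 < sqnorm (gam x * xi y) by rewrite sqnorm_gt0 mulf_neq0.
have p0 := weight_gt0 y g0.
have g1 : 0 < sqnorm (cderiv gam x) by rewrite sqnorm_gt0 rgam.2.
have x1 : 0 < sqnorm (cderiv xi y) by rewrite sqnorm_gt0 rxi.2.
have a0 : 0 <= a * a * sqnorm (cderiv gam x).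
  by rewrite mulr_ge0 ?(ltW g1) // -expr2 sqr_ge0.
have b0 : 0 <= b * b * sqnorm (cderiv xi y).
  by rewrite mulr_ge0 ?(ltW x1) // -expr2 sqr_ge0.
move=> /esym/eqP; rewrite paddr_eq0; last 2 first.
- by rewrite mulr_ge0 // ltW.
- by rewrite mulr_ge0 ?(ltW p0) // addr_ge0.
rewrite !mulf_eq0 (gt_eqF w0) (gt_eqF p0) orbF /= => /andP[/eqP n00].
rewrite paddr_eq0 // !mulf_eq0 (gt_eqF g1) (gt_eqF x1) !orbF !orbb.
move=> /andP[/eqP -> /eqP ->].
split=> //; apply: hip_eq0; rewrite hip_ge0 -/n n00; exact: rmorph0.
Qed.

Lemma off_axisE g x y : G g -> off_axis (F (g, x, y)) <-> gam x != 0 /\ xi y != 0.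
Proof.
move=> Gg; change (usubmx (F (g, x, y)) != 0 <-> gam x != 0 /\ xi y != 0).
rewrite FmapE col_mxKu scaler_eq0 mulf_eq0 !negb_or /=.
have -> /= : g *m V != 0.
  by apply/eqP => q0; have := orbit_unit Gg; rewrite q0 hip0l => /eqP; rewrite eq_sym oner_eq0.
by rewrite andbT; split=> [/andP[]|[-> ->]].
Qed.

Lemma domain_off p : D' p <->
  [/\ G p.1.1, I1 p.1.2, I2 p.2, gam p.1.2 != 0 & xi p.2 != 0].
Proof.
case: p => [[g x] y]; split=> [[[/= Gg Ix Iy] /(off_axisE _ _ Gg)[]]|[/= Gg Ix Iy g0 x0]] //.
by split=> //; apply/off_axisE.
Qed.

Section AlongPath.
Variable c : R -> point.
Hypothesis hc : smooth_path D c.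
Local Notation gc t := (c t).1.1.
Local Notation xc t := (c t).1.2.
Local Notation yc t := (c t).2.

Lemma pathD t : [/\ G (gc t), I1 (xc t) & I2 (yc t)].
Proof. by case: hc => _ _ _ /(_ t)[]. Qed.

Lemma path_g : msmooth (fun t => gc t). Proof. by case: hc. Qed.
Lemma path_x : smooth (fun t => xc t). Proof. by case: hc => _ ? _ _; apply/smoothP. Qed.
Lemma path_y : smooth (fun t => yc t). Proof. by case: hc => _ _ ? _; apply/smoothP. Qed.

Local Notation g' t := (mderiv (fun s => gc s) t).
Local Notation x' t := (derive1 (fun s => xc s) t).
Local Notation y' t := (derive1 (fun s => yc s) t).

Definition path_lie t : 'M[C]_d := g' t *m hadj (gc t).

Lemma path_lie_mem t : lie G (path_lie t).
Proof.
by apply: (lie_path hG hGSU t path_g) => s; have [] := pathD s.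
Qed.

Lemma path_lieE t : path_lie t *m (gc t *m V) = g' t *m V.
Proof.
have [Gg _ _] := pathD t.
by rewrite /path_lie -!mulmxA [hadj _ *m _]mulmxA (group_hadjl hGSU Gg) mul1mx.
Qed.

Lemma cderiv_gam t : has_cderiv (fun s => gam (xc s)) t ((x' t)%:C * cderiv gam (xc t)).
Proof.
have [_ Ix _] := pathD t.
exact: (cderiv_comp (f := fun s => xc s) (curve_deriv rgam Ix) (smoothW t path_x)).
Qed.

Lemma cderiv_xi t : has_cderiv (fun s => xi (yc s)) t ((y' t)%:C * cderiv xi (yc t)).
Proof.
have [_ _ Iy] := pathD t.
exact: (cderiv_comp (f := fun s => yc s) (curve_deriv rxi Iy) (smoothW t path_y)).
Qed.

Lemma cderiv_gam1 t : has_cderiv (fun s => cderiv gam (xc s)) t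
  ((x' t)%:C * cderiv (cderiv gam) (xc t)).
Proof.
have [_ Ix _] := pathD t.
exact: (cderiv_comp (f := fun s => xc s) (curve_deriv2 rgam Ix) (smoothW t path_x)).
Qed.

Lemma cderiv_xi1 t : has_cderiv (fun s => cderiv xi (yc s)) t
  ((y' t)%:C * cderiv (cderiv xi) (yc t)).
Proof.
have [_ _ Iy] := pathD t.
exact: (cderiv_comp (f := fun s => yc s) (curve_deriv2 rxi Iy) (smoothW t path_y)).
Qed.

Lemma deriv_beta_gam (t : R) : is_derive t 1 (fun s => beta gam s1 (xc s))
  (Im ((gam (xc t))^* * cderiv gam (xc t)) * x' t).
Proof.
have [_ Ix _] := pathD t.
exact: (deriv_comp (g := fun s => xc s) (beta_deriv oI1 iI1 rgam Is1 Ix) (smoothW t path_x)).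
Qed.

Lemma deriv_beta_xi (t : R) : is_derive t 1 (fun s => beta xi s2 (yc s))
  (Im ((xi (yc t))^* * cderiv xi (yc t)) * y' t).
Proof.
have [_ _ Iy] := pathD t.
exact: (deriv_comp (g := fun s => yc s) (beta_deriv oI2 iI2 rxi Is2 Iy) (smoothW t path_y)).
Qed.

Lemma deriv_sq_gam (t : R) : is_derive t 1 (fun s => cnorm (gam (xc s)) ^+ 2)
  (2 * (x' t * Re ((gam (xc t))^* * cderiv gam (xc t)))).
Proof.
under eq_fun do rewrite cnorm_sqr.
apply: deriv_eq (deriv_sqnorm (cderiv_gam t)) _.
by rewrite !ReIm; ring.
Qed.

Lemma deriv_sq_xi (t : R) : is_derive t 1 (fun s => cnorm (xi (yc s)) ^+ 2)
  (2 * (y' t * Re ((xi (yc t))^* * cderiv xi (yc t)))).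
Proof.
under eq_fun do rewrite cnorm_sqr.
apply: deriv_eq (deriv_sqnorm (cderiv_xi t)) _.
by rewrite !ReIm; ring.
Qed.

Lemma cderiv_height t : has_cderiv (fun s => height (xc s) (yc s)) t
  ((y' t)%:C * ((xi (yc t))^* * cderiv xi (yc t)) -
   (x' t)%:C * ((gam (xc t))^* * cderiv gam (xc t))).
Proof.
split.
  apply: deriv_eq (derivM (deriv_cst t 2^-1) (derivB (deriv_sq_xi t) (deriv_sq_gam t))) _.
  by rewrite ReD ReN 2!(ReM _%:C) !Re_real !Im_real; field.
apply: deriv_eq (derivB (deriv_beta_xi t) (deriv_beta_gam t)) _.
by rewrite ImD ImN 2!(ImM _%:C) !Re_real !Im_real; ring.
Qed.

Lemma path_velocity t :
  has_mderiv (F \o c) t (tvec (c t) (path_lie t) (x' t) (y' t)).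
Proof.
have -> : F \o c = fun s => col_mx ((gam (xc s) * xi (yc s)) *: (gc s *m V))
    (height (xc s) (yc s))%:M.
  by apply/funext => s; rewrite /= FmapE.
have h := mderiv_col (mderivZ (cderivM (cderiv_gam t) (cderiv_xi t))
    (mderivMr V (msmoothW t path_g))) (mderiv_scalar (n := 1) (cderiv_height t)).
apply: mderiv_eq h _; have := path_lieE t; rewrite /tvec; case: (c t) => [[g x] y] /= ->.
congr (col_mx _ _); rewrite addrC; congr (_ + _ *: _).
by ring.
Qed.

Lemma mderiv_path : mderiv (F \o c) =
  fun t => tvec (c t) (path_lie t) (x' t) (y' t).
Proof. by apply/funext => t; exact: has_mderivP (path_velocity t). Qed.

End AlongPath.

Lemma smooth_path_sub c : smooth_path D' c -> smooth_path D c.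
Proof. by case=> h1 h2 h3 h4; split=> // t; case: (h4 t). Qed.

(** Orbit directions contribute nothing, because <q, A q> = 0. The first block then gives |xi|^2 d
    beta_gamma + |gamma|^2 d beta_xi, to which the Liouville form of the last coordinate is added;
    comparison with the derivative of the primitive is a polynomial identity. *)
Lemma liouville_primitiveF : liouville_primitive F D (fun p =>
  let: (_, x, y) := p in
  - 2^-1 * (cnorm (gam x) ^+ 2 - cnorm (xi y) ^+ 2)
         * (beta gam s1 x - beta xi s2 y)
  + beta_tilde gam s1 x + beta_tilde xi s2 y).
Proof.
move=> c t hc; set f := (X in X \o c).
have [Gg Ix Iy] := pathD hc t.
have h := derivD (derivD
  (derivM (derivM (deriv_cst t (- 2^-1)) (derivB (deriv_sq_gam hc t) (deriv_sq_xi hc t)))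
     (derivB (deriv_beta_gam hc t) (deriv_beta_xi hc t)))
  (deriv_comp (g := fun s => (c s).1.2) (beta_tilde_deriv oI1 iI1 rgam Is1 Ix) (smoothW t (path_x hc))))
  (deriv_comp (g := fun s => (c s).2) (beta_tilde_deriv oI2 iI2 rxi Is2 Iy) (smoothW t (path_y hc))).
have fc : f \o c = fun s => - 2^-1 *
    (cnorm (gam (c s).1.2) ^+ 2 - cnorm (xi (c s).2) ^+ 2) *
    (beta gam s1 (c s).1.2 - beta xi s2 (c s).2)
    + beta_tilde gam s1 (c s).1.2 + beta_tilde xi s2 (c s).2.
  by apply/funext => s /=; rewrite /f; case: (c s) => [[]].
rewrite -fc in h.
split; first by case: h.
rewrite (deriv_derive1 h) liouvilleE (mderiv_path hc) FmapE; congr (_%:C).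
have lA := path_lie_mem hc t.
rewrite /tvec; move: (derive1 _ t) (derive1 _ t) (path_lie c t) lA => a b A lA.
move: Gg Ix Iy {h}; case: (c t) => [[g x] y] /= Gg Ix Iy.
rewrite hip_col hip_scalar hipZl hipDr !hipZr (momentlessM hG hGSU Gg hV) // orbit_unit //.
rewrite mulr0 add0r mulr1 !cnorm_sqr ImD 2!ImM !ReJ !ImJ Re_height Im_height.
move: (beta gam s1 x) => b1; move: (beta xi s2 y) => b2.
move: (gam x) (xi y) (cderiv gam x) (cderiv xi y) => [g0 g0'] [x0 x0'] [g1 g1'] [x1 x1'].
by rewrite /sqnorm !ReIm; field.
Qed.

End Velocities.

(** * Invariance of the real dimension *)

Section BasisSize.
Context {R : realType} {p q : nat}.
Local Notation C := R[i].

(** The matrix [B] of coordinates of r in s is row free: a left kernel vector would be a linear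
    relation among the elements of r. *)
Lemma basis_size_le (T : set 'M[C]_(p, q)) s r :
  real_basis T s -> real_basis T r -> (size r <= size s)%N.
Proof.
move=> bs br.
have /choice[a ha] j : exists a : nat -> R, (j < size r)%N ->
    r`_j = \sum_(i < size s) (a i)%:C *: s`_i.
  case: (ltnP j (size r)) => [lj|_]; last by exists (fun=> 0).
  by have /bs.1[a ->] := basis_mem br lj; exists a.
pose B : 'M[R]_(size r, size s) := \matrix_(j, i) a j i.
suff /eqP <- : row_free B by exact: rank_leq_col.
rewrite -kermx_eq0; apply/eqP/row_matrixP => l; rewrite row0.
have /rowP uB : row l (kermx B) *m B = 0 by rewrite -row_mul mulmx_ker row0.
move: (row l (kermx B)) uB => u uB; apply/rowP => j; rewrite [RHS]mxE.
pose un (k : nat) : R := if insub k is Some k' then u 0 k' else 0.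
have unE (k : 'I_(size r)) : un k = u 0 k by rewrite /un valK.
rewrite -unE; apply: br.2 => //.
transitivity (\sum_(k < size r) \sum_(i < size s) (u 0 k * B k i)%:C *: s`_i).
  apply: eq_bigr => k _; rewrite unE ha // scaler_sumr; apply: eq_bigr => i _.
  by rewrite scalerA -real_complexM mxE.
rewrite exchange_big big1 // => i _; rewrite -scaler_suml -rmorph_sum.
have := uB i; rewrite !mxE => ->.
by rewrite rmorph0 scale0r.
Qed.

Lemma real_dim_size (T : set 'M[C]_(p, q)) s n :
  real_dim T n -> real_basis T s -> size s = n.
Proof.
move=> [r <- br] bs.
by apply/anti_leq; rewrite (basis_size_le bs br) (basis_size_le br bs).
Qed.

End BasisSize.

(** Smooth paths are parametrised by the whole real line and must stay in the domain, so a
    prescribed velocity has to be realised by a bounded function; the amplitude e / 2 and frequency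
    2a / e of the sine do this. *)
Lemma wiggle {R : realType} (x a e : R) : 0 < e -> exists f : R -> R,
  [/\ smooth f, f 0 = x, is_derive (0 : R) 1 f a & forall t, `|x - f t| < e].
Proof.
move=> e0; have e0' : e != 0 by rewrite gt_eqF.
exists (fun t => x + e / 2 * sin (0 + 2 * a / e * t)); split.
- apply: smoothD (smooth_cst _) (smoothM (smooth_cst _) _).
  exact: smooth_comp_aff smooth_sin.
- by rewrite mulr0 addr0 sin0 mulr0 addr0.
- have h := deriv_comp (f := sin) (g := fun t => 0 + 2 * a / e * t)
    (is_derive_sin (0 + 2 * a / e * 0)) (deriv_aff 0 0 (2 * a / e)).
  apply: deriv_eq (derivD (deriv_cst 0 x) (derivM (deriv_cst 0 (e / 2)) h)) _.
  by rewrite mulr0 addr0 cos0; field.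
- move=> t; rewrite opprD addrA subrr sub0r normrN normrM (gtr0_norm (divr_gt0 e0 _)) //.
  have := sin_max (0 + 2 * a / e * t) => h.
  by have := ler_wpM2l (ltW (divr_gt0 e0 (ltr0Sn R 1))) h; lra.
Qed.

(** * Tangent spaces, immersion and cohomogeneity *)

Section TangentSpace.
Context {R : realType} {d : nat}.
Local Notation C := R[i].
Local Notation point := ('M[C]_d * R * R)%type.
Variables (G : set 'M[C]_d) (V : 'cV[C]_d) (I1 I2 : set R) (gam xi : R -> C).
Variables (s1 s2 : R).
Hypothesis S : construction G V I1 I2 gam xi s1 s2.
Let hG := cons_group S. Let hGSU := cons_SU S.
Let hV := cons_momentless S.
Let F := Fmap V gam xi s1 s2.
Let D := domain G I1 I2.
Let D' := D `&` F @^-1` off_axis.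
Implicit Types (p : point).

Lemma curve_nbhd (I : set R) c x : open I -> regular_curve I c -> I x ->
  c x != 0 -> exists2 e, 0 < e & forall y, `|x - y| < e -> I y /\ c y != 0.
Proof.
move=> oI rc Ix c0.
have hI : \forall y \near x, I y by exact: open_nbhs_nbhs.
have : nbhs x [set y | I y /\ c y != 0].
  exact: filterI hI (near_neq0 (curve_deriv rc Ix) c0).
move=> /nbhs_ballP[e /= e0 he].
by exists e.
Qed.

Lemma tangentE p : D' p -> tangent F D' p =
  [set v | exists A a b, lie G A /\ v = tvec V gam xi p A a b].
Proof.
move=> Dp; apply/seteqP; split=> [v [c [hc c0 <-]]|v [A [a [b [lA ->]]]]] /=.
  have hc' := smooth_path_sub hc.
  exists (path_lie c 0), (derive1 (fun s => (c s).1.2) 0), (derive1 (fun s => (c s).2) 0).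
  by split; [exact: path_lie_mem S _ hc' 0|rewrite (mderiv_path S hc') c0].
have /(domain_off S)[] := Dp; case: p Dp => [[g x] y] Dp /= Gg Ix Iy g0 x0.
have [e1 e10 h1] := curve_nbhd (cons_open1 S) (cons_curve1 S) Ix g0.
have [e2 e20 h2] := curve_nbhd (cons_open2 S) (cons_curve2 S) Iy x0.
have [f1 [sf1 f10 df1 f1e]] := wiggle x a e10.
have [f2 [sf2 f20 df2 f2e]] := wiggle y b e20.
case: (lA) => k [sk Gk k0 dk].
(* Left multiplication of g by k gives g' g^(-1) = A at 0, and the wiggles keep x and y where the
   intervals and the nonvanishing of gamma and xi allow. *)
pose c t : point := (k t *m g, f1 t, f2 t).
have hc : smooth_path D' c.
  split.
  - exact: msmoothM sk (msmooth_cst g).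
  - exact/smoothP.
  - exact/smoothP.
  - move=> t; apply/(domain_off S).
    have [? ?] := h1 _ (f1e t); have [? ?] := h2 _ (f2e t).
    by split=> //; exact: group_mul.
have c0 : c 0 = (g, x, y) by rewrite /c k0 mul1mx f10 f20.
exists c; split=> //.
have hc' := smooth_path_sub hc.
rewrite (mderiv_path S hc') c0; congr tvec.
- rewrite /path_lie /= k0 mul1mx.
  have -> : mderiv (fun s => k s *m g) 0 = A *m g.
    by apply: has_mderivP; apply: mderivMr; rewrite -dk; exact: msmoothW.
  by rewrite -mulmxA (group_hadjr hGSU) // mulmx1.
- exact: deriv_derive1.
- exact: deriv_derive1.
Qed.

Lemma tangent_isotropic p : D' p -> isotropic (tangent F D' p).
Proof.
move=> Dp; rewrite tangentE // => u v [A [a [b [lA ->]]]] [B [a' [b' [lB ->]]]].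
rewrite kaehlerE; have /(domain_off S)[] := Dp; case: p {Dp} => [[g x] y] /= Gg _ _ _ _.
exact: (tvec_isotropic S).
Qed.

Lemma tangent_subspace p : D' p -> real_subspace (tangent F D' p).
Proof.
move=> Dp; rewrite tangentE //; split.
  exists 0, 0, 0; split; first by case: (lie_subspace hG).
  case: p {Dp} => [[g x] y]; rewrite /tvec mul0mx scaler0 !mul0r addr0 scale0r add0r subr0.
  by rewrite (raddf0 (@scalar_mx _ _)) col_mx0.
move=> r u v [A [a [b [lA ->]]]] [B [a' [b' [lB ->]]]].
exists (r%:C *: A + B), (r * a + a'), (r * b + b'); split; last by rewrite tvec_lin.
by case: (lie_subspace hG) => _; apply.
Qed.

Lemma immersionF p : D' p -> immersion_mod F D' (isotropy std_act G V) p.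
Proof.
move=> Dp; split=> [h [Gh hV0]|c hc c0 dc].
  by rewrite /F !FmapE /= -mulmxA (hV0 : h *m V = V).
have hc' := smooth_path_sub hc.
have /(domain_off S)[Gg Ix Iy g0 x0] := Dp.
move: dc; rewrite (mderiv_path S hc') c0.
have lA := path_lie_mem S hc' 0.
(* [immersion_mod] records g^(-1) g' while [path_lie] is g' g^(-1). Conjugation by g passes between
   them, and turns the annihilator of g V into that of V. *)
have AE : hadj p.1.1 *m path_lie c 0 *m p.1.1 =
    hadj p.1.1 *m mderiv (fun t => (c t).1.1) 0.
  by rewrite /path_lie c0 -!mulmxA (group_hadjl hGSU) // mulmx1.
have lA' := lie_Ad' hG hGSU Gg lA.
rewrite (SU_inv (hGSU Gg)); move: AE lA' {c0 Dp}.
move: (derive1 _ 0) => b; move: (derive1 _ 0) => a; move: (mderiv _ 0) => B.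
case: p Gg Ix Iy g0 x0 => [[g x] y] /= Gg Ix Iy g0 x0 AE lA'.
move=> /(tvec_eq0 S Gg lA Ix Iy g0 x0)[Aq -> ->]; split=> //.
apply/(lie_isotropy hG hGSU (cons_compact S)); rewrite -AE; split=> //.
by move: (path_lie c 0) Aq => P Aq; rewrite -!mulmxA Aq mulmx0.
Qed.

Lemma ext_act_F g p : ext_act g (F p) = F (g *m p.1.1, p.1.2, p.2).
Proof. by rewrite /F !FmapE /ext_act col_mxKu col_mxKd /= -scalemxAr mulmxA. Qed.

Lemma invariantF : invariant_set ext_act G (F @` D).
Proof.
move=> g _ Gg [p [Gp Ix Iy] <-]; exists (g *m p.1.1, p.1.2, p.2); last by rewrite ext_act_F.
by split=> //; exact: group_mul.
Qed.

(** Off the axis gamma xi is nonzero, so an element of G fixes F(g, x, y) exactly when it fixes g V: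
    the stabiliser is the conjugate by g of the stabiliser of V, for every x and y. *)
Lemma cohomogeneityF m : real_dim (orbit_tangent G V) (m - 2) ->
  cohomogeneity ext_act G m 2 ((F @` D) `&` off_axis).
Proof.
move=> dV; split.
  move=> g q Gg [Lq oq]; split; first exact: invariantF.
  rewrite /off_axis /= /ext_act col_mxKu; apply: contra_neq oq => /(congr1 (mulmx (hadj g))).
  by rewrite mulmx0 mulmxA (group_hadjl hGSU) // mul1mx.
exists (isotropy std_act G V); split.
- by move=> g [].
- split; first by split; [exact: group_one|exact: mul1mx].
    move=> g h [Gg gV] [Gh hV']; split; first exact: group_mul.
    by rewrite /std_act -mulmxA (hV' : h *m V = V).
  move=> g [Gg gV]; rewrite (SU_inv (hGSU Gg)); split; first exact: group_inv.
  by rewrite /std_act -{1}(gV : g *m V = V) mulmxA (group_hadjl hGSU) // mul1mx.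
- move=> q [[p Dp <-] oq].
  have /(domain_off S)[Gg Ix Iy g0 x0] : D' p by split.
  have w0 : gam p.1.2 * xi p.2 != 0 by exact: mulf_neq0.
  have actE h : G h -> (ext_act h (F p) = F p <-> h *m p.1.1 *m V = p.1.1 *m V).
    move=> Gh; rewrite ext_act_F /F !FmapE; split=> [/eq_col_mx[+ _] /=|/= ->//].
    exact: (scalerI w0).
  exists p.1.1 => //; apply/seteqP; split=> [h [Gh /(actE _ Gh) hq]|_ [h [Gh hV'] <-]].
    exists (hadj p.1.1 *m h *m p.1.1); last first.
      rewrite (SU_inv (hGSU Gg)) -!mulmxA (group_hadjr hGSU) // mulmx1 mulmxA.
      by rewrite (group_hadjr hGSU) // mul1mx.
    split.
      apply: group_mul => //; apply: group_mul => //; exact: group_inv.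
    rewrite /std_act -!mulmxA [h *m _]mulmxA hq mulmxA (group_hadjl hGSU) //.
    by rewrite mul1mx.
  rewrite (SU_inv (hGSU Gg)).
  have Gc : G (p.1.1 *m h *m hadj p.1.1).
    by apply: group_mul; [|exact: group_mul|exact: group_inv].
  split=> //; apply/actE => //.
  rewrite -!mulmxA [hadj _ *m _]mulmxA (group_hadjl hGSU) // mul1mx.
  by rewrite (hV' : h *m V = V).
- exact: isotropy_dim_quotient hG hGSU (cons_compact S) _ _ dV.
Qed.

End TangentSpace.

(** * The volume of a tangent frame and the Lagrangian angle *)

Section LagrangianAngle.
Context {R : realType} {n : nat}.
Local Notation C := R[i].
Local Notation d := n.+1.
Local Notation point := ('M[C]_d * R * R)%type.
Variables (G : set 'M[C]_d) (V : 'cV[C]_d) (I1 I2 : set R) (gam xi : R -> C).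
Variables (s1 s2 : R).
Hypothesis S : construction G V I1 I2 gam xi s1 s2.
Hypothesis nV : normalized G V.
Let hG := cons_group S. Let hGSU := cons_SU S.
Let F := Fmap V gam xi s1 s2.
Let D := domain G I1 I2.
Let D' := D `&` F @^-1` off_axis.
Implicit Types (p : point).

(* The columns of U are a frame of the orbit of V, then V and e; those of the
   other matrix are, up to the action of g, a frame of tangent vectors of F. *)
Lemma det_frame_coords (U : 'M[C]_(d + 1)) (w a b c e : C) : a != 0 ->
  \det (\matrix_(i, j < d + 1)
    if (j < n)%N then w * U i j
    else if j == n :> nat then a * U i (lshift 1 ord_max) + b * U i (rshift d 0)
    else c * U i (lshift 1 ord_max) + e * U i (rshift d 0)) =
  \det U * (w ^+ n * (a * e - b * c)).
Proof.
move=> a0.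
pose A : 'M[C]_d := diag_mx (\row_j if (j < n)%N then w else a).
pose r : 'rV[C]_d := delta_mx 0 ord_max.
pose l : 'cV[C]_d := delta_mx ord_max 0.
pose N := block_mx A (c *: l) (b *: r) e%:M.
set M := (X in \det X = _).
have -> : M = U *m N.
  rewrite -[U in RHS]hsubmxK mul_row_block; apply/matrixP => i j.
  rewrite [LHS]mxE; case: (split_ordP j) => j' -> /=.
    rewrite row_mxEl [RHS]mxE mul_mx_diag !mxE big_ord1 !mxE eqxx /=.
    have [jn|nj] := ltnP j' n.
      have -> : (j' == ord_max) = false by apply/negbTE; rewrite -val_eqE /= neq_ltn jn.
      by rewrite !mulr0 addr0 mulrC.
    have -> : j' = ord_max by apply/val_inj/eqP; rewrite /= eqn_leq nj -ltnS ltn_ord.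
    by rewrite !eqxx mulr1 mulrC [b * _]mulrC.
  rewrite ord1 row_mxEr -scalemxAr -colE [RHS]mxE !mxE big_ord1 !mxE mulr1n addn0.
  by rewrite ltnNge leqnSn /= gtn_eqF // [e * _]mulrC.
rewrite det_mulmx; congr (_ * _).
(* Block elimination with pivot a; the Schur complement in the last corner is e - b c / a. *)
have -> : N = block_mx 1%:M 0 ((b / a) *: r) 1%:M *m
    block_mx A (c *: l) 0 (e - b * c / a)%:M.
  rewrite mulmx_block !mul1mx !mul0mx !addr0; congr block_mx.
    rewrite -scalemxAl; apply/rowP => j; rewrite mul_mx_diag !mxE.
    rewrite !eqxx /=; case: (eqVneq j ord_max) => [->|_] /=; last by rewrite mul0r !mulr0.
    by rewrite ltnn; field.
  rewrite -scalemxAl -scalemxAr mul_delta_mx; apply/matrixP => i j.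
  by rewrite !ord1 !mxE /=; field.
rewrite det_mulmx det_lblock det_ublock !det1 !mul1r det_diag det_scalar1.
rewrite big_ord_recr /= !mxE ltnn.
rewrite (eq_bigr (fun=> w)) => [|i _]; last by rewrite mxE /= ltn_ord.
by rewrite prodr_const card_ord; field.
Qed.

Lemma tangent_tvec p A a b : D' p -> lie G A ->
  tangent F D' p (tvec V gam xi p A a b).
Proof. by move=> Dp lA; rewrite (tangentE S Dp); exists A, a, b. Qed.

(** The explicit tangent frame [v] has determinant equal to a real multiple of [holvol s], and equal
    to the product on the left up to det U = +-1 and [weight]. The number r gathers these real
    factors. *)
Lemma tangent_volume p s : D' p -> orthonormal_basis (tangent F D' p) s ->
  [/\ size s = (d + 1)%N,
      hadj (frame s (d + 1)) *m frame s (d + 1) = 1%:M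
    & exists2 r : R, r != 0 & (gam p.1.2 * xi p.2) ^+ n *
        (cderiv gam p.1.2 * cderiv xi p.2) = r%:C * holvol s].
Proof.
move=> Dp os.
have [Gg Ix Iy g0 x0] := (domain_off S p).1 Dp.
have g10 := (cons_curve1 S).2 _ Ix; have x10 := (cons_curve2 S).2 _ Iy.
have w0 := weight_gt0 xi p.2 g0.
have [t ot] := ex_orthonormal_basis (orbit_tangent_subspace hG V).
have st : size t = n := real_dim_size nV.1 ot.1.
pose l := [seq col_mx v (0 : 'cV[C]_1) | v <- t] ++ [:: col_mx V (0 : 'cV[C]_1); elast].
have lt j : (j < n)%N -> l`_j = col_mx t`_j 0.
  by move=> jn; rewrite nth_cat size_map st jn (nth_map 0) ?st.
have lV : l`_n = col_mx V 0 by rewrite nth_cat size_map st ltnn subnn.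
have le : l`_(n.+1) = elast by rewrite nth_cat size_map st ltnNge leqnSn subSn // subnn.
pose U : 'M[C]_(d + 1) := \matrix_(i, j) l`_j i 0.
have U1 : \det U = 1 \/ \det U = -1 by exact: (nV.2 t ot).
have /choice[A hA] j : exists A, (j < n)%N -> lie G A /\ A *m V = t`_j.
  case: (ltnP j n) => [jn|_]; last by exists 0.
  have [A lA AV] : orbit_tangent G V t`_j by apply: (basis_mem ot.1); rewrite st.
  by exists A.
(* Conjugating A_j by g makes the j-th vector equal to gamma xi times g t_j, so that g factors out
   of the whole frame. *)
pose v (j : 'I_(d + 1)) := if (j < n)%N
  then tvec V gam xi p (p.1.1 *m A j *m hadj p.1.1) 0 0
  else if j == n :> nat then tvec V gam xi p 0 1 0 else tvec V gam xi p 0 0 1.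
have vT j : tangent F D' p (v j).
  have l0 : lie G 0 by case: (lie_subspace hG).
  rewrite /v; case: ifP => jn; last by case: ifP => _; exact: tangent_tvec.
  by apply: tangent_tvec => //; apply: lie_Ad => //; case: (hA _ jn).
have vE : \det (\matrix_(i, j) v j i 0) = \det U *
    ((gam p.1.2 * xi p.2) ^+ n * (cderiv gam p.1.2 * cderiv xi p.2)) *
    (weight gam xi p.1.2 p.2)%:C.
  set M := \matrix_(i, j) _.
  have -> : M = block_mx p.1.1 0 0 1%:M *m \matrix_(i, j < d + 1)
    if (j < n)%N then (gam p.1.2 * xi p.2) * U i j
    else if j == n :> nat
      then (cderiv gam p.1.2 * xi p.2) * U i (lshift 1 ord_max) +
        (- ((gam p.1.2)^* * cderiv gam p.1.2)) * U i (rshift d 0)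
      else (gam p.1.2 * cderiv xi p.2) * U i (lshift 1 ord_max) +
        ((xi p.2)^* * cderiv xi p.2) * U i (rshift d 0).
    apply/matrixP => i j.
    rewrite [LHS]mxE mxE; under eq_bigr do rewrite mxE.
    pose y : 'cV[C]_(d + 1) := if (j < n)%N then (gam p.1.2 * xi p.2) *: l`_j
      else if j == n :> nat
      then (cderiv gam p.1.2 * xi p.2) *: l`_n -
        ((gam p.1.2)^* * cderiv gam p.1.2) *: l`_(n.+1)
      else (gam p.1.2 * cderiv xi p.2) *: l`_n +
        ((xi p.2)^* * cderiv xi p.2) *: l`_(n.+1).
    transitivity ((block_mx p.1.1 0 0 1%:M *m y) i 0); last first.
      rewrite mxE; apply: eq_bigr => k _; congr (_ * _).
      by rewrite /y; case: ifP => _; [|case: ifP => _]; rewrite !mxE /= ?addn0 ?mulNr.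
    congr (_ i 0); rewrite /v /y le lV /elast; case: ifP => jn.
      rewrite lt // scale_col_mx mul_block_col !mul0mx scaler0 mulmx0 !addr0.
      case: (hA _ jn) => _ <-; case: (p) Gg => [[g x] z] /= Gg; rewrite /tvec.
      rewrite !mul0r addr0 scale0r addr0 subrr (raddf0 (@scalar_mx _ _)).
      by rewrite -scalemxAr -!mulmxA [hadj _ *m _]mulmxA (group_hadjl hGSU) // mul1mx.
    case: ifP => _; case: (p) => [[g x] z] /=; rewrite /tvec.
      rewrite !scale_col_mx opp_col_mx add_col_mx mul_block_col !mul0mx mul1mx.
      rewrite !scaler0 (rmorph1 (real_complex R)) (rmorph0 (real_complex R)).
      rewrite !mul0r !mul1r !addr0 !add0r scalemxAr.
      by congr col_mx; [rewrite subr0|rewrite scale_scalar_mx mulr1 raddfN].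
    rewrite !scale_col_mx add_col_mx mul_block_col !mul0mx mul1mx.
    rewrite !scaler0 (rmorph1 (real_complex R)) (rmorph0 (real_complex R)).
    rewrite !mul0r !mul1r subr0 !addr0 !add0r scalemxAr.
    by congr col_mx; rewrite scale_scalar_mx mulr1.
  (* The 2 by 2 minor in the directions V and e is gamma' xi' (|xi|^2 + |gamma|^2), which is where
     [weight] comes from. *)
  rewrite det_mulmx det_frame_coords ?mulf_neq0 // det_ublock det1 mulr1.
  have -> : \det p.1.1 = 1 by case: (hGSU Gg).
  rewrite mul1r -!mulrA; congr (_ * (_ * _)).
  rewrite /weight real_complexD -!mulcJ; ring.
have v0 : \det (\matrix_(i, j) v j i 0) != 0.
  rewrite vE !mulf_neq0 ?expf_neq0 ?mulf_neq0 //.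
    by case: U1 => ->; rewrite ?oppr_eq0 oner_neq0.
  by apply/eqP => /complexI /eqP; rewrite gt_eqF.
have [ss us [r rE]] := lagrangian_frame (tangent_isotropic S Dp) os vT v0.
split=> //.
have r0 : r != 0 by apply: contra_neq v0 => r0; rewrite rE r0 mul0r.
have [e e0 Ue] : exists2 e : R, e != 0 & \det U = e%:C.
  case: U1 => ->; [by exists 1; rewrite ?oner_neq0|exists (-1)].
    by rewrite oppr_eq0 oner_neq0.
  by rewrite real_complexN.
exists (r / (e * weight gam xi p.1.2 p.2)).
  by rewrite mulf_neq0 // invr_neq0 // mulf_neq0 // gt_eqF.
have h : e%:C * (weight gam xi p.1.2 p.2)%:C != 0 :> C.
  by rewrite -real_complexM; apply/eqP => /complexI /eqP; apply/negP; rewrite mulf_neq0 // gt_eqF.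
apply: (mulfI h); rewrite -/(frame s (d + 1)) in rE *.
rewrite !real_complexM real_complexV real_complexM [_ * (_ * holvol s)]mulrA [_ * _ * (r%:C / _)]mulrC divfK //.
rewrite -[RHS]rE vE Ue. ring.
Qed.

End LagrangianAngle.
Section SolitonAngle.
Context {R : realType}.
Local Notation C := R[i].

Lemma cis_sqr_opp (z : C) x : z ^+ 2 = cis (x + x) -> z = cis x \/ z = - cis x.
Proof.
rewrite cisD -expr2 => /eqP; rewrite eqf_sqr => /orP[] /eqP; by [left|right].
Qed.

Lemma sqnorm_phase (z : C) : z != 0 -> sqnorm (z / z^*) = 1.
Proof.
move=> z0; apply: (mulIf (x := sqnorm z^*)); first by rewrite sqnorm_eq0 conjC_neq0.
by rewrite -sqnormM divfK ?conjC_neq0 // mul1r /sqnorm ReJ ImJ sqrrN.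
Qed.

Lemma sqnormX (z : C) k : sqnorm z = 1 -> sqnorm (z ^+ k) = 1.
Proof.
move=> z1; elim: k => [|k IH]; first by rewrite /sqnorm Re1 Im1 expr0n addr0 expr1n.
by rewrite exprS sqnormM z1 IH mulr1.
Qed.

Lemma phaseM (z w : C) : (z * w) / (z * w)^* = (z / z^*) * (w / w^*).
Proof. by rewrite conjM invfM mulrACA. Qed.

Lemma phaseX (z : C) k : z ^+ k / (z ^+ k)^* = (z / z^*) ^+ k.
Proof.
elim: k => [|k IH]; last by rewrite !exprS phaseM IH.
by rewrite !expr0 conjC1 divr1.
Qed.

Lemma soliton_angle_cst (I : set R) (c : R -> C) (s0 : R) k a :
  open I -> is_interval I -> regular_curve I c -> I s0 -> soliton_curve k a I c ->
  exists t0 : R, forall t, I t -> c t != 0 ->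
    (c t / (c t)^*) ^+ k * (cderiv c t / (cderiv c t)^*) =
    cis ((t0 - a * beta c s0 t) + (t0 - a * beta c s0 t)).
Proof.
move=> oI iI rc Is0 sc.
have [x hx] : exists x, soliton_phase c s0 k a s0 = cis x.
  apply: cis_ex; rewrite /soliton_phase (sqnormM (_ * _)) (sqnormM (_ ^+ _)).
  rewrite sqnorm_cis sqnorm_phase ?rc.2 // !mulr1; apply: sqnormX; rewrite /unit_phase.
  by case: eqVneq => [_|c0]; rewrite sqnorm_phase ?rc.2.
(* The phase doubles the angle, so half of its constant argument is the constant of the angle. *)
exists (x / 2) => t It c0.
have := soliton_phase_cst oI iI rc Is0 sc It; rewrite hx /soliton_phase /unit_phase (negbTE c0) => h.
have -> : x / 2 - a * beta c s0 t + (x / 2 - a * beta c s0 t) = x + - (2 * a * beta c s0 t).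
  by field.
by rewrite cisD -h -mulrA -cisD subrr cis0 mulr1.
Qed.

End SolitonAngle.

Section SpecialLagrangianAngle.
Context {R : realType} {n : nat}.
Local Notation C := R[i].
Local Notation d := n.+1.
Local Notation point := ('M[C]_d * R * R)%type.
Variables (G : set 'M[C]_d) (V : 'cV[C]_d) (I1 I2 : set R) (gam xi : R -> C).
Variables (s1 s2 a b : R).
Hypothesis S : construction G V I1 I2 gam xi s1 s2.
Hypothesis nV : normalized G V.
Hypothesis sgam : soliton_curve n a I1 gam.
Hypothesis sxi : soliton_curve n b I2 xi.
Let F := Fmap V gam xi s1 s2.
Let D := domain G I1 I2.
Let D' := D `&` F @^-1` off_axis.
Implicit Types (p : point).

(** The angle is asked for up to the sign of [holvol s], so its square h^2 suffices. As |h| = 1, h^2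
    = h / conj h, which does not see the real factor r of [tangent_volume] and splits into the
    phases of gamma and of xi. *)
Lemma angleF : exists t0 : R, lagrangian_angle F D'
  (fun p => t0 - a * beta gam s1 p.1.2 - b * beta xi s2 p.2).
Proof.
have [t1 h1] := soliton_angle_cst (cons_open1 S) (cons_itv1 S) (cons_curve1 S) (cons_base1 S) sgam.
have [t2 h2] := soliton_angle_cst (cons_open2 S) (cons_itv2 S) (cons_curve2 S) (cons_base2 S) sxi.
exists (t1 + t2); split=> [p s Dp os|c hc t].
  apply: cis_sqr_opp.
  have [_ us [r r0 rE]] := tangent_volume S nV Dp os.
  have [Gg Ix Iy g0 x0] := (domain_off S p).1 Dp.
  have g10 := (cons_curve1 S).2 _ Ix; have x10 := (cons_curve2 S).2 _ Iy.
  set h := holvol s.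
  have hh : h * h^* = 1.
        have := congr1 determinant us; rewrite det_mulmx det1 => <-.
    rewrite mulrC; congr (_ * _).
    by rewrite /hadj det_tr -det_map_mx.
  have -> : h ^+ 2 = (r%:C * h) / (r%:C * h)^*.
    have h0 : h != 0 by apply/eqP => h0; move: hh; rewrite h0 mul0r => /eqP; rewrite eq_sym oner_eq0.
    have hJ : h^* = h^-1 by apply: (mulfI h0); rewrite hh divff.
    have rc : r%:C != 0 :> C by apply/eqP => /complexI /eqP; apply/negP.
    by rewrite conjM conjcR hJ invfM invrK mulrACA divff // mul1r expr2.
  rewrite -rE phaseM phaseX !phaseM exprMn mulrACA (h1 _ Ix g0) (h2 _ Iy x0) -cisD.
  by move: (a * _) (b * _) => u v; apply: (congr1 cis); lra.
have hc' := smooth_path_sub hc.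
have h := derivB
  (derivB (deriv_cst t (t1 + t2)) (derivM (deriv_cst t a) (deriv_beta_gam S hc' t)))
  (derivM (deriv_cst t b) (deriv_beta_xi S hc' t)).
exact: deriv_continuous h.
Qed.

End SpecialLagrangianAngle.

(** * Derivatives of tangent fields along paths *)

Section SpinCoefficients.
Context {F : fieldType}.

(* The entries of the linear map of the plane spanned by the orbit direction
   and e which maps the velocities of F in x and y to the derivatives of its
   x-velocity; g, gs, g1, g1s, g2 and x, xs stand for gamma, its conjugate,
   gamma', its conjugate, gamma'' and for xi, its conjugate. *)
Definition spin11 (g gs g1 g1s g2 x xs : F) :=
  (g2 / g1 * (x * xs) + g1 * gs) / (g * gs + x * xs).
Definition spin12 (g gs g1 g1s g2 x xs : F) :=
  x * (g1 - g * g2 / g1) / (g * gs + x * xs).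
Definition spin21 (g gs g1 g1s g2 x xs : F) :=
  - ((g1s * g1 + gs * g2) * xs / g1) / (g * gs + x * xs).
Definition spin22 (g gs g1 g1s g2 x xs : F) :=
  (g1s * g + g * gs * g2 / g1) / (g * gs + x * xs).

Variables (g gs g1 g1s g2 x xs : F).
Hypotheses (r0 : g * gs + x * xs != 0) (g10 : g1 != 0).

(** In the basis q, e the x-velocity is (g1 x, - gs g1) and the y-velocity is (g x1, xs x1). Their
    images must be the x- and y-derivatives of the x-velocity, (g2 x, - (g1s g1 + gs g2)) and (g1
    x1, 0). The coefficients solve these equations by Cramer's rule, the determinant being g1 x1 (g
    gs + x xs). *)
Lemma spin_along1 :
  spin11 g gs g1 g1s g2 x xs * (g1 * x) - spin12 g gs g1 g1s g2 x xs * (gs * g1) =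
  g2 * x.
Proof. by rewrite /spin11 /spin12; field; rewrite g10 r0. Qed.

Lemma spin_along2 :
  spin21 g gs g1 g1s g2 x xs * (g1 * x) - spin22 g gs g1 g1s g2 x xs * (gs * g1) =
  - (g1s * g1 + gs * g2).
Proof. by rewrite /spin21 /spin22; field; rewrite g10 r0. Qed.

Lemma spin_across1 x1 :
  spin11 g gs g1 g1s g2 x xs * (g * x1) + spin12 g gs g1 g1s g2 x xs * (xs * x1) =
  g1 * x1.
Proof. by rewrite /spin11 /spin12; field; rewrite g10 r0. Qed.

Lemma spin_across2 x1 :
  spin21 g gs g1 g1s g2 x xs * (g * x1) + spin22 g gs g1 g1s g2 x xs * (xs * x1) = 0.
Proof. by rewrite /spin21 /spin22; field; rewrite g10 r0. Qed.

(** Once gs and g1s are the conjugates, the last term is real and only g2 / g1 contributes to the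
    imaginary part. *)
Lemma spin_tr :
  spin11 g gs g1 g1s g2 x xs + spin22 g gs g1 g1s g2 x xs =
  g2 / g1 + (g1 * gs + g1s * g) / (g * gs + x * xs).
Proof. by rewrite /spin11 /spin22; field; rewrite g10 r0. Qed.

End SpinCoefficients.

Section SpinAlgebra.
Context {F : fieldType} (M : lmodType F).
Variables (g gs g1 g1s g2 x xs x1 x1s x2 : F).
Variables (N11 N12 N21 N22 P11 P12 P21 P22 : F).
Hypotheses (g0 : g != 0) (x0 : x != 0).
Variables (a b X Y : F).

(** Here u, v, w stand for A q, A B q and B q, with (B, X, Y) the velocity of the path. Exchanging
    gamma and xi reverses the sign of the last coordinate of F; hence the minus signs before P12
    here and before P21 in [spin_lower]. *)
Lemma spin_upper (u v w q : M) :
    N11 * (g1 * x) - N12 * (gs * g1) = g2 * x ->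
    N11 * (g * x1) + N12 * (xs * x1) = g1 * x1 ->
    P11 * (x1 * g) - P12 * (xs * x1) = x2 * g ->
    P11 * (x * g1) + P12 * (gs * g1) = x1 * g1 ->
  (X * g1 * x + g * (Y * x1)) *: u + (g * x) *: v +
  ((0 * (g1 * x) + a * (X * g2 * x + g1 * (Y * x1)) +
    (0 * (g * x1) + b * (X * g1 * x1 + g * (Y * x2)))) *: q +
   (a * (g1 * x) + b * (g * x1)) *: w) =
  (g * x) *: v + (X * (g1 * x) + Y * (g * x1)) *: u +
  (a * (g1 / g) + b * (x1 / x)) *:
    ((g * x) *: w + (X * (g1 * x) + Y * (g * x1)) *: q) +
  (a * N11 + b * P11 - (a * (g1 / g) + b * (x1 / x))) *:
    ((g * x * 0 + (X * (g1 * x) + Y * (g * x1)) * 1) *: q) +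
  (a * N12 - b * P12) *: ((Y * (xs * x1) - X * (gs * g1)) *: q).
Proof.
move=> a1 a3 b1 b3; set l := a * (g1 / g) + _.
have lw : l * (g * x) = a * (g1 * x) + b * (g * x1).
  by rewrite /l; field; rewrite g0 x0.
rewrite scalerDr !scalerA lw [_ *: v + _ *: u]addrC -!addrA.
congr (_ *: _ + (_ + _)); first by ring.
rewrite [_ *: q + _ *: w]addrC; congr (_ + _); rewrite -!scalerDl; congr (_ *: _).
transitivity (a * (X * (g2 * x) + Y * (g1 * x1)) + b * (X * (x1 * g1) + Y * (x2 * g))).
  by ring.
by rewrite -a1 -a3 -b1 -b3; ring.
Qed.

Lemma spin_lower :
    N21 * (g1 * x) - N22 * (gs * g1) = - (g1s * g1 + gs * g2) ->
    N21 * (g * x1) + N22 * (xs * x1) = 0 ->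
    P21 * (x1 * g) - P22 * (xs * x1) = - (x1s * x1 + xs * x2) ->
    P21 * (x * g1) + P22 * (gs * g1) = 0 ->
  b * (Y * x1s * x1 + xs * (Y * x2)) - a * (X * g1s * g1 + gs * (X * g2)) =
  (a * N21 - b * P21) * (X * (g1 * x) + Y * (g * x1)) +
  (a * N22 + b * P22) * (Y * (xs * x1) - X * (gs * g1)).
Proof.
move=> a2 a4 b2 b4.
transitivity (a * (X * - (g1s * g1 + gs * g2) + Y * 0) -
              b * (X * 0 + Y * - (x1s * x1 + xs * x2))); first by ring.
by rewrite -a2 -{1}a4 -b2 -b4; ring.
Qed.

End SpinAlgebra.

Section TangentFields.
Context {R : realType} {n : nat}.
Local Notation C := R[i].
Local Notation d := n.+1.
Local Notation point := ('M[C]_d * R * R)%type.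
Variables (G : set 'M[C]_d) (V : 'cV[C]_d) (I1 I2 : set R) (gam xi : R -> C).
Variables (s1 s2 : R).
Hypothesis S : construction G V I1 I2 gam xi s1 s2.
Let hG := cons_group S. Let hGSU := cons_SU S.
Let F := Fmap V gam xi s1 s2.
Let D := domain G I1 I2.
Let D' := D `&` F @^-1` off_axis.
Implicit Types (p : point) (A B : 'M[C]_d).

Definition jet (f : C -> C -> C -> C -> C -> C -> C -> C) (gam xi : R -> C) x y :=
  f (gam x) (gam x)^* (cderiv gam x) (cderiv gam x)^* (cderiv (cderiv gam) x)
    (xi y) (xi y)^*.

(** The map M for the field with coefficients A, a, b. On orbit directions it is A + l, where l is
    the logarithmic derivative of gamma xi in the direction (a, b). On q and e the 2 by 2 block
    replaces l, whence the subtraction of l along q; there A still adds A q. *)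
Definition spin p A (a b : R) : 'M[C]_(d + 1) :=
  let: (g, x, y) := p in
  let q := g *m V in
  let l := a%:C * (cderiv gam x / gam x) + b%:C * (cderiv xi y / xi y) in
  block_mx
    (A + l%:M +
     (a%:C * jet spin11 gam xi x y + b%:C * jet spin11 xi gam y x - l) *: (q *m hadj q))
    ((a%:C * jet spin12 gam xi x y - b%:C * jet spin12 xi gam y x) *: q)
    ((a%:C * jet spin21 gam xi x y - b%:C * jet spin21 xi gam y x) *: hadj q)
    (a%:C * jet spin22 gam xi x y + b%:C * jet spin22 xi gam y x)%:M.

Lemma weight_neq0 x y : gam x != 0 ->
  (gam x * (gam x)^* + xi y * (xi y)^* != 0) * (xi y * (xi y)^* + gam x * (gam x)^* != 0).
Proof.
move=> g0; have h : gam x * (gam x)^* + xi y * (xi y)^* != 0.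
  rewrite !mulcJ -real_complexD; apply/eqP => /complexI /eqP.
  by rewrite (gt_eqF (weight_gt0 xi y g0)).
by split; rewrite // addrC.
Qed.

Lemma tr_rank1 m (u : 'cV[C]_m) : \tr (u *m hadj u) = hip u u.
Proof. by rewrite mxtrace_mulC /mxtrace big_ord1. Qed.

(** A is traceless, l survives d - 1 = n times because it is removed along q, and the terms of
    [spin_tr] divided by rho are real. *)
Lemma spin_trace p A a b : D' p -> lie G A ->
  Im (\tr (spin p A a b)) =
  a * (n%:R * Im (cderiv gam p.1.2 / gam p.1.2) +
       Im (cderiv (cderiv gam) p.1.2 / cderiv gam p.1.2)) +
  b * (n%:R * Im (cderiv xi p.2 / xi p.2) +
       Im (cderiv (cderiv xi) p.2 / cderiv xi p.2)).
Proof.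
move=> Dp lA; have [] := (domain_off S p).1 Dp; case: p {Dp} => [[g x] y].
cbn [fst snd] => Gg Ix Iy g0 x0; rewrite /spin.
have g10 := (cons_curve1 S).2 _ Ix; have x10 := (cons_curve2 S).2 _ Iy.
rewrite mxtrace_block !mxtraceD (lie_trace hG hGSU (cons_compact S) lA) add0r.
rewrite mxtraceZ tr_rank1 (orbit_unit S) // mulr1 !mxtrace_scalar.
have [r0 r0'] := weight_neq0 y g0.
have h1 := spin_tr (cderiv gam x)^* (cderiv (cderiv gam) x) r0 g10.
have h2 := spin_tr (cderiv xi y)^* (cderiv (cderiv xi) y) r0' x10.
rewrite -/(jet spin11 gam xi x y) -/(jet spin22 gam xi x y) in h1.
rewrite -/(jet spin11 xi gam y x) -/(jet spin22 xi gam y x) in h2.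
move: (jet spin11 gam xi x y) (jet spin22 gam xi x y) h1 => N11 N22 h1.
move: (jet spin11 xi gam y x) (jet spin22 xi gam y x) h2 => P11 P22 h2.
have re0 (z w : C) (r : R) : Im ((z * w^* + z^* * w) / r%:C) = 0.
  rewrite -real_complexV ImM Re_real Im_real !ReIm; ring.
set l := a%:C * (cderiv gam x / gam x) + _.
have -> : l *+ d + (a%:C * N11 + b%:C * P11 - l) + (a%:C * N22 + b%:C * P22) *+ 1 =
  n%:R * l + a%:C * (N11 + N22) + b%:C * (P11 + P22).
  by rewrite mulrSr -mulr_natl; ring.
rewrite h1 h2 /l !mulcJ -!real_complexD.
have ImR (r : R) (z : C) : Im (r%:C * z) = r * Im z.
  by rewrite ImM Re_real Im_real mul0r addr0.
rewrite -(rmorph_nat (real_complex R)) ImD ImD ImR ImD !ImR !ImD !re0 !addr0.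
ring.
Qed.

Lemma mul_rank1 m (u v : 'cV[C]_m) : (u *m hadj u) *m v = hip u v *: u.
Proof. by rewrite -mulmxA [hadj u *m v]mx11_scalar mul_mx_scalar. Qed.

Lemma deriv_tvec c A a b t : smooth_path D' c ->
  has_mderiv (fun s => tvec V gam xi (c s) A a b) t
    (spin (c t) A a b *m tvec V gam xi (c t) (path_lie c t)
       (derive1 (fun s => (c s).1.2) t) (derive1 (fun s => (c s).2) t)).
Proof.
move=> hc'; have hc := smooth_path_sub hc'.
have Dc : D' (c t) by case: hc'.
have [Gg Ix Iy g0 x0] := (domain_off S (c t)).1 Dc.
have lB := path_lie_mem S hc t.
have dq : has_mderiv (fun s => (c s).1.1 *m V) t (path_lie c t *m ((c t).1.1 *m V)).
  by rewrite (path_lieE S hc); apply: mderivMr; exact: msmoothW (path_g hc).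
have dg := cderiv_gam S hc t; have dx := cderiv_xi S hc t.
have dg1 := cderiv_gam1 S hc t; have dx1 := cderiv_xi1 S hc t.
have -> : (fun s => tvec V gam xi (c s) A a b) = fun s => col_mx
    ((gam (c s).1.2 * xi (c s).2) *: (A *m ((c s).1.1 *m V)) +
     (a%:C * (cderiv gam (c s).1.2 * xi (c s).2) +
      b%:C * (gam (c s).1.2 * cderiv xi (c s).2)) *: ((c s).1.1 *m V))
    (b%:C * ((xi (c s).2)^* * cderiv xi (c s).2) -
     a%:C * ((gam (c s).1.2)^* * cderiv gam (c s).1.2))%:M.
  by apply/funext => s; case: (c s) => [[g x] y].
have h := mderiv_col
  (mderivD (mderivZ (cderivM dg dx) (mderivMl A dq))
     (mderivZ (cderivD (cderivM (cderiv_cst a%:C t) (cderivM dg1 dx))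
                       (cderivM (cderiv_cst b%:C t) (cderivM dg dx1))) dq))
  (mderiv_scalar (n := 1)
     (cderivB (cderivM (cderiv_cst b%:C t) (cderivM (cderivJ dx) dx1))
              (cderivM (cderiv_cst a%:C t) (cderivM (cderivJ dg) dg1)))).
apply: mderiv_eq h _.
move: (derive1 _ t) (derive1 _ t) (path_lie c t) lB => Y X B lB.
case: (c t) Gg Ix Iy g0 x0 => [[g x] y]; cbn [fst snd] => Gg Ix Iy g0 x0.
have g10 := (cons_curve1 S).2 _ Ix; have x10 := (cons_curve2 S).2 _ Iy.
have qB : hip (g *m V) (B *m (g *m V)) = 0 by apply: (momentlessM hG hGSU Gg (cons_momentless S)).
have qq := orbit_unit S Gg.
rewrite /tvec /spin mul_block_col.
move: (g *m V) qB qq => q qB qq.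
have [r0 r0'] := weight_neq0 y g0.
pose g1s := (cderiv gam x)^*; pose x1s := (cderiv xi y)^*.
have a1 := spin_along1 g1s (cderiv (cderiv gam) x) r0 g10.
have a2 := spin_along2 g1s (cderiv (cderiv gam) x) r0 g10.
have a3 := spin_across1 g1s (cderiv (cderiv gam) x) r0 g10 (cderiv xi y).
have a4 := spin_across2 g1s (cderiv (cderiv gam) x) r0 g10 (cderiv xi y).
have b1 := spin_along1 x1s (cderiv (cderiv xi) y) r0' x10.
have b2 := spin_along2 x1s (cderiv (cderiv xi) y) r0' x10.
have b3 := spin_across1 x1s (cderiv (cderiv xi) y) r0' x10 (cderiv gam x).
have b4 := spin_across2 x1s (cderiv (cderiv xi) y) r0' x10 (cderiv gam x).
rewrite !conjM !conjcR -/g1s -/x1s.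
rewrite -/(jet spin11 gam xi x y) -/(jet spin12 gam xi x y) -/(jet spin21 gam xi x y)
  -/(jet spin22 gam xi x y) in a1 a2 a3 a4.
rewrite -/(jet spin11 xi gam y x) -/(jet spin12 xi gam y x) -/(jet spin21 xi gam y x)
  -/(jet spin22 xi gam y x) in b1 b2 b3 b4.
(* From here on the coefficients enter only through the eight equations, and conjugates and
   derivatives may be treated as independent variables. *)
move: (jet spin11 gam xi x y) (jet spin12 gam xi x y) (jet spin21 gam xi x y)
  (jet spin22 gam xi x y) a1 a2 a3 a4 => N11 N12 N21 N22 a1 a2 a3 a4.
move: (jet spin11 xi gam y x) (jet spin12 xi gam y x) (jet spin21 xi gam y x)
  (jet spin22 xi gam y x) b1 b2 b3 b4 => P11 P12 P21 P22 b1 b2 b3 b4.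
move: g1s x1s a2 b2 {r0 r0'} => g1s x1s a2 b2.
move: (cderiv (cderiv gam) x) (cderiv (cderiv xi) y) a1 a2 b1 b2 => g2 x2 a1 a2 b1 b2.
move: (cderiv gam x) (cderiv xi y) g10 x10 a1 a2 a3 a4 b1 b2 b3 b4 => g1 x1 g10 x10 a1 a2 a3 a4 b1 b2 b3 b4.
move: (gam x)^* (xi y)^* a1 a2 a3 a4 b1 b2 b3 b4 => gs xs a1 a2 a3 a4 b1 b2 b3 b4.
move: (gam x) (xi y) g0 x0 a1 a2 a3 a4 b1 b2 b3 b4 => g0 x0 g00 x00 a1 a2 a3 a4 b1 b2 b3 b4.
move: a%:C b%:C X%:C Y%:C => {}a {}b {}X {}Y.
congr col_mx.
  rewrite !mulmxDl mul_scalar_mx -!scalemxAl mul_rank1 mul_mx_scalar hipDr !hipZr qB qq.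
  rewrite mulmxDr -!scalemxAr.
  exact: spin_upper.
rewrite -scalemxAl mulmxDr -!scalemxAr [hadj q *m _]mx11_scalar [hadj q *m q]mx11_scalar.
rewrite -/(hip _ _) -/(hip _ _) qB qq.
rewrite (raddf0 (@scalar_mx _ _)) scaler0 add0r !scale_scalar_mx mulr1 -scalar_mxM -raddfD.
by congr (_%:M); rewrite !mul0r !add0r; exact: spin_lower.
Qed.

End TangentFields.

(** * Mean curvature *)

Section MeanCurvature.
Context {R : realType} {n : nat}.
Local Notation C := R[i].
Local Notation d := n.+1.
Local Notation point := ('M[C]_d * R * R)%type.
Variables (G : set 'M[C]_d) (V : 'cV[C]_d) (I1 I2 : set R) (gam xi : R -> C).
Variables (s1 s2 k1 k2 : R).
Hypothesis S : construction G V I1 I2 gam xi s1 s2.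
Hypothesis nV : normalized G V.
Hypothesis sgam : soliton_curve n k1 I1 gam.
Hypothesis sxi : soliton_curve n k2 I2 xi.
Let F := Fmap V gam xi s1 s2.
Let D := domain G I1 I2.
Let D' := D `&` F @^-1` off_axis.
Implicit Types (p : point) (c : R -> point).

(** Only existence is recorded: the value contains g'', and [hip_acceleration] obtains the pairing
    needed from the first-order field instead. *)
Lemma path_acceleration c t : smooth_path D c ->
  exists l, has_mderiv (mderiv (F \o c)) t l.
Proof.
move=> hc; rewrite /F (mderiv_path S hc).
have dq := mderivMr V (msmoothW t (path_g hc)).
have dq1 := mderivMr V (msmoothW t (msmooth_mderiv (path_g hc))).
have dg := cderiv_gam S hc t; have dx := cderiv_xi S hc t.
have dg1 := cderiv_gam1 S hc t; have dx1 := cderiv_xi1 S hc t.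
have dX := cderiv_real (smoothW t (smooth_derive1 (path_x hc))).
have dY := cderiv_real (smoothW t (smooth_derive1 (path_y hc))).
have h := mderiv_col
  (mderivD (mderivZ (cderivM dg dx) dq1)
     (mderivZ (cderivD (cderivM dX (cderivM dg1 dx)) (cderivM dY (cderivM dg dx1))) dq))
  (mderiv_scalar (n := 1)
     (cderivB (cderivM dY (cderivM (cderivJ dx) dx1)) (cderivM dX (cderivM (cderivJ dg) dg1)))).
eexists; move: h; congr has_mderiv; apply/funext => s.
rewrite /tvec -(path_lieE S hc s); case: (c s) => [[g x] y] //.
Qed.

Lemma hip_acceleration c A a b : smooth_path D' c -> lie G A ->
  Im (hip (tvec V gam xi (c 0) A a b) (mderiv (mderiv (F \o c)) 0)) =
  Im (hip (mderiv (F \o c) 0) (spin V gam xi (c 0) A a b *m mderiv (F \o c) 0)).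
Proof.
move=> hc' lA; have hc := smooth_path_sub hc'.
have [l hl] := path_acceleration 0 hc; rewrite (has_mderivP hl).
have [_] := cderiv_hip (deriv_tvec S A a b 0 hc') hl.
have -> : (fun s => Im (hip (tvec V gam xi (c s) A a b) (mderiv (F \o c) s))) = fun=> 0.
  apply/funext => s; rewrite /F (mderiv_path S hc).
  have [Gg _ _] := pathD hc s; have lB := path_lie_mem S hc s.
  move: (path_lie c s) lB Gg => B lB.
  by case: (c s) => [[g x] y] Gg; exact: (tvec_isotropic S).
move=> h; have := deriv_uniq h (deriv_cst _ _).
rewrite /F (mderiv_path S hc) => /eqP.
rewrite ImD addrC addr_eq0 => /eqP ->.
by rewrite -hipJ ImJ opprK.
Qed.

(** A unitary tangent frame is a complex basis, so a vector is determined by its Hermitian products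
    with the frame. The real parts express that h and H are normal; the imaginary parts of H sum to
    Im tr M, which [soliton_angle] converts into the second hypothesis on h. *)
Lemma mean_curvatureF p h : D' p ->
  (forall v, tangent F D' p v -> dot h v = 0) ->
  (forall A a b, lie G A -> Im (hip (tvec V gam xi p A a b) h) =
     - k1 * (a * Im ((gam p.1.2)^* * cderiv gam p.1.2))
     - k2 * (b * Im ((xi p.2)^* * cderiv xi p.2))) ->
  mean_curvature F D' p h.
Proof.
move=> Dp hT hI s c os hc.
have [ss us _] := tangent_volume S nV Dp os.
have sT := tangent_subspace S Dp; have iT := tangent_isotropic S Dp.
have [Gg Ix Iy g0 x0] := (domain_off S p).1 Dp.
set H := \sum_(j < _) _; apply/eqP; rewrite -subr_eq0; apply/eqP.
rewrite [LHS](frame_expand _ us) big1 // => i _.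
suff -> : hip s`_i (h - H) = 0 by rewrite scale0r.
have Ts : tangent F D' p s`_i by apply: (basis_mem os.1); rewrite ss.
apply: cplx_eq.
  rewrite -dotE dotC dotBl hT // dot_suml big1 ?subrr // => j _.
  by have [_ ->] := orthoprojP (mderiv (mderiv (F \o c j)) 0) sT.
move: Ts; rewrite (tangentE S Dp) => -[A [a [b [lA sE]]]].
have Ts : tangent F D' p s`_i by apply: (basis_mem os.1); rewrite ss.
rewrite hipBr ImD ImN sE hI // hip_sumr Im_sum.
rewrite (eq_bigr (fun j : 'I_(size s) => Im (hip s`_j (spin V gam xi p A a b *m s`_j)))).
  rewrite -Im_sum ss (trace_frame _ us) (spin_trace S _ _ Dp lA).
  rewrite [_ + Im (_ / cderiv gam _)]addrC (soliton_angle (cons_curve1 S) sgam Ix g0).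
  rewrite [_ + Im (_ / cderiv xi _)]addrC (soliton_angle (cons_curve2 S) sxi Iy x0).
  rewrite Im0; move: (Im _) (Im _) => u v.
  by ring.
move=> j _; have [hc1 c0 cs] := hc j (ltn_ord j).
have := hip_acceleration a b hc1 lA; rewrite c0 cs => <-.
(* The normal projection may be dropped: the tangential part of the acceleration pairs to zero under
   [kaehler]. *)
rewrite -sE /normal_part hipBr ImD ImN.
have [Tp _] := orthoprojP (mderiv (mderiv (F \o c j)) 0) sT.
by have := iT _ _ Ts Tp; rewrite kaehlerE => ->; rewrite subr0.
Qed.

Lemma hip_tvec_elast p A a b : hip (tvec V gam xi p A a b) elast =
  (b%:C * ((xi p.2)^* * cderiv xi p.2) -
   a%:C * ((gam p.1.2)^* * cderiv gam p.1.2))^*.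
Proof.
by case: p => [[g x] y]; rewrite /tvec /elast hip_col hip0r add0r hip_scalar mulr1.
Qed.

(** One computation covers both orientations of the translation: eps = 1 means k1 = -1, k2 = 1 and
    direction e, while eps = -1 exchanges the signs and reverses the direction. By isotropy the
    tangential part of e drops out of Im <v, .>. *)
Lemma lagrangian_translatorF (eps : R) : k1 = - eps -> k2 = eps ->
  lagrangian_translator F D' (eps%:C *: elast).
Proof.
move=> hk1 hk2 p Dp.
have sT := tangent_subspace S Dp; have iT := tangent_isotropic S Dp.
have [Tp pT] := orthoprojP (eps%:C *: elast) sT.
apply: mean_curvatureF => // A a b lA.
have Tv := tangent_tvec S a b Dp lA.
rewrite /normal_part hipBr ImD ImN.
have := iT _ _ Tv Tp; rewrite kaehlerE => ->.
rewrite subr0 hipZr hip_tvec_elast hk1 hk2 ImM Re_real Im_real mul0r addr0 ImJ ImD ImN.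
rewrite 2!(ImM _%:C) !Re_real !Im_real !mul0r !addr0.
by ring.
Qed.

Lemma special_lagrangianF : k1 = 0 -> k2 = 0 -> special_lagrangian F D'.
Proof.
move=> hk1 hk2 p Dp; apply: mean_curvatureF => // [v _|A a b lA].
  exact: dot0l.
by rewrite hip0r hk1 hk2 oppr0 !mul0r subr0.
Qed.

Lemma dot_F_Jelast p :
  dot (F p) (cplxJ elast) = beta xi s2 p.2 - beta gam s1 p.1.2.
Proof.
rewrite /F FmapE dotE /cplxJ hipZr /elast hip_col hip0r add0r hip_scalar mulr1.
by rewrite ReM Re_i Im_i ReJ ImJ -(Im_height gam xi s1 s2); ring.
Qed.

End MeanCurvature.

(** The orbit frame, V and e are pairwise Hermitian-orthogonal, and all but V are known to have norm
    one. The squared modulus of their determinant is thus <V, V>, and the determinant is +-1. *)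
Lemma normalized_unit {R : realType} {n : nat} (G : set 'M[R[i]]_n.+1) V :
  is_subgroup G -> G `<=` SU -> momentless G V -> normalized G V -> hip V V = 1.
Proof.
move=> hG hGSU hV nV; pose d := n.+1.
have [t ot] := ex_orthonormal_basis (orbit_tangent_subspace hG V).
have st : size t = n := real_dim_size nV.1 ot.1.
pose l := [seq col_mx v (0 : 'cV[R[i]]_1) | v <- t] ++ [:: col_mx V (0 : 'cV[R[i]]_1); elast].
have lt j : (j < n)%N -> l`_j = col_mx t`_j 0.
  by move=> jn; rewrite nth_cat size_map st jn (nth_map 0) ?st.
have lV : l`_n = col_mx V 0 by rewrite nth_cat size_map st ltnn subnn.
have le : l`_(n.+1) = elast by rewrite nth_cat size_map st ltnNge leqnSn subSn // subnn.
have iT : isotropic (orbit_tangent G V).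
  by move=> _ _ [A lA <-] [B lB <-]; rewrite kaehlerE (momentless_isotropic hG hGSU hV).
have tT i : (i < n)%N -> orbit_tangent G V t`_i.
  by move=> li; apply: (basis_mem ot.1); rewrite st.
have tt i j : (i < n)%N -> (j < n)%N -> hip t`_i t`_j = (i == j)%:R.
  move=> li lj; have := iT _ _ (tT _ li) (tT _ lj).
  have := ot.2 i j; rewrite st kaehlerE dotE => /(_ li lj) h1 h2.
  by apply: cplx_eq; rewrite ?h1 ?h2 -(rmorph_nat (real_complex R)).
have tV i : (i < n)%N -> hip V t`_i = 0.
  by move=> /tT[A lA <-]; exact: hV.
have tV' i : (i < n)%N -> hip t`_i V = 0.
  by move=> li; rewrite -hipJ tV // conjC0.
have U1 : hadj (frame l (d + 1)) *m frame l (d + 1) =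
    diag_mx (\row_j if j == n :> nat then hip V V else 1).
  apply/matrixP => i j; rewrite -[hadj _]mulmx1 frame_hip mul1mx !mxE.
  have bnd (k : 'I_(d + 1)) : (n < k)%N -> k = n.+1 :> nat.
    by move=> nk; apply/eqP; rewrite eqn_leq nk -ltnS -[n.+2]addn1 ltn_ord.
  have ij : (i == j) = (i == j :> nat) by [].
  rewrite ij {ij}.
  have [li|/bnd ei|ei] := ltngtP i n; have [lj|/bnd ej|ej] := ltngtP j n.
  - by rewrite !lt // hip_col hip0l addr0 tt.
  - by rewrite ej (lt _ li) le /elast hip_col hip0r hip0l addr0 (ltn_eqF (leqW li)).
  - by rewrite ej (lt _ li) lV hip_col hip0r addr0 tV' // (ltn_eqF li).
  - rewrite ei (lt _ lj) le /elast hip_col hip0l hip0r addr0 gtn_eqF //; exact: leqW.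
  - by rewrite ei ej le /elast hip_col hip0l add0r hip_scalar conjC1 mulr1 eqxx.
  - by rewrite ei ej le lV /elast hip_col hip0l hip0r addr0 gtn_eqF.
  - by rewrite ei lV (lt _ lj) hip_col hip0r addr0 tV // gtn_eqF.
  - by rewrite ei ej le lV /elast hip_col hip0l hip0r addr0 ltn_eqF.
  - by rewrite ei ej lV hip_col hip0r addr0 eqxx.
have : \det (frame l (d + 1)) = 1 \/ \det (frame l (d + 1)) = -1 by exact: (nV.2 t ot).
have := congr1 determinant U1; rewrite det_mulmx det_diag (bigD1 (lshift 1 ord_max)) //=.
rewrite mxE eqxx big1 => [|j jn]; last first.
  by rewrite mxE (negbTE (jn : nat_of_ord j != n)).
rewrite mulr1 /hadj det_tr (det_map_mx Num.conj) => <-.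
by case=> ->; rewrite ?rmorphN rmorph1 ?mulrNN mulr1.
Qed.
Theorem theorem5p6 (R : realType) (m : nat) (hm : (2 <= m)%N)
  (G : set 'M[R[i]]_(m.-1))
  (hG : is_subgroup G) (hGSU : G `<=` SU) (hGc : compact G)
  (hGconn : connected G)
  (Z : set 'cV[R[i]]_(m.-1))
  (hZ : exists2 z0, zero_level G z0 &
          Z = connected_component (zero_level G) z0)
  (hZlag : exists N : set 'cV[R[i]]_(m.-1),
     [/\ N !=set0, N `<=` Z, immersed_lagrangian N
       & cohomogeneity std_act G (m - 1) 1 N])
  (z' : 'cV[R[i]]_(m.-1)) (hz' : Z z') (hz'0 : z' != 0)
  (V : 'cV[R[i]]_(m.-1)) (hVP : exists a : R[i], V = a *: z')
  (hV : normalized G V)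
  (I1 I2 : set R)
  (hI1 : open I1) (hI1' : is_interval I1)
  (hI2 : open I2) (hI2' : is_interval I2)
  (gam xi : R -> R[i])
  (hgam : regular_curve I1 gam) (hxi : regular_curve I2 xi)
  (a b : R)
  (hgam_eq : soliton_curve (m - 2) a I1 gam)
  (hxi_eq : soliton_curve (m - 2) b I2 xi)
  (s1 s2 : R) (hs1 : I1 s1) (hs2 : I2 s2) :
  let D := domain G I1 I2 in
  let F := Fmap V gam xi s1 s2 in
  let L := F @` D in
  let D' := D `&` F @^-1` off_axis in
  [/\ (* exact, with the given primitive of F^* lambda *)
      exact_map F D /\
      liouville_primitive F D (fun p =>
        let: (_, x, y) := p in
        - 2^-1 * (cnorm (gam x) ^+ 2 - cnorm (xi y) ^+ 2)
               * (beta gam s1 x - beta xi s2 y)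
        + beta_tilde gam s1 x + beta_tilde xi s2 y),
      (* G-invariant, and of cohomogeneity two off {0} x C *)
      invariant_set ext_act G L /\
      cohomogeneity ext_act G m 2 (L `&` off_axis),
      (* an immersed Lagrangian off {0} x C *)
      (forall p, D' p ->
         [/\ immersion_mod F D' (isotropy std_act G V) p,
             real_dim (tangent F D' p) m
           & isotropic (tangent F D' p)]),
      (a = 0 -> b = 0 ->
         special_lagrangian F D' /\
         exists t0 : R, lagrangian_angle F D' (fun=> t0))
    & (a = 1 -> b = -1 ->
         lagrangian_translator F D' (- elast) /\
         exists t0 : R, lagrangian_angle F D'
           (fun p => dot (F p) (cplxJ elast) + t0)) /\
      (a = -1 -> b = 1 ->
         lagrangian_translator F D' elast /\
         exists t0 : R, lagrangian_angle F D'
           (fun p => - dot (F p) (cplxJ elast) + t0))].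
Proof.
(* Writing m = n + 2 makes the matrix size m.-1 a successor and turns m - 2 into n. *)
case: m hm G hG hGSU hGc hGconn Z hZ hZlag z' hz' hz'0 V hVP hV hgam_eq hxi_eq => [|[|n]] //.
move=> _ G hG hGSU hGc _ Z [z0 _ ZE] _ z' hz' _ V [u VE] nV.
rewrite subSS subSS subn0 => sgam sxi.
(* V is a complex multiple of z', where mu vanishes, and [momentless] is invariant under complex
   scaling. *)
have mV : momentless G V.
  rewrite VE; apply/momentlessZ/(zero_level_momentless hG hGSU).
  by move: hz'; rewrite ZE => /connected_component_sub.
have S : construction G V I1 I2 gam xi s1 s2.
  by split=> //; exact: normalized_unit hG hGSU mV nV.
move=> D F L D'.
have lF := liouville_primitiveF S.
have [t0 angle] := angleF S nV sgam sxi.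
split.
- by split=> //; eexists; exact: lF.
- split; first exact: (invariantF S).
  by apply: (cohomogeneityF S); rewrite subSS subSS subn0; case: nV.
- move=> p Dp; split; [exact: (immersionF S)| |exact: (tangent_isotropic S)].
  have [s os] := ex_orthonormal_basis (tangent_subspace S Dp).
  have [ss _ _] := tangent_volume S nV Dp os.
  by exists s; [rewrite ss addn1|case: os].
- move=> a0 b0; split; first exact: (special_lagrangianF S nV sgam sxi).
  exists t0; move: angle; congr lagrangian_angle; apply/funext => p.
  by move: (beta _ _ _) (beta _ _ _) => v w; rewrite a0 b0 !mul0r !subr0.
- split=> ha hb.
    split.
      (* This is the case eps = -1; the direction is written as a real multiple of e. *)
      rewrite -scaleN1r -[-1](rmorphN1 (real_complex R)).
      by apply: (lagrangian_translatorF S nV sgam sxi); rewrite ?opprK.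
    exists t0; move: angle; congr lagrangian_angle; apply/funext => p.
    rewrite /F dot_F_Jelast ha hb.
    by move: (beta _ _ _) (beta _ _ _) => v w; ring.
  split.
    rewrite -[elast]scale1r -[1](rmorph1 (real_complex R)).
    exact: (lagrangian_translatorF S nV sgam sxi).
  exists t0; move: angle; congr lagrangian_angle; apply/funext => p.
  rewrite /F dot_F_Jelast ha hb.
    by move: (beta _ _ _) (beta _ _ _) => v w; ring.
Qed.
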